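(* Let $1<p<\infty$, $q:=p/(p-1)$, let $X$ be a convenient measure space (one that either has no atoms or has infinitely many atoms), $\mathbf{L}:=L_p(X)$, and let $Y$ and $Z$ be measure spaces. Consider $L_q(Y)$, $L_q(Z)$ and $L_q(Y)\otimes^q L_q(Z)$ as $\mathbf{L}$-spaces with the minimal quantization, where $L_q(Y)\otimes^qL_q(Z)$ is the dense normed subspace of $L_q(Y\times Z)$ consisting of the functions $\sum_{k=1}^n f_k(s)g_k(t)$ with $f_k\in L_q(Y)$, $g_k\in L_q(Z)$. Then $$L_q(Y)\otimes_{p\mathbf{L}}L_q(Z)=L_q(Y)\otimes^qL_q(Z),$$ in the sense that there exists an $\mathbf{L}$-isometric isomorphism from the left-hand side onto the right-hand side, well defined by the rule $x\otimes y\mapsto x(s)y(t)$, $s\in Y$, $t\in Z$.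
   Context: Spaces are over $\mathbb{C}$; $\otimes$ is the algebraic tensor product and $\otimes_{in}$ the non-completed injective tensor product of normed spaces. All measures are assumed to have a countable basis, i.e. they are $\sigma$-finite and there is a countable family of measurable sets approximating every set of finite measure in the metric $\mu(A\triangle B)$ (so there are at most countably many atoms); $X$ has positive measure. $\diamond$-operation: fix an arbitrary isometric isomorphism $i:L_p(X\times X)\to L_p(X)$ (it exists under the conditions on $X$) and put $\xi\diamond\eta:=i(\xi(s)\eta(t))$ for $\xi,\eta\in L_p(X)$. $\mathcal{B}(\mathbf{L})$ is the algebra of bounded operators on $\mathbf{L}$. For a linear space $E$, $\mathbf{L}E:=\mathbf{L}\otimes E$, with elementary tensors written $\xi x$, is a left $\mathcal{B}(\mathbf{L})$-module via $a\cdot(\xi x)=a(\xi)x$. An $\mathbf{L}$-norm on $E$ is a norm on $\mathbf{L}E$ with $\|a\cdot u\|\le\|a\|\|u\|$ for all $a\in\mathcal{B}(\mathbf{L})$, $u\in\mathbf{L}E$; an $\mathbf{L}$-space is a linear space with an $\mathbf{L}$-norm. The minimal quantization of a normed space $E$ is the $\mathbf{L}$-space $E$ whose $\mathbf{L}$-norm is the norm of $\mathbf{L}\otimes_{in}E$ on $\mathbf{L}E$. For $u\in\mathbf{L}E$, $v\in\mathbf{L}F$, the element $u\diamond v\in\mathbf{L}(E\otimes F)$ is defined by bilinear extension of $\xi x\diamond\eta y:=(\xi\diamond\eta)(x\otimes y)$. For measurable $X'\subseteq X$, $L_p(X')$ is identified with the subspace of $L_p(X)$ of functions vanishing outside $X'$.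 An isometric operator on $L_p(X)$ is a proper isometry if its image is $L_p(X')$ for some measurable $X'\subseteq X$; two proper isometries are disjoint if their images intersect in $\{0\}$. For $\mathbf{L}$-spaces $E,F$, $E\otimes_{p\mathbf{L}}F$ is the linear space $E\otimes F$ with the $\mathbf{L}$-norm $$\|U\|_{p\mathbf{L}}:=\inf\Big\{\|a\|\Big(\sum_{k=1}^n\|u_k\|^p\|v_k\|^p\Big)^{1/p}\Big\},\qquad U\in\mathbf{L}(E\otimes F),$$ the infimum being over all representations $U=a\cdot\sum_{k=1}^n I_k\cdot(u_k\diamond v_k)$ with $a\in\mathcal{B}(\mathbf{L})$, $u_k\in\mathbf{L}E$, $v_k\in\mathbf{L}F$ and $I_k$ pairwise disjoint proper isometries on $\mathbf{L}$. A linear operator $\varphi:E\to F$ between $\mathbf{L}$-spaces is an $\mathbf{L}$-isometric isomorphism if its amplification $\varphi_\infty:\mathbf{L}E\to\mathbf{L}F$, $\xi x\mapsto\xi\varphi(x)$, is an isometric isomorphism. *)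

(* Defs.v *)
From HB Require Import structures.
From mathcomp Require Import all_boot all_order all_algebra.
From mathcomp Require Import generic_quotient ring_quotient complex.
From mathcomp Require Import all_classical all_reals all_analysis.
From mathcomp Require Import measurable_realfun.

Set Implicit Arguments.
Unset Strict Implicit.
Unset Printing Implicit Defensive.
Import Order.TTheory GRing.Theory Num.Theory.
Import numFieldNormedType.Exports.

Local Open Scope quotient_scope.
Local Open Scope classical_set_scope.
Local Open Scope ring_scope.

Section Tensor.
Variables (K : comNzRingType) (V W : lmodType K).
Implicit Types s t : seq (V * W).

Definition fsum (U : lmodType K) (b : V -> W -> U) s : U :=
  \sum_(z <- s) b z.1 z.2.

(* Formal sums of pairs, identified when every bilinear map takes the same value
   on both; this is the algebraic tensor product, since a scalar coefficient can
   be absorbed in the first factor. *)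
Definition tequiv s t : bool :=
  `[< forall (U : lmodType K) (b : {bilinear V -> W -> U}),
      fsum b s = fsum b t >].

Lemma tequiv_refl : reflexive tequiv.
Proof. by move=> s; apply/asboolP. Qed.

Lemma tequiv_sym : symmetric tequiv.
Proof.
move=> s t; apply/idP/idP => /asboolP st; apply/asboolP => U b;
  exact/esym/st.
Qed.

Lemma tequiv_trans : transitive tequiv.
Proof.
move=> t s r /asboolP st /asboolP tr; apply/asboolP => U b.
by rewrite st tr.
Qed.

Canonical tequiv_equiv := EquivRel tequiv tequiv_refl tequiv_sym tequiv_trans.

Definition tensor : Type := {eq_quot tequiv}.
HB.instance Definition _ := Choice.on tensor.
HB.instance Definition _ := EqQuotient.on tensor.

(* The linear extension of b; it only makes sense when b is bilinear. *)
Definition tlift (U : lmodType K) (b : V -> W -> U) (u : tensor) : U :=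
  fsum b (repr u).

Lemma tliftE (U : lmodType K) (b : {bilinear V -> W -> U}) s :
  tlift b (\pi_tensor s) = fsum b s.
Proof.
have /eqmodP /asboolP : (repr (\pi_tensor s) = s %[mod tensor]).
  by rewrite reprK.
exact.
Qed.

Lemma tensor_eqP s t :
  (forall (U : lmodType K) (b : {bilinear V -> W -> U}),
    fsum b s = fsum b t) -> (\pi_tensor s = \pi_tensor t).
Proof. by move=> st; apply/eqmodP/asboolP. Qed.

Lemma fsum_repr (U : lmodType K) (b : {bilinear V -> W -> U}) s :
  fsum b (repr (\pi_tensor s)) = fsum b s.
Proof. exact: tliftE. Qed.

Definition tscale_seq (a : K) s := [seq (a *: z.1, z.2) | z <- s].

Lemma fsum_cat (U : lmodType K) (b : V -> W -> U) s t :
  fsum b (s ++ t) = fsum b s + fsum b t.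
Proof. exact: big_cat. Qed.

Lemma fsum_scale (U : lmodType K) (b : {bilinear V -> W -> U}) a s :
  fsum b (tscale_seq a s) = a *: fsum b s.
Proof.
rewrite /fsum big_map scaler_sumr; apply: eq_bigr => z _ /=.
by rewrite linearZl_LR.
Qed.

Definition tzero : tensor := (\pi_tensor [::]).
Definition tadd (u v : tensor) : tensor := (\pi_tensor (repr u ++ repr v)).
Definition tscale (a : K) (u : tensor) : tensor :=
  (\pi_tensor (tscale_seq a (repr u))).
Definition topp (u : tensor) : tensor := tscale (-1) u.

Definition tE := (fsum_cat, fsum_repr, fsum_scale).

Let taddA : associative tadd.
Proof. by move=> u v w; apply: tensor_eqP => U b; rewrite !tE addrA. Qed.

Let taddC : commutative tadd.
Proof. by move=> u v; apply: tensor_eqP => U b; rewrite !tE addrC. Qed.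

Let tadd0 : left_id tzero tadd.
Proof.
move=> u; rewrite -[RHS]reprK; apply: tensor_eqP => U b.
by rewrite !tE /fsum big_nil add0r.
Qed.

Let taddN : left_inverse tzero topp tadd.
Proof.
move=> u; apply: tensor_eqP => U b.
by rewrite !tE scaleN1r addNr /fsum big_nil.
Qed.

HB.instance Definition _ := GRing.isZmodule.Build tensor taddA taddC tadd0 taddN.

Let tscaleA a b (u : tensor) : tscale a (tscale b u) = tscale (a * b) u.
Proof. by apply: tensor_eqP => U c; rewrite !tE scalerA. Qed.

Let tscale1 : left_id 1 tscale.
Proof.
by move=> u; rewrite -[RHS]reprK; apply: tensor_eqP => U c; rewrite !tE scale1r.
Qed.

Let tscaleDr : right_distributive tscale +%R.
Proof. by move=> a u v; apply: tensor_eqP => U c; rewrite !tE scalerDr. Qed.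

Let tscaleDl u : {morph tscale^~ u : a b / a + b}.
Proof. by move=> a b; apply: tensor_eqP => U c; rewrite !tE scalerDl. Qed.

HB.instance Definition _ := GRing.Zmodule_isLmodule.Build K tensor
  tscaleA tscale1 tscaleDr tscaleDl.

Definition tmul (x : V) (y : W) : tensor := (\pi_tensor [:: (x, y)]).

Lemma fsum_tmul (U : lmodType K) (b : V -> W -> U) x y :
  fsum b [:: (x, y)] = b x y.
Proof. by rewrite /fsum big_seq1. Qed.

Lemma tmul_is_bilinear : bilinear_for *:%R *:%R tmul.
Proof.
split=> [y a x x'|x a y y']; apply: tensor_eqP => U b;
  rewrite !tE !fsum_tmul.
- by rewrite linearPl.
- by rewrite linearPr.
Qed.
HB.instance Definition _ := bilinear_isBilinear.Build K V W tensor
  *:%R *:%R tmul tmul_is_bilinear.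

Lemma tlift_tmul (U : lmodType K) (b : {bilinear V -> W -> U}) x y :
  tlift b (tmul x y) = b x y.
Proof. by rewrite tliftE fsum_tmul. Qed.

Lemma tlift_is_linear (U : lmodType K) (b : {bilinear V -> W -> U}) :
  linear (tlift b).
Proof. by move=> a u v; rewrite /tlift !tE. Qed.

Lemma tlift_tmul_for (U : lmodType K) (b : V -> W -> U) x y :
  bilinear_for *:%R *:%R b -> tlift b (tmul x y) = b x y.
Proof.
move=> bb.
pose c : {bilinear V -> W -> U} := HB.pack b (bilinear_isBilinear.Build
  K V W U *:%R *:%R b bb).
exact: (tlift_tmul c).
Qed.

Lemma tlift_is_linear_for (U : lmodType K) (b : V -> W -> U) :
  bilinear_for *:%R *:%R b -> linear (tlift b).
Proof.
move=> bb.
pose c : {bilinear V -> W -> U} := HB.pack b (bilinear_isBilinear.Build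
  K V W U *:%R *:%R b bb).
exact: (tlift_is_linear c).
Qed.

Lemma tensor_sum (u : tensor) : u = \sum_(z <- repr u) tmul z.1 z.2.
Proof.
rewrite -{1}[u]reprK; elim: (repr u) => [|[x y] s IHs]; first by rewrite big_nil.
rewrite big_cons -IHs; apply: tensor_eqP => U b.
by rewrite !tE fsum_tmul /fsum big_cons.
Qed.

End Tensor.

Notation normc := Normc.normc.

Section LpFun.
Context d (T : measurableType d) (R : realType) (mu : {measure set T -> \bar R}).
Variables (p : R) (p1 : 1 <= p).
Implicit Types f g : T -> R[i].

Definition cmeasurable f :=
  measurable_fun setT (@complex.Re R \o f) /\ measurable_fun setT (@complex.Im R \o f).

Definition Lp_fun : {pred T -> R[i]} :=
  mem [set f | cmeasurable f /\ finite_norm mu p%:E (@normc R \o f)].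

Lemma measurable_normc f : cmeasurable f ->
  measurable_fun setT (@normc R \o f).
Proof.
move=> [mr mi].
rewrite (_ : _ \o f = (fun x => (complex.Re (f x) ^+ 2 + complex.Im (f x) ^+ 2) `^ 2^-1)).
  apply: (measurableT_comp (measurable_powR 2^-1)).
  by apply: measurable_funD; apply: (measurableT_comp (exprn_measurable 2)).
apply/funext => x /=; rewrite powR12_sqrt ?addr_ge0 ?sqr_ge0//.
by case: (f x).
Qed.

Lemma normc_ge0 (z : R[i]) : 0 <= normc z.
Proof. by case: z => a b; exact: sqrtr_ge0. Qed.

Lemma normc_lec (z : R[i]) : `|z| = (normc z)%:C%C.
Proof. by []. Qed.

Lemma le_Lnorm_normc (f : T -> R[i]) (g : T -> R) : cmeasurable f ->
  measurable_fun setT g ->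
  (forall x, normc (f x) <= `|g x|) ->
  ('N[mu]_p%:E[EFin \o (@normc R \o f)] <= 'N[mu]_p%:E[EFin \o g])%E.
Proof.
move=> mf mg fg; have p0 : 0 <= p := le_trans ler01 p1.
rewrite unlock /Lnorm; apply: gt0_ler_poweR; rewrite ?invr_ge0//.
- by rewrite in_itv/= leey integral_ge0// => x _; rewrite poweR_ge0.
- by rewrite in_itv/= leey integral_ge0// => x _; rewrite poweR_ge0.
apply: ge0_le_integral => //.
- by move=> x _; rewrite poweR_ge0.
- apply: (measurableT_comp (measurable_poweR p)).
  apply: measurableT_comp => //.
  by apply/measurable_EFinP; exact: measurable_normc.
- apply: (measurableT_comp (measurable_poweR p)).
  apply: measurableT_comp => //.
  exact/measurable_EFinP.
move=> x _ /=; rewrite lee_fin ge0_ler_powR ?nnegrE//.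
by rewrite ger0_norm ?normc_ge0.
Qed.

Lemma cmeasurableD f g : cmeasurable f -> cmeasurable g ->
  cmeasurable (f + g).
Proof.
move=> [fr fi] [gr gi]; split.
- rewrite (_ : _ \o _ = (@complex.Re R \o f) \+ (@complex.Re R \o g)); last first.
    by apply/funext => x /=; rewrite !fctE; case: (f x); case: (g x).
  exact: measurable_funD.
- rewrite (_ : _ \o _ = (@complex.Im R \o f) \+ (@complex.Im R \o g)); last first.
    by apply/funext => x /=; rewrite !fctE; case: (f x); case: (g x).
  exact: measurable_funD.
Qed.

Lemma cmeasurableM f g : cmeasurable f -> cmeasurable g ->
  cmeasurable (fun x => f x * g x).
Proof.
move=> [fr fi] [gr gi]; split.
- rewrite (_ : _ \o _ = (fun x =>
      complex.Re (f x) * complex.Re (g x) - complex.Im (f x) * complex.Im (g x))); last first.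
    by apply/funext => x /=; case: (f x); case: (g x).
  by apply: measurable_funB; apply: measurable_funM.
- rewrite (_ : _ \o _ = (fun x =>
      complex.Re (f x) * complex.Im (g x) + complex.Im (f x) * complex.Re (g x))); last first.
    by apply/funext => x /=; case: (f x); case: (g x).
  by apply: measurable_funD; apply: measurable_funM.
Qed.

Lemma cmeasurable_cst (z : R[i]) : cmeasurable (fun=> z).
Proof. by split; apply: measurable_cst. Qed.

Lemma Lnorm_normcD f g : cmeasurable f -> cmeasurable g ->
  ('N[mu]_p%:E[EFin \o (@normc R \o (f + g)%R)] <=
   'N[mu]_p%:E[EFin \o (@normc R \o f)] +
   'N[mu]_p%:E[EFin \o (@normc R \o g)])%E.
Proof.
move=> mf mg.
apply: (@le_trans _ _
  'N[mu]_p%:E[EFin \o ((@normc R \o f) \+ (@normc R \o g))%R]%E).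
  apply: le_Lnorm_normc; first exact: cmeasurableD.
    by apply: measurable_funD; apply: measurable_normc.
  by move=> x; rewrite ger0_norm ?addr_ge0 ?normc_ge0//; apply: le_normcD.
by apply: eminkowski; rewrite ?lee_fin//; exact: measurable_normc.
Qed.

Lemma Lnorm_normcZ a f : cmeasurable f ->
  ('N[mu]_p%:E[EFin \o (@normc R \o (a *: f)%R)] =
   (normc a)%:E * 'N[mu]_p%:E[EFin \o (@normc R \o f)])%E.
Proof.
move=> mf; have p0 : 0 < p := lt_le_trans ltr01 p1.
rewrite unlock /Lnorm.
under eq_integral => x _.
  rewrite /= [normc _](_ : _ = normc a * normc (f x)); last exact: Normc.normcM.
  rewrite normrM powRM// EFinM.
  over.
rewrite ge0_integralZl//; last first.
  exact: (measurableT_comp (measurable_poweR p)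
    (measurableT_comp (@abse_measurable R setT)
      ((measurable_EFinP _ _).2 (measurable_normc mf)))).
rewrite poweRM ?lee_fin ?powR_ge0 ?integral_ge0//.
rewrite poweR_EFin -powRrM mulfV ?gt_eqF// powRr1 ?normr_ge0//.
by rewrite ger0_norm ?normc_ge0.
Qed.

Lemma Lp_fun_submod_closed : submod_closed Lp_fun.
Proof.
split.
  rewrite inE; split; first exact: cmeasurable_cst.
  rewrite /finite_norm (_ : _ \o _ = cst 0%E); last first.
    by apply/funext => x; exact: (congr1 EFin (@Normc.normc0 R)).
  by rewrite Lnorm0 ?eqe ?gt_eqF ?(lt_le_trans ltr01).
move=> a f g; rewrite !inE => -[mf lf] [mg lg].
have mZ : cmeasurable (a *: f).
  exact: (cmeasurableM (cmeasurable_cst a) mf).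
split; first exact: cmeasurableD.
rewrite /finite_norm (le_lt_trans (Lnorm_normcD _ _))// lte_add_pinfty//.
rewrite Lnorm_normcZ// lte_mul_pinfty ?lee_fin ?normc_ge0//.
Qed.

End LpFun.

Section LpFunType.
Context d (T : measurableType d) (R : realType) (mu : {measure set T -> \bar R}).
Context (p : R).

Record LpFun (p1 : 1 <= p) := MkLpFun {
  LpFun_fun :> T -> R[i];
  LpFun_prop : LpFun_fun \in Lp_fun mu p }.

Variable p1 : 1 <= p.

HB.instance Definition _ := [isSub for @LpFun_fun p1].
HB.instance Definition _ := [Choice of LpFun p1 by <:].
HB.instance Definition _ := GRing.isSubmodClosed.Build R[i] (T -> R[i])
  (Lp_fun mu p) (Lp_fun_submod_closed mu p1).
HB.instance Definition _ := [SubChoice_isSubLmodule of LpFun p1 by <:].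

Definition Lp_null : {pred LpFun p1} :=
  mem [set f : LpFun p1 | {ae mu, forall x, f x = 0}].

Lemma Lp_null_zmod_closed : zmod_closed Lp_null.
Proof.
split; first by rewrite inE; apply: aeW.
move=> f g; rewrite !inE => f0 g0.
by apply: filterS2 f0 g0 => x fx gx; rewrite /= !fctE/= fx gx subr0.
Qed.

HB.instance Definition _ := GRing.isZmodClosed.Build (LpFun p1)
  Lp_null Lp_null_zmod_closed.

(* Complex L_p: p-integrable functions modulo almost everywhere zero ones. *)
Definition Lp : Type := Quotient.quot (Lp_null : zmodClosed (LpFun p1)).
HB.instance Definition _ := GRing.Zmodule.on Lp.
HB.instance Definition _ := EqQuotient.on Lp.

Definition Lp_pi (f : LpFun p1) : Lp := \pi_Lp f.

Lemma Lp_piP (f g : LpFun p1) :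
  Lp_pi f = Lp_pi g <-> {ae mu, forall x, f x = g x}.
Proof.
have E : (f == g %[mod Lp]) = (f - g \in Lp_null).
  by rewrite [RHS]Quotient.idealrBE.
split=> [/eqP fg|fg].
  move: fg; rewrite /Lp_pi E inE; apply: filterS => x /eqP.
  by rewrite subr_eq0 => /eqP.
apply/eqP; rewrite /Lp_pi E inE; move: fg; apply: filterS => x /= fg.
by rewrite !fctE/= fg subrr.
Qed.

Lemma Lp_piD (f g : LpFun p1) : Lp_pi (f + g) = Lp_pi f + Lp_pi g.
Proof. exact: (raddfD \pi_Lp). Qed.

Definition Lp_scale (a : R[i]) (u : Lp) : Lp := Lp_pi (a *: repr u).

Lemma Lp_reprK (u : Lp) : Lp_pi (repr u) = u.
Proof. exact: reprK. Qed.

Lemma Lp_repr_pi (f : LpFun p1) : {ae mu, forall x, repr (Lp_pi f) x = f x}.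
Proof. by apply/Lp_piP; exact: Lp_reprK. Qed.

Lemma Lp_piZ a (f : LpFun p1) : Lp_pi (a *: f) = Lp_scale a (Lp_pi f).
Proof.
apply/Lp_piP; apply: filterS (Lp_repr_pi f) => x fx.
by rewrite /= !fctE/= fx.
Qed.

Let scaleA a b (u : Lp) : Lp_scale a (Lp_scale b u) = Lp_scale (a * b) u.
Proof. by rewrite -[u]Lp_reprK -!Lp_piZ scalerA. Qed.

Let scale1 : left_id 1 Lp_scale.
Proof. by move=> u; rewrite -[u]Lp_reprK -!Lp_piZ scale1r. Qed.

Let scaleDr : right_distributive Lp_scale +%R.
Proof.
move=> a u v; rewrite -[u]Lp_reprK -[v]Lp_reprK.
by rewrite -!Lp_piZ -!Lp_piD -Lp_piZ scalerDr.
Qed.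

Let scaleDl u : {morph Lp_scale^~ u : a b / a + b}.
Proof.
by move=> a b; rewrite -[u]Lp_reprK -!Lp_piZ -Lp_piD scalerDl.
Qed.

HB.instance Definition _ := GRing.Zmodule_isLmodule.Build R[i] Lp
  scaleA scale1 scaleDr scaleDl.

Lemma Lp_pi_is_linear : linear (Lp_pi : LpFun p1 -> Lp).
Proof. by move=> a f g; rewrite Lp_piD Lp_piZ. Qed.

Definition Lpfun_norm (f : T -> R[i]) : R :=
  fine 'N[mu]_p%:E[EFin \o (@normc R \o f)].

Lemma LpFun_cmeasurable (f : LpFun p1) : cmeasurable f.
Proof. by case: f => f /=; rewrite inE => -[]. Qed.

Lemma LpFun_finite (f : LpFun p1) :
  ((Lpfun_norm f)%:E = 'N[mu]_p%:E[EFin \o (@normc R \o f)])%E.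
Proof.
rewrite /Lpfun_norm fineK// ge0_fin_numE ?Lnorm_ge0//.
by case: f => f /=; rewrite inE => -[].
Qed.

Lemma Lpfun_norm_ae (f g : LpFun p1) :
  {ae mu, forall x, f x = g x} -> Lpfun_norm f = Lpfun_norm g.
Proof.
move=> fg; rewrite /Lpfun_norm unlock /Lnorm; congr (fine (_ `^ _)).
have mN (h : LpFun p1) : measurable_fun setT
    (fun x => (`|(EFin \o (@normc R \o h)) x| `^ p)%E).
  exact: (measurableT_comp (measurable_poweR p)
    (measurableT_comp (@abse_measurable R setT)
      ((measurable_EFinP _ _).2 (measurable_normc (LpFun_cmeasurable h))))).
apply: ae_eq_integral => //.
by apply: filterS fg => x fgx _ /=; rewrite fgx.
Qed.

Definition Lp_norm (u : Lp) : R := Lpfun_norm (repr u).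

Lemma Lp_norm_pi (f : LpFun p1) : Lp_norm (Lp_pi f) = Lpfun_norm f.
Proof. exact/Lpfun_norm_ae/Lp_repr_pi. Qed.

Let ler_Lp_normD (u v : Lp) :
  (Lp_norm (u + v))%:C%C <= (Lp_norm u)%:C%C + (Lp_norm v)%:C%C.
Proof.
rewrite -rmorphD lecR -[u]Lp_reprK -[v]Lp_reprK -Lp_piD !Lp_norm_pi.
rewrite -lee_fin EFinD !LpFun_finite.
exact: (Lnorm_normcD _ p1 (LpFun_cmeasurable _) (LpFun_cmeasurable _)).
Qed.

Let Lp_normZ (a : R[i]) (u : Lp) :
  (Lp_norm (a *: u))%:C%C = `|a| * (Lp_norm u)%:C%C.
Proof.
rewrite normc_lec -rmorphM; congr (_%:C)%C.
rewrite -[u]Lp_reprK -[a *: _]Lp_piZ !Lp_norm_pi.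
apply: EFin_inj; rewrite EFinM !LpFun_finite.
exact: (Lnorm_normcZ _ p1 _ (LpFun_cmeasurable _)).
Qed.

Let Lp_norm0_eq0 (u : Lp) : (Lp_norm u)%:C%C = 0 -> u = 0.
Proof.
move=> /(congr1 (@complex.Re R))/= u0.
have mu0 := (measurable_EFinP _ _).2 (measurable_normc (LpFun_cmeasurable (repr u))).
have := @Lnorm_eq0_eq0 _ _ _ mu _ p%:E mu0.
rewrite lte_fin (lt_le_trans ltr01 p1) -LpFun_finite -/(Lp_norm u) u0.
move=> /(_ isT erefl) {}u0.
rewrite -[u]Lp_reprK -[0](raddf0 \pi_Lp); apply/Lp_piP.
apply: filterS u0 => x /(_ I) [] /=; exact: Normc.eq0_normc.
Qed.

HB.instance Definition _ := Lmodule_isNormed.Build R[i] Lp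
  ler_Lp_normD Lp_normZ Lp_norm0_eq0.

End LpFunType.

Section LpProduct.
Context dS dT (S : measurableType dS) (T : measurableType dT) (R : realType).
Variables (nu : {sigma_finite_measure set S -> \bar R}).
Variables (la : {sigma_finite_measure set T -> \bar R}).
Variables (p : R) (p1 : 1 <= p).

Lemma cmeasurable_fst (f : S -> R[i]) :
  cmeasurable f -> cmeasurable (fun z : S * T => f z.1).
Proof.
by move=> [fr fi]; split;
  [exact: (measurableT_comp fr measurable_fst)|
   exact: (measurableT_comp fi measurable_fst)].
Qed.

Lemma cmeasurable_snd (g : T -> R[i]) :
  cmeasurable g -> cmeasurable (fun z : S * T => g z.2).
Proof.
by move=> [fr fi]; split;
  [exact: (measurableT_comp fr measurable_snd)|
   exact: (measurableT_comp fi measurable_snd)].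
Qed.

Lemma Lnorm_prod (f : S -> R[i]) (g : T -> R[i]) :
  cmeasurable f -> cmeasurable g ->
  ('N[(nu \x la)%E]_p%:E
     [EFin \o (@normc R \o (fun z => f z.1 * g z.2)%R)] =
   'N[nu]_p%:E[EFin \o (@normc R \o f)] *
   'N[la]_p%:E[EFin \o (@normc R \o g)])%E.
Proof.
move=> mf mg.
have mp d (U : measurableType d) (h : U -> R[i]) : cmeasurable h ->
    measurable_fun setT (fun x => (`|(EFin \o (@normc R \o h)) x| `^ p)%E).
  move=> mh; exact: (measurableT_comp (measurable_poweR p)
    (measurableT_comp (@abse_measurable R setT)
      ((measurable_EFinP _ _).2 (measurable_normc mh)))).
rewrite unlock /Lnorm fubini_tonelli1; first last.
- by move=> z; rewrite poweR_ge0.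
- by apply: mp; apply: cmeasurableM;
    [exact: cmeasurable_fst|exact: cmeasurable_snd].
have ip d (U : measurableType d) (m : {measure set U -> \bar R}) h :
    (0 <= \int[m]_x (`|h x| `^ p))%E.
  by apply: integral_ge0 => x _; rewrite poweR_ge0.
rewrite -poweRM//; congr (_ `^ _)%E.
rewrite -ge0_integralZr//; last 2 first.
- exact: (mp _ _ _ mf).
- by move=> x _; rewrite poweR_ge0.
apply: eq_integral => x _; rewrite /fubini_F.
rewrite -ge0_integralZl//; first last.
- by rewrite poweR_ge0.
- by move=> y _; rewrite poweR_ge0.
- exact: (mp _ _ _ mg).
apply: eq_integral => y _ /=.
rewrite [normc (_ * _)](_ : _ = normc (f x) * normc (g y)); last exact: Normc.normcM.
by rewrite normrM powRM// EFinM.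
Qed.

Lemma Lp_prod_fun_subproof (f : LpFun nu p1) (g : LpFun la p1) :
  (fun z : S * T => f z.1 * g z.2) \in Lp_fun (nu \x la)%E p.
Proof.
have [mf mg] := (LpFun_cmeasurable f, LpFun_cmeasurable g).
rewrite inE; split.
  by apply: cmeasurableM; [exact: cmeasurable_fst|exact: cmeasurable_snd].
by rewrite /finite_norm Lnorm_prod// -!LpFun_finite -EFinM ltry.
Qed.

Definition Lp_prod_fun (f : LpFun nu p1) (g : LpFun la p1) :
    LpFun (nu \x la)%E p1 :=
  MkLpFun p1 (Lp_prod_fun_subproof f g).

(* The class of (s, t) |-> f s * g t. *)
Definition Lp_prod (f : Lp nu p1) (g : Lp la p1) : Lp (nu \x la)%E p1 :=
  Lp_pi (Lp_prod_fun (repr f) (repr g)).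

Lemma ae_fst (P : S -> Prop) :
  {ae nu, forall x, P x} -> {ae (nu \x la)%E, forall z, P z.1}.
Proof.
move=> [A [mA A0 PA]]; exists (A `*` setT); split; first exact: measurableX.
  apply: (etrans (product_measure1E nu la mA measurableT)).
  by rewrite [X in (X * _)%E]A0 mul0e.
by move=> [x y] /= nP; split => //; exact: PA.
Qed.

Lemma ae_snd (P : T -> Prop) :
  {ae la, forall y, P y} -> {ae (nu \x la)%E, forall z, P z.2}.
Proof.
move=> [A [mA A0 PA]]; exists (setT `*` A); split; first exact: measurableX.
  apply: (etrans (product_measure1E nu la measurableT mA)).
  by rewrite [X in (_ * X)%E]A0 mule0.
by move=> [x y] /= nP; split => //; exact: PA.
Qed.

Lemma Lp_prodE (f : LpFun nu p1) (g : LpFun la p1) :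
  Lp_prod (Lp_pi f) (Lp_pi g) = Lp_pi (Lp_prod_fun f g).
Proof.
apply/Lp_piP.
apply: filterS2 (ae_fst (Lp_repr_pi f)) (ae_snd (Lp_repr_pi g)) => z /= fz gz.
by rewrite fz gz.
Qed.

Lemma Lp_prod_is_bilinear : bilinear_for *:%R *:%R Lp_prod.
Proof.
split=> [g a f f'|f a g g'].
- rewrite -[f]Lp_reprK -[f']Lp_reprK -[g]Lp_reprK.
  rewrite -Lp_pi_is_linear !Lp_prodE; apply: etrans (Lp_pi_is_linear _ _ _).
  congr Lp_pi; apply: val_inj; apply/funext => z /=.
  by rewrite ?fctE mulrDl scalerAl.
- rewrite -[f]Lp_reprK -[g]Lp_reprK -[g']Lp_reprK.
  rewrite -Lp_pi_is_linear !Lp_prodE; apply: etrans (Lp_pi_is_linear _ _ _).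
  congr Lp_pi; apply: val_inj; apply/funext => z /=.
  by rewrite mulrDr; congr (_ + _); exact: mulrCA.
Qed.
HB.instance Definition _ := bilinear_isBilinear.Build R[i] (Lp nu p1) (Lp la p1)
  (Lp (nu \x la)%E p1) *:%R *:%R Lp_prod Lp_prod_is_bilinear.

Definition Lp_alg : {pred Lp (nu \x la)%E p1} :=
  mem [set w | exists s : seq (Lp nu p1 * Lp la p1),
    w = \sum_(z <- s) Lp_prod z.1 z.2].

Lemma Lp_alg_submod_closed : submod_closed Lp_alg.
Proof.
split; first by rewrite inE; exists [::]; rewrite big_nil.
move=> a u v; rewrite !inE => -[s ->] [t ->].
exists ([seq (a *: z.1, z.2) | z <- s] ++ t).
rewrite big_cat big_map scaler_sumr; congr (_ + _).
by apply: eq_bigr => z _ /=; rewrite linearZl_LR.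
Qed.
HB.instance Definition _ := GRing.isSubmodClosed.Build R[i] _
  Lp_alg Lp_alg_submod_closed.

(* The normed subspace of L_p(S x T) of the finite sums of f(s) g(t). *)
Record LpAlg := MkLpAlg {
  LpAlg_val :> Lp (nu \x la)%E p1;
  LpAlg_prop : LpAlg_val \in Lp_alg }.
HB.instance Definition _ := [isSub for LpAlg_val].
HB.instance Definition _ := [Choice of LpAlg by <:].
HB.instance Definition _ := [SubChoice_isSubLmodule of LpAlg by <:].

Let norm_alg (w : LpAlg) : R[i] := `|val w|.

Let norm_algD (u v : LpAlg) : norm_alg (u + v) <= norm_alg u + norm_alg v.
Proof. exact: ler_normD. Qed.

Let norm_algZ a (u : LpAlg) : norm_alg (a *: u) = `|a| * norm_alg u.
Proof. exact: normrZ. Qed.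

Let norm_alg0 (u : LpAlg) : norm_alg u = 0 -> u = 0.
Proof. by move=> /normr0_eq0 u0; apply: val_inj. Qed.

HB.instance Definition _ := Lmodule_isNormed.Build R[i] LpAlg
  norm_algD norm_algZ norm_alg0.

End LpProduct.

Section Tmap.
Context (K : comNzRingType) (V V' W W' : lmodType K).

Definition tmap (f : V -> V') (g : W -> W') : tensor V W -> tensor V' W' :=
  tlift (fun x y => tmul (f x) (g y)).

Lemma tmap_tmul (f : {linear V -> V'}) (g : {linear W -> W'}) x y :
  tmap f g (tmul x y) = tmul (f x) (g y).
Proof.
apply: tlift_tmul_for; split=> [y' a z z'|z a y' z'] /=.
- by rewrite linearP linearPl.
- by rewrite linearP linearPr.
Qed.

Lemma tmap_is_linear (f : {linear V -> V'}) (g : {linear W -> W'}) :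
  linear (tmap f g).
Proof.
apply: tlift_is_linear_for; split=> [y' a z z'|z a y' z'] /=.
- by rewrite linearP linearPl.
- by rewrite linearP linearPr.
Qed.

End Tmap.

Section Quantization.
Context (R : realType) (L : normedModType R[i]).

(* In a normedModType R[i] the norm takes its values in R[i]. *)
Definition rnorm (E : normedModType R[i]) (x : E) : R := complex.Re `|x|.

Definition bounded_op (a : L -> L) : Prop :=
  exists C : R, forall xi, rnorm (a xi) <= C * rnorm xi.

Definition opnorm (a : L -> L) : R :=
  sup [set rnorm (a xi) | xi in [set xi : L | rnorm xi <= 1]].

Definition act (E : lmodType R[i]) (a : L -> L) : tensor L E -> tensor L E :=
  tmap a id.

Definition amp (E F : lmodType R[i]) (phi : E -> F) :
  tensor L E -> tensor L F := tmap id phi.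

(* The norm of the injective tensor product of L and E, that is, the L-norm of
   the minimal quantization of E. *)
Definition inj_norm (E : normedModType R[i]) (u : tensor L E) : R :=
  sup [set r | exists (f : {scalar L}) (g : {scalar E}),
    [/\ forall xi, normc (f xi) <= rnorm xi,
        forall x, normc (g x) <= rnorm x &
        r = normc (tlift (fun xi x => (f xi * g x : R[i]^o)) u)]].

(* An L-norm on E is given by its value function tensor L E -> R. *)
Definition L_isometric_iso (E F : lmodType R[i]) (NE : tensor L E -> R)
    (NF : tensor L F -> R) (phi : E -> F) : Prop :=
  bijective (amp phi) /\ forall u, NF (amp phi u) = NE u.

End Quantization.

Definition isometric (R : realType) (V W : normedModType R[i]) (f : V -> W) :
  Prop := forall x, `|f x| = `|x|.

Section MeasureConditions.
Context d (T : measurableType d) (R : realType).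
Variable mu : {measure set T -> \bar R}.
Local Open Scope ereal_scope.

(* Sigma-finiteness is carried by the type of the measures in use. *)
Definition countable_basis : Prop :=
  exists B : nat -> set T, (forall n, measurable (B n)) /\
    forall A (e : R), measurable A -> mu A < +oo -> (0 < e)%R ->
      exists n, mu (A `+` B n) < e%:E.

Definition atom (A : set T) : Prop :=
  [/\ measurable A, 0 < mu A &
      forall B, measurable B -> B `<=` A -> mu B = 0 \/ mu (A `\` B) = 0].

(* Atoms are counted modulo null sets. *)
Definition infinitely_many_atoms : Prop :=
  exists A : nat -> set T, (forall n, atom (A n)) /\
    forall m n, m <> n -> 0 < mu (A m `+` A n).

Definition convenient : Prop :=
  (forall A, ~ atom A) \/ infinitely_many_atoms.

End MeasureConditions.

Section ProjectiveNorm.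
Context d (X : measurableType d) (R : realType).
Variable mu : {sigma_finite_measure set X -> \bar R}.
Variables (p : R) (p1 : 1 <= p).
Local Notation L := (Lp mu p1).
Implicit Types I J : L -> L.

(* L_p(A) as a subspace of L_p(X); independent of the representative. *)
Definition Lp_on (A : set X) : set L :=
  [set xi : L | {ae mu, forall x, ~ A x -> (repr xi : LpFun mu p1) x = 0}].

Definition proper_isometry I : Prop :=
  isometric I /\ exists2 A, measurable A & range I = Lp_on A.

Definition disjoint_op I J : Prop := range I `&` range J = [set 0].

(* i is meant to be an isometric isomorphism. *)
Variable i : {linear Lp (mu \x mu)%E p1 -> L}.

Definition diam (xi eta : L) : L := i (Lp_prod xi eta).

Definition tdiam (E F : lmodType R[i]) (u : tensor L E) (v : tensor L F) :
    tensor L (tensor E F) :=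
  tlift (fun xi x =>
    tlift (fun eta y => tmul (diam xi eta) (tmul x y)) v) u.

Lemma tdiam_tmul (E F : lmodType R[i]) xi (x : E) eta (y : F) :
  tdiam (tmul xi x) (tmul eta y) = tmul (diam xi eta) (tmul x y).
Proof.
have bv z w : bilinear_for *:%R *:%R
    (fun eta (y : F) => tmul (diam z eta) (tmul w y : tensor E F)).
  split=> [y' a u u'|u a y' z'] /=; first by rewrite /diam linearPr linearP linearPl.
  by rewrite !linearPr.
rewrite /tdiam tlift_tmul_for ?tlift_tmul_for//.
split=> [y' a u u'|u a y' z'] /=; rewrite !tlift_tmul_for//.
- by rewrite /diam linearPl linearP linearPl.
- by rewrite linearPl linearPr.
Qed.

Definition pL_norm (E F : lmodType R[i]) (NE : tensor L E -> R)
    (NF : tensor L F -> R) (U : tensor L (tensor E F)) : R :=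
  inf [set r | exists (n : nat) (a : {linear L -> L})
      (I : 'I_n -> {linear L -> L})
      (u : 'I_n -> tensor L E) (v : 'I_n -> tensor L F),
    [/\ bounded_op a,
        forall k, proper_isometry (I k),
        forall j k, j != k -> disjoint_op (I j) (I k),
        U = act a (\sum_k act (I k) (tdiam (u k) (v k))) &
        r = opnorm a * (\sum_k NE (u k) `^ p * NF (v k) `^ p) `^ p^-1]].

End ProjectiveNorm.

Definition conj_exp (R : realType) (p : R) : R := p / (p - 1).

Lemma conj_exp_ge1 (R : realType) (p : R) : 1 < p -> 1 <= conj_exp p.
Proof.
move=> p1; rewrite /conj_exp ler_pdivlMr ?subr_gt0// mul1r.
by rewrite gerBl ler01.
Qed.

(* Main.v *)
(* For a functional g on E let (id (x) g) u be the slice of u in L (x) E; the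
   injective norm of u is the supremum of |(id (x) g) u| over |g| <= 1, because L
   has norming functionals. Finitely many elements of L_q are approximated by their
   conditional expectations on finitely many disjoint sets of finite measure, whose
   normalized indicators span isometric copies of l_q and have a dual family in L_p.

   Injective <= projective: disjoint proper isometries have almost disjoint supports,
   so it suffices to bound one product u <> v. After conditioning, its slice by g is
   a sum of c_ab alpha_a(s) beta_b(t) with |c|_p <= 1, and Tonelli's theorem bounds it
   by the norms of u and v.

   Projective <= injective: after conditioning, U = sum theta_ab (e_a (x) e_b) is
   a . (u <> v) with u = sum eps_a e_a and v = sum eps'_b e_b, for normalized
   indicators eps, eps' in L; here a is the projection onto the span of the
   eps_a <> eps'_b followed by eps_a <> eps'_b |-> theta_ab, and |a| is at most the
   injective norm of U. The small remainder is absorbed in the same a, u and v on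
   further disjoint indicators. *)

Require Import Defs.
From HB Require Import structures.
From mathcomp Require Import all_boot all_order all_algebra.
From mathcomp Require Import complex ring lra.
From mathcomp Require Import all_classical all_reals all_analysis.
From mathcomp Require Import measurable_realfun.

Set Implicit Arguments.
Unset Strict Implicit.
Unset Printing Implicit Defensive.
Import Order.TTheory GRing.Theory Num.Theory.
Import numFieldNormedType.Exports.

Local Open Scope classical_set_scope.
Local Open Scope ring_scope.

(** * Complex numbers and exponents *)

(** Functionals on [Lp] and [LpAlg] stay arbitrary; none is represented by a function. A functional
    g of norm at most 1 is only tested on the span of normalized indicators, a copy of l_q, and
    finite duality says that its values there have l_p norm at most 1. This gives |c|_p <= 1 in the
    first estimate. In the second it makes the injective norms of u and v at most 1: the slice of u
    by g is sum g(e_a) eps_a, whose norm is the l_p norm of its coefficients. So u and v cost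
    nothing, and |a| alone carries the size of U.

    The remainder left by conditioning is treated without a triangle inequality for the projective
    norm. A summand xi (x) x' (x) y with |x'| <= t^3 is rewritten as (t xi) (x) (t^-2 x') (x) (t y).
    Every factor is now O(t), so adding it to the factorization changes the bounds for |a|, |u| and
    |v| by O(t) each. With w the injective norm, U costs at most (w + tC)(1 + tC)^2, and t tends to
    0. *)

Section ComplexModulus.
Variable R : realType.
Implicit Types (z : R[i]) (r s p q : R).

Lemma normc_mul z w : normc (z * w) = normc z * normc w.
Proof. exact: Normc.normcM. Qed.

Lemma normc_real r : normc (r%:C)%C = `|r|.
Proof. by rewrite /= expr0n/= addr0 sqrtr_sqr. Qed.

Lemma normc_conjc z : normc (z^*)%C = normc z.
Proof. by case: z => a b /=; rewrite sqrrN. Qed.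

Lemma conjc_mul z : ((z^*) * z = (normc z ^+ 2)%:C)%C.
Proof. by rewrite mulrC -sqr_normc normc_lec rmorphXn. Qed.

Lemma normr_Re_le z : `|complex.Re z| <= normc z.
Proof. by have := normc_ge_Re z; rewrite normc_lec lecR. Qed.

Lemma normr_Im_le z : `|complex.Im z| <= normc z.
Proof.
case: z => a b /=; rewrite -sqrtr_sqr ler_wsqrtr//.
by rewrite lerDr sqr_ge0.
Qed.

Lemma normc_le_ReIm z : normc z <= `|complex.Re z| + `|complex.Im z|.
Proof.
case: z => a b /=; rewrite -[leRHS]ger0_norm ?addr_ge0//.
rewrite -sqrtr_sqr ler_wsqrtr// sqrrD !real_normK ?num_real//.
by rewrite lerD2r lerDl mulrn_wge0// mulr_ge0.
Qed.

Lemma normc_sum (I : Type) (s : seq I) (P : pred I) (F : I -> R[i]) :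
  normc (\sum_(k <- s | P k) F k) <= \sum_(k <- s | P k) normc (F k).
Proof.
apply: (big_ind2 (fun x y => normc x <= y)) => //.
  by rewrite Normc.normc0.
by move=> a b c d ab cd; rewrite (le_trans (le_normcD _ _))// lerD.
Qed.

(* The extremal factor in Hoelder's inequality; since conj 0 = 0 it vanishes at
   z = 0, whatever the value of 0 `^ (p - 2). *)
Definition cdual p z : R[i] := ((z^*) * (normc z `^ (p - 2))%:C)%C.

Lemma cdual_mul p z : 1 < p -> z * cdual p z = ((normc z `^ p)%:C)%C.
Proof.
move=> p1; rewrite /cdual mulrA [z * _]mulrC conjc_mul -rmorphM.
congr (_%:C)%C; have [->|z0] := eqVneq (normc z) 0.
  by rewrite [RHS]powR0 ?gt_eqF ?(lt_trans ltr01)// expr2 !mul0r.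
rewrite -powR_mulrn ?normc_ge0// -powRD; last by rewrite z0 implybT.
by congr (_ `^ _); ring.
Qed.

Lemma normc_cdual p z : 1 < p -> normc (cdual p z) = normc z `^ (p - 1).
Proof.
move=> p1; rewrite /cdual normc_mul normc_conjc normc_real ger0_norm ?powR_ge0//.
have [->|z0] := eqVneq (normc z) 0.
  by rewrite mul0r powR0// subr_eq0 gt_eqF.
rewrite -{1}[normc z]powRr1 ?normc_ge0// -powRD; last by rewrite z0 implybT.
by congr (_ `^ _); ring.
Qed.

End ComplexModulus.

Section Exponents.
Variable R : realType.
Implicit Types (p q : R).

Lemma conj_exp_inv p : 1 < p -> p^-1 + (conj_exp p)^-1 = 1.
Proof.
move=> p1; have p0 : p != 0 by rewrite gt_eqF// (lt_trans ltr01).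
have p10 : p - 1 != 0 by rewrite gt_eqF// subr_gt0.
by rewrite /conj_exp; field; rewrite p0 p10.
Qed.

Lemma conjugate_gt1 p q : 1 <= p -> 1 <= q -> p^-1 + q^-1 = 1 -> 1 < p.
Proof.
move=> p1 q1 pq; have q0 : 0 < q^-1 by rewrite invr_gt0 (lt_le_trans ltr01).
have p0 : 0 < p by apply: lt_le_trans p1.
have : p^-1 < 1 by lra.
by rewrite invf_lt1.
Qed.

Lemma conjugate_mulB1 p q : 1 <= p -> 1 <= q -> p^-1 + q^-1 = 1 ->
  (p - 1) * q = p.
Proof.
move=> p1 q1 pq.
have p0 : p != 0 by rewrite gt_eqF// (lt_le_trans ltr01).
have q0 : q != 0 by rewrite gt_eqF// (lt_le_trans ltr01).
have : (p^-1 + q^-1) * p * q = p * q by rewrite pq mul1r.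
have -> : (p^-1 + q^-1) * p * q = q + p by field; rewrite p0 q0.
by move=> h; rewrite mulrBl mul1r -h addrAC subrr add0r.
Qed.

Lemma ler_powR2r (r : R) (x y : R) : 0 < r -> 0 <= x -> 0 <= y ->
  (x `^ r <= y `^ r) = (x <= y).
Proof.
move=> r0 x0 y0; apply/idP/idP => [|xy]; last first.
  by apply: ge0_ler_powR; rewrite ?nnegrE// ltW.
apply: contraTT; rewrite -!ltNge => yx.
by apply: gt0_ltr_powR; rewrite ?nnegrE.
Qed.

Lemma powRK (r x : R) : r != 0 -> 0 <= x -> (x `^ r) `^ r^-1 = x.
Proof. by move=> r0 x0; rewrite -powRrM mulfV// powRr1. Qed.

Lemma powRVK (r x : R) : r != 0 -> 0 <= x -> (x `^ r^-1) `^ r = x.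
Proof. by move=> r0 x0; rewrite -powRrM mulVf// powRr1. Qed.

(** Converse of Hoelder's inequality in l_p. With t a = [cdual p (c a)] the left side becomes S =
    sum |c a|^p and, since (p - 1) q = p, the right side becomes M S^(1/q). Dividing by S^(1/q)
    leaves S^(1/p) <= M. *)
Lemma finite_duality (I : finType) p q (p1 : 1 <= p) (q1 : 1 <= q)
    (pq : p^-1 + q^-1 = 1) (c : I -> R[i]) (M : R) : 0 <= M ->
  (forall t : I -> R[i], normc (\sum_a t a * c a) <=
     M * (\sum_a normc (t a) `^ q) `^ q^-1) ->
  \sum_a normc (c a) `^ p <= M `^ p.
Proof.
move=> M0 /(_ (fun a => cdual p (c a))).
have pgt1 := conjugate_gt1 p1 q1 pq.
have p0 : 0 < p := lt_trans ltr01 pgt1.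
set S := \sum_a normc (c a) `^ p.
have S0 : 0 <= S by apply: sumr_ge0 => a _; exact: powR_ge0.
under eq_bigr do rewrite mulrC cdual_mul//.
rewrite -rmorph_sum normc_real ger0_norm//.
rewrite (_ : \sum_a _ = S); last first.
  apply: eq_bigr => a _; rewrite normc_cdual// -powRrM.
  by rewrite (conjugate_mulB1 p1 q1).
move=> SM; have [S00|Sn0] := eqVneq S 0; first by rewrite S00 powR_ge0.
have Sgt0 : 0 < S by rewrite lt_neqAle eq_sym Sn0.
suff SpM : S `^ p^-1 <= M.
  rewrite -[S](@powRVK p) ?gt_eqF// ler_powR2r// powR_ge0//.
rewrite (_ : p^-1 = 1 - q^-1); last by rewrite -pq addrK.
rewrite powRB; last by rewrite Sn0 implybT.
by rewrite powRr1// ler_pdivrMr// powR_gt0.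
Qed.

End Exponents.

(** * Real-valued norms, complex integrals and representatives of L_p classes *)

Section RealNorm.
Variables (R : realType) (E : normedModType R[i]).
Implicit Types x y : E.

Lemma normr_rnorm x : `|x| = ((rnorm x)%:C)%C.
Proof. by rewrite RRe_real// normr_real. Qed.

Lemma rnorm_ge0 x : 0 <= rnorm x.
Proof. by rewrite -ler0c -normr_rnorm normr_ge0. Qed.

Lemma rnormD x y : rnorm (x + y) <= rnorm x + rnorm y.
Proof. by rewrite -lecR rmorphD/= -!normr_rnorm ler_normD. Qed.

Lemma rnormZ (a : R[i]) x : rnorm (a *: x) = normc a * rnorm x.
Proof.
by apply: complexI; rewrite rmorphM/= -!normr_rnorm normrZ normc_lec.
Qed.

Lemma rnorm0 : rnorm (0 : E) = 0.
Proof. by rewrite /rnorm normr0. Qed.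

Lemma rnormN x : rnorm (- x) = rnorm x.
Proof. by rewrite /rnorm normrN. Qed.

Lemma rnorm_eq0 x : rnorm x = 0 -> x = 0.
Proof. by move=> x0; apply/normr0_eq0; rewrite normr_rnorm x0. Qed.

Lemma rnorm_sum (I : Type) (s : seq I) (F : I -> E) :
  rnorm (\sum_(k <- s) F k) <= \sum_(k <- s) rnorm (F k).
Proof.
elim: s => [|k s IHs]; first by rewrite !big_nil rnorm0.
by rewrite !big_cons (le_trans (rnormD _ _))// lerD2l.
Qed.

Lemma isometric_rnorm (F : normedModType R[i]) (f : E -> F) x :
  isometric f -> rnorm (f x) = rnorm x.
Proof. by move=> fi; rewrite /rnorm fi. Qed.

End RealNorm.

Section ComplexIntegral.
Context d (T : measurableType d) (R : realType).
Variable mu : {measure set T -> \bar R}.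
Implicit Types f g : T -> R[i].

Definition cintegrable f : Prop :=
  mu.-integrable setT (EFin \o (@complex.Re R \o f)) /\
  mu.-integrable setT (EFin \o (@complex.Im R \o f)).

Definition cint f : R[i] :=
  ((\int[mu]_x complex.Re (f x)) +i* (\int[mu]_x complex.Im (f x)))%C.

Lemma cintegrable_le f (h : T -> R) : cmeasurable f ->
  mu.-integrable setT (EFin \o h) -> (forall x, normc (f x) <= h x) ->
  cintegrable f.
Proof.
move=> [mr mi] ih fh; split; apply: le_integrable ih => //.
- exact/measurable_EFinP.
- move=> x _ /=; rewrite lee_fin (le_trans (normr_Re_le _))//.
  by rewrite (le_trans (fh _))// ler_norm.
- exact/measurable_EFinP.
- move=> x _ /=; rewrite lee_fin (le_trans (normr_Im_le _))//.
  by rewrite (le_trans (fh _))// ler_norm.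
Qed.

Lemma cintegrable_cmeasurable f : cintegrable f -> cmeasurable f.
Proof.
by move=> [/measurable_int /measurable_EFinP ? /measurable_int /measurable_EFinP].
Qed.

Lemma integrable_normc f : cintegrable f ->
  mu.-integrable setT (EFin \o (@normc R \o f)).
Proof.
move=> fi; have [fr fim] := fi.
have := integrableD measurableT (integrable_abse fr) (integrable_abse fim).
apply: le_integrable => //.
  by apply/measurable_EFinP/measurable_normc/cintegrable_cmeasurable.
move=> x _ /=; rewrite lee_fin ger0_norm ?normc_ge0//.
by rewrite [leRHS]ger0_norm ?addr_ge0// normc_le_ReIm.
Qed.

Lemma cintD f g : cintegrable f -> cintegrable g ->
  cint (fun x => f x + g x) = cint f + cint g.
Proof.
move=> [fr fi] [gr gi]; rewrite /cint.
rewrite (_ : (fun x => complex.Re (f x + g x)) =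
  (fun x => complex.Re (f x) + complex.Re (g x))); last first.
  by apply/funext => x; case: (f x); case: (g x).
rewrite (_ : (fun x => complex.Im (f x + g x)) =
  (fun x => complex.Im (f x) + complex.Im (g x))); last first.
  by apply/funext => x; case: (f x); case: (g x).
by rewrite !RintegralD.
Qed.

Lemma cintZ (a : R[i]) f : cintegrable f ->
  cint (fun x => a * f x) = a * cint f.
Proof.
move=> [fr fi]; rewrite /cint; case: a => a b.
have iZ (c : R) (h : T -> R) : mu.-integrable setT (EFin \o h) ->
    mu.-integrable setT (EFin \o (fun x => c * h x)).
  by move=> ih; exact: (integrableZl measurableT c ih).
rewrite (_ : (fun x => complex.Re ((a +i* b)%C * f x)) =
  (fun x => a * complex.Re (f x) - b * complex.Im (f x))); last first.
  by apply/funext => x; case: (f x).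
rewrite (_ : (fun x => complex.Im ((a +i* b)%C * f x)) =
  (fun x => a * complex.Im (f x) + b * complex.Re (f x))); last first.
  by apply/funext => x; case: (f x).
rewrite RintegralB ?RintegralD//; try exact: iZ.
by rewrite !RintegralZl.
Qed.

Lemma cintegrableZ (a : R[i]) f : cintegrable f ->
  cintegrable (fun x => a * f x).
Proof.
move=> fi.
apply: (@cintegrable_le _ (fun x => normc a * normc (f x))).
- apply: cmeasurableM; first exact: cmeasurable_cst.
  exact: cintegrable_cmeasurable.
- exact: (integrableZl measurableT (normc a) (integrable_normc fi)).
- by move=> x; rewrite normc_mul.
Qed.

(** Multiplying f by the unimodular w rotates its integral onto the nonnegative real axis, where the
    modulus is the real part and can be estimated under the integral sign. *)
Lemma normc_cint f : cintegrable f ->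
  normc (cint f) <= \int[mu]_x normc (f x).
Proof.
move=> fi; have [z0|z0] := eqVneq (cint f) 0.
  by rewrite z0 Normc.normc0 Rintegral_ge0// => x _; exact: normc_ge0.
have n0 : normc (cint f) != 0 by apply: contra z0 => /eqP/Normc.eq0_normc ->.
pose w : R[i] := (((cint f)^*) * ((normc (cint f))^-1)%:C)%C.
have nw : normc w = 1.
  by rewrite normc_mul normc_conjc normc_real normfV ger0_norm ?normc_ge0// mulfV.
have : complex.Re (cint (fun x => w * f x)) = normc (cint f).
  rewrite cintZ// /w mulrAC conjc_mul -rmorphM/= expr2 -mulrA mulfV// mulr1.
  by [].
move=> <-; rewrite /cint/=.
have wi := cintegrableZ w fi.
apply: le_Rintegral => //; first exact: wi.1.
  exact: integrable_normc.
move=> x _; rewrite (le_trans (ler_norm _))// (le_trans (normr_Re_le _))//.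
by rewrite normc_mul nw mul1r.
Qed.

Lemma cint_ae f g : cmeasurable f -> cmeasurable g ->
  {ae mu, forall x, f x = g x} -> cint f = cint g.
Proof.
move=> [mfr mfi] [mgr mgi] fg; rewrite /cint /Rintegral.
congr ((fine _) +i* (fine _))%C; apply: ae_eq_integral => //.
- exact/measurable_EFinP.
- exact/measurable_EFinP.
- by apply: filterS fg => x /= fgx _; rewrite fgx.
- exact/measurable_EFinP.
- exact/measurable_EFinP.
- by apply: filterS fg => x /= fgx _; rewrite fgx.
Qed.

End ComplexIntegral.

Section LpBasics.
Context d (T : measurableType d) (R : realType).
Variable mu : {measure set T -> \bar R}.
Variables (p : R) (p1 : 1 <= p).
Local Notation Lpt := (Lp mu p1).

Let p0 : 0 < p := lt_le_trans ltr01 p1.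

Lemma rnorm_Lp (u : Lpt) : rnorm u = Lp_norm u.
Proof. by []. Qed.

Lemma Lp_norm_ge0 (u : Lpt) : 0 <= Lp_norm u.
Proof. by rewrite /Lp_norm /Lpfun_norm fine_ge0// Lnorm_ge0. Qed.

Lemma Lpfun_norm_integral (f : T -> R[i]) :
  ('N[mu]_p%:E[EFin \o (@normc R \o f)] `^ p = \int[mu]_x (normc (f x) `^ p)%:E)%E.
Proof.
have pn0 : p != 0 by rewrite gt_eqF.
apply: etrans (poweR_Lnorm _ _ pn0) _; apply: eq_integral => x _ /=.
by rewrite ger0_norm ?normc_ge0.
Qed.

Lemma Lpfun_normP (f : LpFun mu p1) :
  ((Lpfun_norm mu p f `^ p)%:E = \int[mu]_x (normc (f x) `^ p)%:E)%E.
Proof. by rewrite -Lpfun_norm_integral -LpFun_finite poweR_EFin. Qed.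

Lemma Lp_normP (u : Lpt) :
  ((Lp_norm u `^ p)%:E = \int[mu]_x (normc (repr u x) `^ p)%:E)%E.
Proof. exact: Lpfun_normP. Qed.

Lemma measurable_normc_powR (f : T -> R[i]) (r : R) : cmeasurable f ->
  measurable_fun setT (fun x => normc (f x) `^ r).
Proof.
move=> mf; apply: (measurableT_comp (measurable_powR r)).
exact: measurable_normc.
Qed.

Lemma Lp_fun_mem (f : T -> R[i]) : cmeasurable f ->
  (\int[mu]_x (normc (f x) `^ p)%:E < +oo)%E -> f \in Lp_fun mu p.
Proof.
move=> mf fi; rewrite inE; split => //; rewrite /finite_norm.
by move: fi; rewrite -Lpfun_norm_integral; apply: lty_poweRy; rewrite gt_eqF.
Qed.

Lemma Lp_ext (u v : Lpt) : {ae mu, forall x, repr u x = repr v x} -> u = v.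
Proof. by move=> uv; rewrite -[u]Lp_reprK -[v]Lp_reprK; apply/Lp_piP. Qed.

Lemma Lp_repr0 : {ae mu, forall x, repr (0 : Lpt) x = 0}.
Proof.
have /Lp_piP : Lp_pi (repr (0 : Lpt)) = Lp_pi (0 : LpFun mu p1).
  rewrite Lp_reprK -[in RHS](subrr (0 : LpFun mu p1)) -[in RHS]scaleN1r addrC.
  by rewrite Lp_pi_is_linear scaleN1r addNr.
exact.
Qed.

Lemma Lp_reprP (a : R[i]) (u v : Lpt) :
  {ae mu, forall x, repr (a *: u + v) x = a * repr u x + repr v x}.
Proof.
rewrite -[u in a *: u + v]Lp_reprK -[v in _ + v]Lp_reprK -Lp_pi_is_linear.
exact: Lp_repr_pi.
Qed.

Lemma Lp_repr_sum (I : Type) (s : seq I) (c : I -> R[i]) (F : I -> Lpt) :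
  {ae mu, forall x, repr (\sum_(k <- s) c k *: F k) x =
                    \sum_(k <- s) c k * repr (F k) x}.
Proof.
elim: s => [|k s IHs].
  by rewrite big_nil; apply: filterS Lp_repr0 => x; rewrite big_nil.
rewrite big_cons.
apply: filterS2 (Lp_reprP (c k) (F k) (\sum_(j <- s) c j *: F j)) IHs => x xE sE.
by rewrite xE sE big_cons.
Qed.

Lemma Lp_norm_powR_ae (u : Lpt) (f : T -> R[i]) : cmeasurable f ->
  {ae mu, forall x, repr u x = f x} ->
  ((Lp_norm u `^ p)%:E = \int[mu]_x (normc (f x) `^ p)%:E)%E.
Proof.
move=> mf uf; rewrite Lp_normP; apply: ae_eq_integral => //.
- exact/measurable_EFinP/measurable_normc_powR/LpFun_cmeasurable.
- exact/measurable_EFinP/measurable_normc_powR.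
- by apply: filterS uf => x /= -> _.
Qed.

End LpBasics.

(** * The duality of L_p and L_q *)

Section Pairing.
Context d (T : measurableType d) (R : realType).
Variable mu : {measure set T -> \bar R}.
Variables (p q : R) (p1 : 1 <= p) (q1 : 1 <= q).

(** Bilinear rather than sesquilinear: either argument then defines a complex-linear functional, and
    the conjugation needed for norming sits in [cdual]. *)
Definition pair (u : Lp mu p1) (v : Lp mu q1) : R[i] :=
  cint mu (fun x => repr u x * repr v x).

Hypothesis pq : p^-1 + q^-1 = 1.

Let p0 : 0 < p := lt_le_trans ltr01 p1.
Let q0 : 0 < q := lt_le_trans ltr01 q1.

(** Stated in the extended reals so that it also yields the integrability of the product, on which
    all rules for [cint] depend. *)
Lemma pair_hoelder (u : Lp mu p1) (v : Lp mu q1) :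
  (\int[mu]_x (normc (repr u x * repr v x))%:E <=
    (Lp_norm u * Lp_norm v)%:E)%E.
Proof.
have mR (r : R) (r1 : 1 <= r) (w : Lp mu r1) :=
  measurable_normc (LpFun_cmeasurable (repr w)).
have := hoelder mu (mR _ _ u) (mR _ _ v) p0 q0 pq.
rewrite EFinM /Lp_norm !LpFun_finite; apply: le_trans.
rewrite Lnorm1; apply: ge0_le_integral => //.
- by move=> x _; rewrite lee_fin normc_ge0.
- apply/measurable_EFinP/measurable_normc.
  by apply: cmeasurableM; exact: LpFun_cmeasurable.
- by apply: measurableT_comp => //; apply/measurable_EFinP/measurable_funM; exact: mR.
- by move=> x _ /=; rewrite lee_fin normc_mul ler_norm.
Qed.

Lemma cintegrable_pair (u : Lp mu p1) (v : Lp mu q1) :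
  cintegrable mu (fun x => repr u x * repr v x).
Proof.
have m : cmeasurable (fun x => repr u x * repr v x).
  by apply: cmeasurableM; exact: LpFun_cmeasurable.
apply: (@cintegrable_le _ _ _ _ _ (@normc R \o (fun x => repr u x * repr v x))) => //.
apply/integrableP; split; first exact/measurable_EFinP/measurable_normc.
apply: le_lt_trans (ltry (Lp_norm u * Lp_norm v)).
apply: le_trans (pair_hoelder u v).
rewrite le_eqVlt; apply/orP; left; apply/eqP.
by apply: eq_integral => x _ /=; rewrite ger0_norm ?normc_ge0.
Qed.

Lemma pair_is_scalar (v : Lp mu q1) : scalar (pair ^~ v).
Proof.
move=> a u u'; rewrite /= /pair -cintZ; last exact: cintegrable_pair.
rewrite -cintD; [|exact/cintegrableZ/cintegrable_pair|exact: cintegrable_pair].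
apply: cint_ae.
- by apply: cmeasurableM; exact: LpFun_cmeasurable.
- apply: cmeasurableD; last by apply: cmeasurableM; exact: LpFun_cmeasurable.
  apply: cmeasurableM; first exact: cmeasurable_cst.
  by apply: cmeasurableM; exact: LpFun_cmeasurable.
- by apply: filterS (Lp_reprP a u u') => x ->; rewrite mulrDl mulrA.
Qed.

Lemma normc_pair (u : Lp mu p1) (v : Lp mu q1) :
  normc (pair u v) <= Lp_norm u * Lp_norm v.
Proof.
rewrite (le_trans (normc_cint (cintegrable_pair u v)))// /Rintegral.
have := pair_hoelder u v.
have : (0 <= \int[mu]_x (normc (repr u x * repr v x))%:E)%E.
  by apply: integral_ge0 => x _; rewrite lee_fin normc_ge0.
by case: (\int[mu]_x _)%E.
Qed.

End Pairing.

Section PairingDuality.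
Context d (T : measurableType d) (R : realType).
Variable mu : {measure set T -> \bar R}.

Lemma pairC (p q : R) (p1 : 1 <= p) (q1 : 1 <= q) (u : Lp mu p1) (v : Lp mu q1) :
  pair u v = pair v u.
Proof. by rewrite /pair; congr cint; apply/funext => x; rewrite mulrC. Qed.

Definition scalar_of (V : lmodType R[i]) (f : V -> R[i]) (fs : scalar f) :
    {scalar V} :=
  HB.pack f (GRing.isLinear.Build R[i] V R[i] *%R f fs).

Variables (p q : R) (p1 : 1 <= p) (q1 : 1 <= q) (pq : p^-1 + q^-1 = 1).

Definition pairl (v : Lp mu q1) : {scalar Lp mu p1} :=
  scalar_of (pair_is_scalar pq v).

Lemma pairlE v u : pairl v u = pair u v.
Proof. by []. Qed.

Lemma pair_sumr (I : Type) (s : seq I) (c : I -> R[i]) (F : I -> Lp mu q1)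
    (u : Lp mu p1) :
  pair u (\sum_(k <- s) c k *: F k) = \sum_(k <- s) c k * pair u (F k).
Proof.
have qp : q^-1 + p^-1 = 1 by rewrite addrC.
rewrite pairC -[LHS]/(scalar_of (@pair_is_scalar _ _ _ mu _ _ q1 p1 qp u) _).
by rewrite linear_sum; apply: eq_bigr => k _; rewrite linearZ/= [in RHS]pairC.
Qed.

Lemma normc_pairl v u : normc (pairl v u) <= Lp_norm v * rnorm u.
Proof. by rewrite pairlE mulrC; exact: normc_pair. Qed.

Lemma cmeasurable_cdual (f : T -> R[i]) : cmeasurable f ->
  cmeasurable (fun x => cdual p (f x)).
Proof.
move=> mf; apply: cmeasurableM.
  split; first by rewrite (_ : _ \o _ = @complex.Re R \o f);
    [exact: mf.1|apply/funext => x /=; case: (f x)].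
  rewrite (_ : _ \o _ = \- (@complex.Im R \o f)).
    by apply: measurable_funN; exact: mf.2.
  by apply/funext => x /=; case: (f x).
by split; [exact: measurable_normc_powR|exact: measurable_cst].
Qed.

(** The equality case of Hoelder's inequality: w = [cdual p] of u satisfies |w|^q = |u|^p and u w =
    |u|^p pointwise, so w has norm |u|^(p - 1) and pairs with u to |u|^p. *)
Lemma norming_pair (u : Lp mu p1) : exists v : Lp mu q1,
  Lp_norm v <= 1 /\ pair u v = ((Lp_norm u)%:C)%C.
Proof.
have pgt1 := conjugate_gt1 p1 q1 pq.
have p0 : 0 < p := lt_trans ltr01 pgt1.
have q0 : 0 < q := lt_le_trans ltr01 q1.
have pnq := conjugate_mulB1 p1 q1 pq.
have N0 := Lp_norm_ge0 u.
pose f x := cdual p (repr u x).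
have mf : cmeasurable f by exact/cmeasurable_cdual/LpFun_cmeasurable.
have fq x : normc (f x) `^ q = normc (repr u x) `^ p.
  by rewrite normc_cdual// -powRrM pnq.
have fL : f \in Lp_fun mu q.
  apply: Lp_fun_mem => //; under eq_integral do rewrite fq.
  by rewrite -Lp_normP ltry.
pose w : Lp mu q1 := Lp_pi (MkLpFun q1 fL).
have wN : Lp_norm w = Lp_norm u `^ (p - 1).
  have : Lp_norm w `^ q = Lp_norm u `^ p.
    apply: EFin_inj; rewrite (@Lp_norm_powR_ae _ _ _ _ _ _ w f)//;
      last exact: Lp_repr_pi.
    by rewrite Lp_normP; apply: eq_integral => x _; rewrite fq.
  move=> h; rewrite -[LHS](@powRK _ q) ?gt_eqF ?Lp_norm_ge0// h -powRrM.
  by congr (_ `^ _); rewrite -{1}pnq mulfK// gt_eqF.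
have uw : pair u w = ((Lp_norm u `^ p)%:C)%C.
  rewrite /pair (@cint_ae _ _ _ _ _ (fun x => ((normc (repr u x) `^ p)%:C)%C)).
  - rewrite /cint; congr (_ +i* _)%C; last first.
      by rewrite /Rintegral integral0.
    by rewrite /Rintegral -Lp_normP.
  - by apply: cmeasurableM; exact: LpFun_cmeasurable.
  - by split; [exact/measurable_normc_powR/LpFun_cmeasurable|exact: measurable_cst].
  - by apply: filterS (Lp_repr_pi (MkLpFun q1 fL)) => x /= ->; rewrite cdual_mul.
(* If u has norm 0, the unnormalized w serves, as both norms and the pairing vanish; otherwise w is
   divided by its norm. *)
have [u0|un0] := eqVneq (Lp_norm u) 0.
  exists w; rewrite wN uw u0 !powR0 ?ler01//; first by rewrite gt_eqF.
  by rewrite subr_eq0 gt_eqF.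
have N1 : 0 < Lp_norm u by rewrite lt_neqAle eq_sym un0.
exists (((Lp_norm u `^ (1 - p))%:C)%C *: w); split.
  rewrite -rnorm_Lp rnormZ normc_real rnorm_Lp ger0_norm ?powR_ge0// wN.
  rewrite -powRD; last by rewrite un0 implybT.
  by rewrite addrA subrK subrr powRr0.
(* A sum with a single term, used to pull the scalar out of the second argument. *)
have := pair_sumr [:: tt] (fun=> ((Lp_norm u `^ (1 - p))%:C)%C) (fun=> w) u.
rewrite !big_seq1 => ->; rewrite uw -rmorphM -powRD; last by rewrite un0 implybT.
by rewrite subrK powRr1.
Qed.

Lemma norming_scalar (u : Lp mu p1) : exists f : {scalar Lp mu p1},
  (forall w, normc (f w) <= rnorm w) /\ f u = ((rnorm u)%:C)%C.
Proof.
have [v [v1 uv]] := norming_pair u; exists (pairl v); split; last exact: uv.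
move=> w; rewrite (le_trans (normc_pairl _ _))// ler_piMl//.
exact: Lp_norm_ge0.
Qed.

Lemma pair_eq0 (u : Lp mu p1) : (forall v : Lp mu q1, pair u v = 0) -> u = 0.
Proof.
move=> u0; have [v [_ uv]] := norming_pair u.
apply/normr0_eq0; rewrite -[LHS]/((Lp_norm u)%:C)%C -uv; exact: u0.
Qed.

End PairingDuality.

(** * Disjoint supports and normalized indicators *)

Section DisjointSupports.
Context d (T : measurableType d) (R : realType).
Variable mu : {measure set T -> \bar R}.

Lemma ae_forall_fin (I : finType) (P : I -> T -> Prop) :
  (forall k, {ae mu, forall x, P k x}) -> {ae mu, forall x, forall k, P k x}.
Proof.
move=> aP; suff H (s : seq I) : {ae mu, forall x, forall k, k \in s -> P k x}.
  by apply: filterS (H (enum I)) => x Px k; apply: Px; rewrite mem_enum.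
elim: s => [|k s IHs]; first by apply: aeW.
apply: filterS2 (aP k) IHs => x Pk Ps j; rewrite inE => /orP[/eqP ->//|].
exact: Ps.
Qed.

Lemma cmeasurable_sum (I : finType) (F : I -> T -> R[i]) :
  (forall k, cmeasurable (F k)) -> cmeasurable (fun x => \sum_k F k x).
Proof.
move=> mF; rewrite (_ : (fun x => _) = \sum_k F k).
  apply: (big_ind (@cmeasurable _ _ R)) => //; first exact: cmeasurable_cst.
  by move=> u v; exact: cmeasurableD.
by apply/funext => x; rewrite fct_sumE.
Qed.

Lemma normc_powR_sum_disjoint (I : finType) (p : R) (z : I -> R[i]) : 0 < p ->
  (forall j k, j != k -> z j = 0 \/ z k = 0) ->
  normc (\sum_k z k) `^ p = \sum_k normc (z k) `^ p.
Proof.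
move=> p0 zz; have [[j zj]|nz] := pselect (exists j, z j != 0); last first.
  have z0 k : z k = 0 by apply: contrapT => /eqP zk; apply: nz; exists k.
  rewrite !big1 ?Normc.normc0 ?powR0 ?gt_eqF// => k _.
  by rewrite z0 Normc.normc0 powR0// gt_eqF.
have z0 k : k != j -> z k = 0.
  by move=> /zz[//|/eqP]; rewrite (negbTE zj).
rewrite (bigD1 j)//= big1 ?addr0; last by move=> k /z0.
rewrite [RHS](bigD1 j)//= big1 ?addr0// => k /z0 ->.
by rewrite Normc.normc0 powR0// gt_eqF.
Qed.

Variables (p : R) (p1 : 1 <= p).

Let p0 : 0 < p := lt_le_trans ltr01 p1.

Lemma Lp_norm_disjoint (I : finType) (f : I -> Lp mu p1) :
  (forall j k, j != k ->
     {ae mu, forall x, repr (f j) x = 0 \/ repr (f k) x = 0}) ->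
  Lp_norm (\sum_k f k) `^ p = \sum_k Lp_norm (f k) `^ p.
Proof.
move=> ff; apply: EFin_inj.
have mf : cmeasurable (fun x => \sum_k repr (f k) x).
  by apply: cmeasurable_sum => k; exact: LpFun_cmeasurable.
rewrite (Lp_norm_powR_ae mf); last first.
  have := Lp_repr_sum (index_enum I) (fun=> 1) f.
  by apply: filterS => x; under eq_bigr do rewrite scale1r;
    under [in X in _ = X]eq_bigr do rewrite mul1r.
rewrite -sumEFin; under [RHS]eq_bigr do rewrite Lp_normP.
have mfp k : measurable_fun setT (fun x => (normc (repr (f k) x) `^ p)%:E).
  exact/measurable_EFinP/measurable_normc_powR/LpFun_cmeasurable.
rewrite -ge0_integral_sum//; last by move=> k x _; rewrite lee_fin powR_ge0.
apply: ae_eq_integral => //.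
- exact/measurable_EFinP/measurable_normc_powR.
- exact: emeasurable_sum.
- have : {ae mu, forall x, forall k : I * I, k.1 != k.2 ->
      repr (f k.1) x = 0 \/ repr (f k.2) x = 0}.
    apply: ae_forall_fin => -[j k] /=.
    have [->|jk] := eqVneq j k; first by apply: aeW.
    by apply: filterS (ff _ _ jk).
  apply: filterS => x h _.
  rewrite sumEFin normc_powR_sum_disjoint// => j k jk.
  exact: (h (j, k)).
Qed.

End DisjointSupports.

Section NormalizedIndicators.
Context d (T : measurableType d) (R : realType).
Variable mu : {measure set T -> \bar R}.

Definition fin_pos (A : set T) : Prop :=
  [/\ measurable A, (0 < mu A)%E & (mu A < +oo)%E].

Definition disjoint_family (I : finType) (A : I -> set T) : Prop :=
  (forall k, fin_pos (A k)) /\ forall j k, j != k -> A j `&` A k = set0.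

Definition nindf (p : R) (A : set T) (x : T) : R[i] :=
  ((fine (mu A) `^ (- p^-1) * \1_A x)%:C)%C.

Lemma fin_pos_fine A : fin_pos A -> 0 < fine (mu A) /\ mu A = (fine (mu A))%:E.
Proof.
move=> [_ A0 Aoo]; split; first by rewrite fine_gt0// A0 Aoo.
by rewrite fineK// ge0_fin_numE// ltW.
Qed.

Lemma cmeasurable_nindf p A : measurable A -> cmeasurable (nindf p A).
Proof.
move=> mA; split; last exact: measurable_cst.
by apply: measurable_funM => //; exact: measurable_indic.
Qed.

Lemma normc_nindf p A x :
  normc (nindf p A x) = fine (mu A) `^ (- p^-1) * \1_A x.
Proof. by rewrite normc_real ger0_norm// mulr_ge0// powR_ge0. Qed.

Lemma integral_scaled_indic (c : R) A : 0 <= c -> measurable A ->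
  (\int[mu]_x (c * \1_A x)%:E = c%:E * mu A)%E.
Proof.
move=> c0 mA; under eq_integral do rewrite EFinM.
rewrite ge0_integralZl//; last exact/measurable_EFinP/measurable_indic.
by rewrite integral_indic// setIT.
Qed.

Lemma powR_indic (c : R) (p : R) (A : set T) x : 0 < p -> 0 <= c ->
  (c * \1_A x) `^ p = c `^ p * \1_A x :> R.
Proof.
move=> p0 c0; rewrite powRM//; congr (_ * _).
by rewrite indicE; case: (x \in A); rewrite ?powR1 ?powR0 ?gt_eqF.
Qed.

Lemma integral_nindf p A : 0 < p -> fin_pos A ->
  (\int[mu]_x (normc (nindf p A x) `^ p)%:E = 1)%E.
Proof.
move=> p0 Afp; have [mA _ _] := Afp; have [m0 mE] := fin_pos_fine Afp.
under eq_integral do rewrite normc_nindf powR_indic ?powR_ge0//.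
rewrite integral_scaled_indic ?powR_ge0// mE -EFinM -powRrM mulNr mulVf ?gt_eqF//.
by rewrite powR_inv1 ?ltW// mulVf ?gt_eqF.
Qed.

Section Classes.
Variables (p : R) (p1 : 1 <= p).

Let p0 : 0 < p := lt_le_trans ltr01 p1.

(* The class 0 when nindf p A is not in L_p. *)
Definition nind (A : set T) : Lp mu p1 :=
  Lp_pi (insubd (0 : LpFun mu p1) (nindf p A)).

Lemma nind_pi (A : set T) (fL : nindf p A \in Lp_fun mu p) :
  nind A = Lp_pi (MkLpFun p1 fL).
Proof. by congr Lp_pi; apply: val_inj; rewrite val_insubd/= fL. Qed.

Lemma nindf_Lp A : fin_pos A -> nindf p A \in Lp_fun mu p.
Proof.
move=> Afp; have [mA _ _] := Afp; apply: Lp_fun_mem => //.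
- exact: cmeasurable_nindf.
- by rewrite integral_nindf ?ltry.
Qed.

Lemma repr_nind A : fin_pos A -> {ae mu, forall x, repr (nind A) x = nindf p A x}.
Proof. by move=> /nindf_Lp AL; rewrite (nind_pi AL); exact: Lp_repr_pi. Qed.

Lemma Lp_norm_nind A : fin_pos A -> Lp_norm (nind A) = 1.
Proof.
move=> Afp; have [mA _ _] := Afp.
rewrite -[LHS](@powRK _ p) ?gt_eqF ?Lp_norm_ge0//.
rewrite (_ : _ `^ p = 1) ?powR1//; apply: EFin_inj.
by rewrite (Lp_norm_powR_ae (cmeasurable_nindf p mA) (repr_nind Afp)) integral_nindf.
Qed.

Lemma Lp_norm_sum_nind (I : finType) (A : I -> set T) (t : I -> R[i]) :
  disjoint_family A ->
  Lp_norm (\sum_k t k *: nind (A k)) `^ p = \sum_k normc (t k) `^ p.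
Proof.
move=> [Afp Ad]; rewrite Lp_norm_disjoint.
  apply: eq_bigr => k _; rewrite -rnorm_Lp rnormZ rnorm_Lp Lp_norm_nind//.
  by rewrite mulr1.
move=> j k /Ad jk.
have rZ l : {ae mu, forall x, repr (t l *: nind (A l)) x = t l * nindf p (A l) x}.
  have := Lp_reprP (t l) (nind (A l)) 0; rewrite addr0.
  apply: filterS3 (Lp_repr0 mu p1) (repr_nind (Afp l)).
  by move=> x -> -> ->; rewrite addr0.
apply: filterS2 (rZ j) (rZ k) => x -> ->; rewrite /nindf !indicE.
have [xj|xj] := boolP (x \in A j); last by left; rewrite !mulr0.
have [xk|xk] := boolP (x \in A k); last by right; rewrite !mulr0.
by have : (A j `&` A k) x; [split; exact/set_mem|rewrite jk].
Qed.

End Classes.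

(** For conjugate exponents the factors mu(A)^(-1/p) and mu(A)^(-1/q) multiply to 1 / mu(A), so the
    two normalizations of one family are dual to each other. *)
Lemma pair_nind (p q : R) (p1 : 1 <= p) (q1 : 1 <= q) (pq : p^-1 + q^-1 = 1)
    (I : finType) (A : I -> set T) j k :
  disjoint_family A -> pair (nind p1 (A j)) (nind q1 (A k)) = (j == k)%:R.
Proof.
move=> [Afp Ad]; have [mj _ _] := Afp j; have [mk _ _] := Afp k.
have [m0 mE] := fin_pos_fine (Afp k).
rewrite /pair (@cint_ae _ _ _ _ _ (fun x => nindf p (A j) x * nindf q (A k) x)).
- have [->|jk] := eqVneq j k; last first.
    rewrite (_ : (fun x => _) = cst 0); first by rewrite /cint !Rintegral_cst// !mul0r.
    apply/funext => x; rewrite /nindf -rmorphM/= !indicE.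
    have [xj|xj] := boolP (x \in A j); last by rewrite mulr0 mul0r.
    have [xk|xk] := boolP (x \in A k); last by rewrite !mulr0.
    by have : (A j `&` A k) x; [split; exact/set_mem|rewrite Ad].
  rewrite (_ : (fun x => _) = (fun x => (((fine (mu (A k)))^-1 * \1_(A k) x)%:C)%C)).
    rewrite /cint /Rintegral/= integral_scaled_indic//.
    by rewrite integral0 mE -EFinM/= mulVf ?gt_eqF.
  apply/funext => x; rewrite /nindf -rmorphM/= mulrACA -powRD; last first.
    by rewrite (gt_eqF m0) implybT.
  rewrite -opprD pq powR_inv1 ?ltW//; congr ((_ * _)%:C)%C.
  by rewrite indicE; case: (x \in A k); rewrite ?mulr1 ?mulr0.
- by apply: cmeasurableM; exact: LpFun_cmeasurable.
- by apply: cmeasurableM; exact: cmeasurable_nindf.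
- by apply: filterS2 (repr_nind p1 (Afp j)) (repr_nind q1 (Afp k)) => x -> ->.
Qed.

End NormalizedIndicators.

Section Products.
Context dS dT (S : measurableType dS) (T : measurableType dT) (R : realType).
Variables (nu : {sigma_finite_measure set S -> \bar R}).
Variables (la : {sigma_finite_measure set T -> \bar R}).
Variables (p : R) (p1 : 1 <= p).

Lemma fin_pos_setX A B : fin_pos nu A -> fin_pos la B ->
  fin_pos (nu \x la)%E (A `*` B).
Proof.
move=> fA fB; have [mA A0 Aoo] := fA; have [mB B0 Boo] := fB.
have E := product_measure1E nu la mA mB.
split; first exact: measurableX.
- by rewrite [X in (_ < X)%E]E mule_gt0.
- rewrite [X in (X < _)%E]E.
  by rewrite (fin_pos_fine fA).2 (fin_pos_fine fB).2 -EFinM ltry.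
Qed.

Lemma disjoint_family_setX (I J : finType) (A : I -> set S) (B : J -> set T) :
  disjoint_family nu A -> disjoint_family la B ->
  disjoint_family (nu \x la)%E (fun k : I * J => A k.1 `*` B k.2).
Proof.
move=> [fA dA] [fB dB]; split=> [k|[j j'] [k k']]; first exact: fin_pos_setX.
rewrite xpair_eqE negb_and => /orP[/dA|/dB] /= h.
  by apply/seteqP; split=> [[x y] [[/= a b] [/= a' b']]|//];
    have : (A j `&` A k) x by []; rewrite h.
by apply/seteqP; split=> [[x y] [[/= a b] [/= a' b']]|//];
  have : (B j' `&` B k') y by []; rewrite h.
Qed.

Lemma Lp_prod_nind A B : fin_pos nu A -> fin_pos la B ->
  Lp_prod (nind nu p1 A) (nind la p1 B) = nind (nu \x la)%E p1 (A `*` B).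
Proof.
move=> fA fB; have [mA A0 Aoo] := fA; have [mB B0 Boo] := fB.
have fAB := fin_pos_setX fA fB.
rewrite (nind_pi p1 (nindf_Lp p1 fA)) (nind_pi p1 (nindf_Lp p1 fB)).
rewrite (nind_pi p1 (nindf_Lp p1 fAB)) Lp_prodE; congr Lp_pi; apply: val_inj.
apply/funext => -[x y]; rewrite /= /nindf -rmorphM/=; congr (_%:C)%C.
have -> : ((nu \x la)%E (A `*` B) = nu A * la B)%E := product_measure1E nu la mA mB.
have [a0 aE] := fin_pos_fine fA; have [b0 bE] := fin_pos_fine fB.
rewrite {2}aE {2}bE -EFinM/= powRM ?ltW//.
rewrite mulrACA; congr (_ * _); rewrite !indicE in_setX/=.
by case: (x \in A); case: (y \in B); rewrite ?mulr0 ?mul0r ?mulr1.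
Qed.

Lemma Lp_norm_prod (f : Lp nu p1) (g : Lp la p1) :
  Lp_norm (Lp_prod f g) = Lp_norm f * Lp_norm g.
Proof.
rewrite Lp_norm_pi; apply: EFin_inj; rewrite EFinM !LpFun_finite.
by apply: Lnorm_prod; exact: LpFun_cmeasurable.
Qed.

(* By Tonelli's theorem: the second bound is applied in each section, and then
   the first one. *)
Lemma Lp_norm_sum_prod (I J : finType) (f : I -> Lp nu p1) (g : J -> Lp la p1)
    (M N : R) : 0 <= N ->
  (forall t : I -> R[i],
     Lp_norm (\sum_a t a *: f a) `^ p <= M * \sum_a normc (t a) `^ p) ->
  (forall t : J -> R[i],
     Lp_norm (\sum_b t b *: g b) `^ p <= N * \sum_b normc (t b) `^ p) ->
  forall c : I * J -> R[i],
    Lp_norm (\sum_k c k *: Lp_prod (f k.1) (g k.2)) `^ p <=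
      M * N * \sum_k normc (c k) `^ p.
Proof.
move=> N0 fM gN c.
pose h (z : S * T) : R[i] := \sum_k c k * (repr (f k.1) z.1 * repr (g k.2) z.2).
have mh : cmeasurable h.
  apply: cmeasurable_sum => k; apply: cmeasurableM; first exact: cmeasurable_cst.
  by apply: cmeasurableM; [apply: cmeasurable_fst|apply: cmeasurable_snd];
    exact: LpFun_cmeasurable.
(* For fixed x the section h(x, .) is sum_b u_b(x) g_b, a combination of the g_b to which [gN]
   applies. *)
pose u b x : R[i] := \sum_a c (a, b) * repr (f a) x.
have mu_ b : cmeasurable (u b).
  apply: cmeasurable_sum => a; apply: cmeasurableM; first exact: cmeasurable_cst.
  exact: LpFun_cmeasurable.
have inner x : (fubini_F la (fun z => (normc (h z) `^ p)%:E) x <=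
    (N * \sum_b normc (u b x) `^ p)%:E)%E.
  have := gN (fun b => u b x); rewrite -lee_fin; apply: le_trans.
  rewrite (@Lp_norm_powR_ae _ _ _ la p p1 _ (fun y => \sum_b u b x * repr (g b) y)).
  - rewrite le_eqVlt; apply/orP; left; apply/eqP; apply: eq_integral => y _.
    congr (normc _ `^ p)%:E; rewrite /h/= /u.
    under [RHS]eq_bigr do rewrite mulr_suml.
    rewrite exchange_big/= pair_big/=; apply: eq_bigr => -[a b] _ /=.
    by rewrite mulrA.
  - apply: cmeasurable_sum => b; apply: cmeasurableM; last exact: LpFun_cmeasurable.
    exact: cmeasurable_cst.
  - exact: Lp_repr_sum.
rewrite -lee_fin (Lp_norm_powR_ae mh); last first.
  have rP : {ae (nu \x la)%E, forall z, forall k : I * J,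
      repr (Lp_prod (f k.1) (g k.2)) z = repr (f k.1) z.1 * repr (g k.2) z.2}.
    by apply: ae_forall_fin => k; exact: Lp_repr_pi.
  apply: filterS2 rP (Lp_repr_sum (index_enum _) c (fun k => Lp_prod (f k.1) (g k.2))).
  by move=> z zP ->; apply: eq_bigr => k _; rewrite zP.
rewrite fubini_tonelli1; first last.
- by move=> z; rewrite lee_fin powR_ge0.
- exact/measurable_EFinP/measurable_normc_powR.
have msum : measurable_fun setT (fun x => \sum_b (normc (u b x) `^ p)%:E)%E.
  by apply: emeasurable_sum => b; exact/measurable_EFinP/measurable_normc_powR.
have sum0 x : (0 <= \sum_b (normc (u b x) `^ p)%:E)%E.
  by apply: sume_ge0 => b _; rewrite lee_fin powR_ge0.
apply: (@le_trans _ _ (\int[nu]_x (N%:E * \sum_b (normc (u b x) `^ p)%:E))%E).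
  apply: ge0_le_integral => //.
  - move=> x _; apply: integral_ge0 => y _; rewrite lee_fin powR_ge0//.
  - apply: measurable_fun_fubini_tonelli_F; last by move=> z; rewrite lee_fin powR_ge0.
    exact/measurable_EFinP/measurable_normc_powR.
  - exact: measurable_funeM.
  - by move=> x _; rewrite sumEFin -EFinM.
rewrite ge0_integralZl//.
rewrite ge0_integral_sum//; first last.
- by move=> b x _; rewrite lee_fin powR_ge0.
- by move=> b; exact/measurable_EFinP/measurable_normc_powR.
(* What remains is the sum over b of the integrals of |u_b|^p; each u_b is a combination of the f_a,
   and [fM] bounds it. *)
rewrite [M * N]mulrC -mulrA [leRHS]EFinM lee_wpmul2l ?lee_fin//.
rewrite (_ : \sum_k normc (c k) `^ p = \sum_b \sum_a normc (c (a, b)) `^ p).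
  rewrite mulr_sumr -sumEFin; apply: lee_sum => b _.
  rewrite -(@Lp_norm_powR_ae _ _ _ _ _ p1 (\sum_a c (a, b) *: f a)) ?lee_fin//.
  exact: Lp_repr_sum.
by rewrite exchange_big pair_big/=; apply: eq_bigr => -[].
Qed.
End Products.

(** * Conditional expectations on finite partitions *)

Section SimpleApproximation.
Context d (T : measurableType d) (R : realType).

Import HBNNSimple.

Lemma maxrB0 (y : R) : Num.max y 0 - Num.max (- y) 0 = y.
Proof.
have [y0|y0] := leP 0 y.
  by rewrite max_r ?oppr_le0// subr0.
by rewrite max_l ?oppr_ge0 ?ltW// sub0r opprK.
Qed.

Lemma maxrD0 (y : R) : Num.max y 0 + Num.max (- y) 0 = `|y|.
Proof.
have [y0|y0] := leP 0 y.
  by rewrite max_r ?oppr_le0// addr0 ger0_norm.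
by rewrite max_l ?oppr_ge0 ?ltW// add0r ltr0_norm.
Qed.

(** The positive and negative parts are approximated from below; 0 <= gp <= h^+ and 0 <= gn <= h^-
    give |gp - gn| <= h^+ + h^- = |h|, the domination used for convergence in norm. *)
Lemma real_simple_approx (h : T -> R) : measurable_fun setT h ->
  exists g : nat -> T -> R, [/\ forall n, measurable_fun setT (g n),
    forall n, finite_set (range (g n)),
    forall x, g n x @[n --> \oo] --> h x &
    forall n x, `|g n x| <= `|h x|].
Proof.
move=> /measurable_EFinP mh.
have mp := measurable_funepos mh; have mn := measurable_funeneg mh.
pose gp := nnsfun_approx measurableT mp; pose gn := nnsfun_approx measurableT mn.
have gp_le n x : gp n x <= Num.max (h x) 0.
  have := @le_approx _ _ _ setT (EFin \o h)^\+%E n x (fun y _ => funepos_ge0 _ y) I.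
  by rewrite funeposE -(nnsfun_approxE measurableT mp) /= -EFin_max lee_fin.
have gn_le n x : gn n x <= Num.max (- h x) 0.
  have := @le_approx _ _ _ setT (EFin \o h)^\-%E n x (fun y _ => funeneg_ge0 _ y) I.
  by rewrite funenegE -(nnsfun_approxE measurableT mn) /= -EFin_max lee_fin.
exists (fun n x => gp n x - gn n x); split.
- by move=> n; apply: measurable_funB; exact: measurable_funPT.
- move=> n.
  apply: (@sub_finite_set _ _ [set z.1 - z.2 | z in range (gp n) `*` range (gn n)]).
    by move=> _ [x _ <-]; exists (gp n x, gn n x) => //; split; exists x.
  by apply: finite_image; apply: finite_setX; exact: fimfunP.
- move=> x.
  have cp : gp n x @[n --> \oo] --> Num.max (h x) 0.
    have := cvg_nnsfun_approx measurableT mp (fun x _ => funepos_ge0 _ x) (I : setT x).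
    by rewrite funeposE /= -EFin_max; move=> /fine_cvg.
  have cn : gn n x @[n --> \oo] --> Num.max (- h x) 0.
    have := cvg_nnsfun_approx measurableT mn (fun x _ => funeneg_ge0 _ x) (I : setT x).
    by rewrite funenegE /= -EFin_max; move=> /fine_cvg.
  by rewrite -[h x]maxrB0; exact: cvgB.
- move=> n x; rewrite -[leRHS]maxrD0.
  have gp0 : 0 <= gp n x by []. have gn0 : 0 <= gn n x by [].
  rewrite (le_trans (ler_normB _ _))// !ger0_norm//; exact: lerD.
Qed.

Variable mu : {measure set T -> \bar R}.
Variables (q : R) (q1 : 1 <= q).

Let q0 : 0 < q := lt_le_trans ltr01 q1.

Definition simple_fun (g : T -> R[i]) : Prop :=
  cmeasurable g /\ finite_set (range g).

Lemma Lp_simple_approx (u : Lp mu q1) (e : R) : 0 < e ->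
  exists g : LpFun mu q1, simple_fun g /\ Lp_norm (u - Lp_pi g) <= e.
Proof.
move=> e0; have mu_ := LpFun_cmeasurable (repr u).
have [gr [mgr fgr cgr lgr]] := real_simple_approx mu_.1.
have [gi [mgi fgi cgi lgi]] := real_simple_approx mu_.2.
pose g n x : R[i] := (gr n x +i* gi n x)%C.
have mg n : cmeasurable (g n) by split; [exact: mgr|exact: mgi].
have sg n : simple_fun (g n).
  split => //.
  apply: (@sub_finite_set _ _
    [set (z.1 +i* z.2)%C | z in range (gr n) `*` range (gi n)]).
    by move=> _ [x _ <-]; exists (gr n x, gi n x) => //; split; exists x.
  by apply: finite_image; exact: finite_setX.
have lg n x : normc (g n x) <= 2 * normc (repr u x).
  apply: (le_trans (normc_le_ReIm _)); rewrite mulrDl mul1r.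
  apply: lerD; [apply: le_trans (lgr n x) _|apply: le_trans (lgi n x) _].
  - exact: normr_Re_le.
  - exact: normr_Im_le.
have iu : (\int[mu]_x ((2 * normc (repr u x)) `^ q)%:E < +oo)%E.
  under eq_integral do rewrite powRM ?normc_ge0// EFinM.
  rewrite ge0_integralZl//; last 2 first.
  - exact/measurable_EFinP/measurable_normc_powR.
  - by move=> x _; rewrite lee_fin powR_ge0.
  by rewrite -Lp_normP -EFinM ltry.
have gL n : g n \in Lp_fun mu q.
  apply: (Lp_fun_mem q1 (mg n)).
  apply: le_lt_trans iu; apply: ge0_le_integral; first exact: measurableT.
  - by move=> x _; rewrite lee_fin powR_ge0.
  - exact/measurable_EFinP/measurable_normc_powR.
  - apply/measurable_EFinP; apply: (measurableT_comp (measurable_powR q)).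
    apply: measurable_funM => //; exact: measurable_normc.
  - move=> x _; rewrite lee_fin ge0_ler_powR ?nnegrE ?normc_ge0 ?(ltW q0)//.
    by rewrite mulr_ge0// normc_ge0.
pose D n x : R[i] := repr u x - g n x.
have mD n : cmeasurable (D n).
  rewrite (_ : D n = (fun x => repr u x + (-1) * g n x)); last first.
    by apply/funext => x; rewrite mulN1r.
  apply: cmeasurableD => //; apply: cmeasurableM => //; exact: cmeasurable_cst.
have ND n : ((Lp_norm (u - Lp_pi (MkLpFun q1 (gL n))) `^ q)%:E =
    \int[mu]_x (normc (D n x) `^ q)%:E)%E.
  apply: Lp_norm_powR_ae => //.
  rewrite addrC -scaleN1r.
  apply: filterS2 (Lp_reprP (-1) (Lp_pi (MkLpFun q1 (gL n))) u)
    (Lp_repr_pi (MkLpFun q1 (gL n))) => x -> ->.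
  by rewrite mulN1r addrC.
(* Since |g n| <= 2 |u| pointwise, |u - g n| <= 3 |u|: a dominating function that does not depend on
   n. *)
have iD : mu.-integrable setT (fun x => ((3 * normc (repr u x)) `^ q)%:E).
  apply/integrableP; split.
    apply/measurable_EFinP; apply: (measurableT_comp (measurable_powR q)).
    by apply: measurable_funM => //; exact: measurable_normc.
  under eq_integral do rewrite /= ger0_norm ?powR_ge0// powRM ?normc_ge0// EFinM.
  rewrite ge0_integralZl//; last 2 first.
  - exact/measurable_EFinP/measurable_normc_powR.
  - by move=> x _; rewrite lee_fin powR_ge0.
  by rewrite -Lp_normP -EFinM ltry.
have cD x : (normc (D n x) `^ q)%:E @[n --> \oo] --> (0%R)%:E.
  apply: cvg_EFin; first exact: nearW.
  (* The real and the imaginary part may each contribute half of eps^(1/q). *)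
  apply/cvgrPdist_le => /= eps eps0; pose del := eps `^ q^-1 / 2.
  have del0 : 0 < del by rewrite divr_gt0// powR_gt0.
  have /cvgrPdist_le/(_ _ del0) Hr := cgr x.
  have /cvgrPdist_le/(_ _ del0) Hi := cgi x.
  near=> n; rewrite sub0r normrN ger0_norm ?powR_ge0//.
  have -> : eps = (eps `^ q^-1) `^ q by rewrite powRVK ?gt_eqF// ltW.
  rewrite ge0_ler_powR ?nnegrE ?normc_ge0 ?powR_ge0 ?(ltW q0)//.
  apply: (le_trans (normc_le_ReIm _)); rewrite [leRHS](splitr _) -/del.
  have DE : D n x = ((complex.Re (repr u x) - gr n x) +i*
                     (complex.Im (repr u x) - gi n x))%C.
    by rewrite /D /g; case: (repr u x).
  by rewrite DE/=; apply: lerD; near: n.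
have [||_ _ dc] := @dominated_convergence _ _ _ mu setT measurableT
  (fun n x => (normc (D n x) `^ q)%:E) (cst 0%E)
  (fun x => ((3 * normc (repr u x)) `^ q)%:E)
  (fun n => (measurable_EFinP _ _).2 (measurable_normc_powR q (mD n)))
  (measurable_cst _) _ iD _.
- by apply: aeW => x _; exact: cD.
- apply: aeW => x n _ /=; rewrite lee_fin ger0_norm ?powR_ge0//.
  have n0 := normc_ge0 (repr u x).
  rewrite ge0_ler_powR ?nnegrE ?normc_ge0 ?(ltW q0) ?mulr_ge0//.
  rewrite (le_trans (le_normcD _ _))// normcN.
  by have := lg n x; lra.
have eq0 : 0 < e `^ q by rewrite powR_gt0.
move: dc; rewrite /= integral0 => /fine_cvgP[_ /cvgrPdist_le/(_ _ eq0)].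
move=> [n _ /(_ n (leqnn n))].
rewrite /= -ND/= sub0r normrN ger0_norm ?powR_ge0// ler_powR2r ?Lp_norm_ge0 ?(ltW e0)//.
by exists (MkLpFun q1 (gL n)); split => //; exact: sg.
Unshelve. all: by end_near. Qed.

Lemma finite_range_seq (g : T -> R[i]) : finite_set (range g) ->
  exists s : seq R[i], forall x, g x \in s.
Proof.
move=> /finite_seqP[s gs]; exists s => x.
by have : range g (g x) by []; rewrite gs.
Qed.

(* The joint level sets of the functions g j: those of positive finite measure
   span all the g j, since an integrable simple function vanishes on its level
   sets of infinite measure. *)
Lemma simple_funs_span (J : finType) (g : J -> LpFun mu q1) :
  (forall j, simple_fun (g j)) ->
  exists (I : finType) (A : I -> set T), disjoint_family mu A /\
    forall j, exists t : I -> R[i], Lp_pi (g j) = \sum_k t k *: nind mu q1 (A k).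
Proof.
move=> sg.
have /choice[ss gss] j : exists s : seq R[i], forall x, g j x \in s.
  by apply: finite_range_seq; exact: (sg j).2.
(* Without repetitions, distinct positions in s hold distinct values, which makes the level sets
   [B v] pairwise disjoint. *)
pose s := undup (flatten [seq ss j | j <- enum J]).
have gs j x : g j x \in s.
  rewrite mem_undup; apply/flattenP; exists (ss j) => //.
  by apply/map_f; rewrite mem_enum.
have us : uniq s by exact: undup_uniq.
pose N := size s.
pose K := {ffun J -> 'I_N}.
pose B (v : K) : set T := [set x | forall j, g j x = s`_(v j)].
have mB v : measurable (B v).
  rewrite (_ : B v = \bigcap_(j in setT) (g j @^-1` [set s`_(v j)])); last first.
    by apply/seteqP; split=> [x Bx j _|x Bx j]; [exact: Bx|exact: (Bx j I)].
  apply: fin_bigcap_measurable => // j _.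
  rewrite (_ : _ @^-1` _ =
    ((@complex.Re R \o g j) @^-1` [set complex.Re s`_(v j)]) `&`
    ((@complex.Im R \o g j) @^-1` [set complex.Im s`_(v j)])).
    have [mr mi] := LpFun_cmeasurable (g j).
    by apply: measurableI; rewrite -[X in measurable X]setTI;
      [apply: mr|apply: mi].
  apply/seteqP; split=> [x /= ->//|x /= []].
  by case: (g j x) (s`_(v j)) => a b [c e] /= -> ->.
have Bdisj v w : v != w -> B v `&` B w = set0.
  move=> vw; apply/seteqP; split=> // x [/= Bv Bw]; move/eqP: vw; apply.
  apply/ffunP => j; apply/val_inj/eqP.
  by rewrite -(nth_uniq 0 _ _ us) ?ltn_ord// -Bv -Bw.
have Bcov x : exists v, B v x.
  have ix j : (index (g j x) s < N)%N by rewrite index_mem.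
  by exists [ffun j => Ordinal (ix j)] => j; rewrite ffunE/= nth_index.
pose P v := `[< fin_pos mu (B v) >].
pose I := {v : K | P v}.
have fI (k : I) : fin_pos mu (B (val k)) by exact/asboolP/(valP k).
exists I, (fun k : I => B (val k)); split.
  split=> [//|j k jk]; apply: Bdisj; by apply: contra jk => /eqP/val_inj ->.
move=> j.
(* Cancels the normalizing factor of [nindf]. *)
pose c (k : I) := fine (mu (B (val k))) `^ (q^-1).
exists (fun k : I => s`_(val k j) * ((c k)%:C)%C).
apply: Lp_ext.
(* Almost every x avoids the null level sets, so its level set either belongs to the family or has
   infinite measure. *)
have ae0 : {ae mu, forall x, forall v, mu (B v) = 0%E -> ~ B v x}.
  apply: ae_forall_fin => v; have [v0|v0] := pselect (mu (B v) = 0%E); last first.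
    by apply: aeW => x /v0.
  exists (B v); split => // x /= h; apply: contrapT => nB; apply: h => _; exact: nB.
have aeR : {ae mu, forall x, forall k : I, repr (nind mu q1 (B (val k))) x =
    nindf mu q (B (val k)) x}.
  by apply: ae_forall_fin => k; exact: repr_nind.
have aeS := Lp_repr_sum (index_enum I) (fun k : I => s`_(val k j) * ((c k)%:C)%C)
  (fun k => nind mu q1 (B (val k))).
have aeG := Lp_repr_pi (g j).
apply: filterS2 aeG (filterI ae0 (filterI aeR aeS)) => x -> [x0 [xR ->]].
under eq_bigr do rewrite xR.
have [v Bv] := Bcov x.
have nv (k : I) : val k != v -> nindf mu q (B (val k)) x = 0.
  move=> /Bdisj kv; rewrite /nindf indicE memNset ?mulr0// => Bk.
  by have : (B (val k) `&` B v) x by []; rewrite kv.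
have [Pv|Pv] := boolP (P v).
  pose k : I := exist _ v Pv.
  rewrite (bigD1 k)//= big1 ?addr0; last first.
    by move=> l lk; rewrite nv ?mulr0.
  have [m0 mE] := fin_pos_fine (fI k).
  rewrite /nindf indicE mem_set// mulr1 -mulrA -rmorphM/= -powRD; last first.
    by rewrite (gt_eqF m0) implybT.
  by rewrite subrr powRr0 mulr1; exact: Bv.
rewrite big1; last first.
  move=> k _; rewrite nv ?mulr0//; apply: contraNneq Pv => <-; exact: (valP k).
have Bv_y : mu (B v) = +oo%E.
  have v0 : (0 < mu (B v))%E.
    by rewrite lt0e measure_ge0 andbT; apply/eqP => /x0.
  apply/eqP; rewrite -leye_eq leNgt; apply: contra Pv => voo.
  by apply/asboolP; split.
rewrite Bv; apply: contrapT => /eqP sn0.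
have : (\int[mu]_y (normc (s`_(v j)) `^ q * \1_(B v) y)%:E < +oo)%E.
  apply: le_lt_trans (ltry (Lpfun_norm mu q (g j) `^ q)).
  rewrite Lpfun_normP; apply: ge0_le_integral => //.
  - by move=> y _; rewrite lee_fin mulr_ge0// powR_ge0.
  - by apply/measurable_EFinP/measurable_funM => //; exact: measurable_indic.
  - exact/measurable_EFinP/measurable_normc_powR/LpFun_cmeasurable.
  - move=> y _; rewrite lee_fin indicE; have [/set_mem yB|_] := boolP (y \in B v).
      by rewrite mulr1 yB.
    by rewrite mulr0 powR_ge0.
rewrite integral_scaled_indic ?powR_ge0// Bv_y gt0_muley ?ltxx// lte_fin powR_gt0//.
rewrite lt_neqAle normc_ge0 andbT eq_sym.
by apply: contra sn0 => /eqP/Normc.eq0_normc ->.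
Qed.

End SimpleApproximation.

Section ConditionalExpectation.
Context d (T : measurableType d) (R : realType).
Variable mu : {measure set T -> \bar R}.
Variables (p q : R) (p1 : 1 <= p) (q1 : 1 <= q) (pq : p^-1 + q^-1 = 1).

Let q0 : 0 < q := lt_le_trans ltr01 q1.

Section Family.
Variables (I : finType) (A : I -> set T).

(** The two normalizations combine to 1 / mu(A k), so for a disjoint family this is the mean of x
    over each A k, and 0 outside their union. *)
Definition condexp (x : Lp mu q1) : Lp mu q1 :=
  \sum_k pair x (nind mu p1 (A k)) *: nind mu q1 (A k).

Let qp : q^-1 + p^-1 = 1. Proof. by rewrite addrC. Qed.

Lemma condexp_is_linear : linear condexp.
Proof.
move=> a x y; rewrite /condexp scaler_sumr -big_split; apply: eq_bigr => k _ /=.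
by rewrite (pair_is_scalar qp) scalerDl scalerA.
Qed.

HB.instance Definition _ := GRing.isLinear.Build R[i] (Lp mu q1) (Lp mu q1) *:%R
  condexp condexp_is_linear.

Hypothesis dA : disjoint_family mu A.

(** By finite duality: a combination of these pairings with scalars t is the pairing of x with sum
    t_k e_k, and the latter has norm |t|_p. *)
Lemma pair_nind_bessel (x : Lp mu q1) :
  \sum_k normc (pair x (nind mu p1 (A k))) `^ q <= Lp_norm x `^ q.
Proof.
apply: (finite_duality q1 p1 qp); first exact: Lp_norm_ge0.
move=> t; rewrite -(pair_sumr qp) (le_trans (normc_pair qp _ _))//.
rewrite ler_wpM2l ?Lp_norm_ge0// -(@Lp_norm_sum_nind _ _ _ mu p p1 I A t dA).
by rewrite powRK ?Lp_norm_ge0// gt_eqF// (lt_le_trans ltr01).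
Qed.

Lemma Lp_norm_condexp (x : Lp mu q1) : Lp_norm (condexp x) <= Lp_norm x.
Proof.
rewrite -(@ler_powR2r _ q) ?Lp_norm_ge0// Lp_norm_sum_nind//.
exact: pair_nind_bessel.
Qed.

Lemma condexp_sum_nind (t : I -> R[i]) :
  condexp (\sum_k t k *: nind mu q1 (A k)) = \sum_k t k *: nind mu q1 (A k).
Proof.
rewrite linear_sum; apply: eq_bigr => k _; rewrite linearZ/=; congr (_ *: _).
rewrite /condexp (bigD1 k)//= pair_nind// eqxx scale1r big1 ?addr0// => j jk.
by rewrite pair_nind// eq_sym (negbTE jk) scale0r.
Qed.

End Family.

(** Simple functions within e / 2 of the x j lie in the span of one common family. [condexp] fixes
    them and is a contraction, so the error is at most twice e / 2. *)
Lemma Lp_condexp_approx (J : finType) (x : J -> Lp mu q1) (e : R) : 0 < e ->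
  exists (I : finType) (A : I -> set T), disjoint_family mu A /\
    forall j, Lp_norm (x j - condexp A (x j)) <= e.
Proof.
move=> e0; have e20 : 0 < e / 2 by rewrite divr_gt0.
have /choice[g gP] j := Lp_simple_approx (x j) e20.
have [I [A [dA gA]]] := simple_funs_span (fun j => (gP j).1).
exists I, A; split=> // j; have [t gt] := gA j.
have -> : x j - condexp A (x j) =
    (x j - Lp_pi (g j)) - condexp A (x j - Lp_pi (g j)).
  by rewrite linearB/= {2}gt condexp_sum_nind// -gt opprB addrA subrK.
rewrite -rnorm_Lp (le_trans (rnormD _ _))// rnormN !rnorm_Lp (splitr e).
by apply: lerD; [|apply: le_trans (Lp_norm_condexp dA _) _]; exact: (gP j).2.
Qed.

End ConditionalExpectation.

(** * Disjoint sets in a convenient measure space *)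

Section ManyDisjointSets.
Context d (X : measurableType d) (R : realType).
Variable mu : {sigma_finite_measure set X -> \bar R}.
Local Open Scope ereal_scope.

Lemma fin_pos_subset (A : set X) : measurable A -> 0 < mu A ->
  exists B, B `<=` A /\ fin_pos mu B.
Proof.
move=> mA A0.
have [F FT Ffin] := sigma_finiteT mu.
have [[n An]|nA] := pselect (exists n, 0 < mu (A `&` F n)).
  have mAF : measurable (A `&` F n) by apply: measurableI => //; exact: (Ffin n).1.
  exists (A `&` F n); split; first by move=> x [].
  split => //; apply: le_lt_trans (Ffin n).2.
  by apply: le_measure; rewrite ?inE//; exact: (Ffin n).1.
exfalso; move: A0; apply/negP; rewrite -leNgt.
rewrite -[A]setIT FT setI_bigcupr.
have mAF n : measurable (A `&` F n) by apply: measurableI => //; exact: (Ffin n).1.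
rewrite (le_trans (measure_sigma_subadditive mu mAF _ (@subset_refl _ _)))//.
  exact: bigcupT_measurable.
rewrite eseries0// => n _ _; apply/eqP; rewrite eq_le measure_ge0 andbT leNgt.
by apply/negP => An; apply: nA; exists n.
Qed.

Definition measurable_pos (A : set X) := measurable A /\ 0 < mu A.

Lemma atomless_split (A : set X) : (forall B, ~ atom mu B) -> measurable_pos A ->
  exists B C, [/\ measurable_pos B, measurable_pos C, B `<=` A, C `<=` A &
    B `&` C = set0].
Proof.
move=> na [mA A0]; apply: contrapT => nBC; apply: (na A); split => // B mB BA.
apply: contrapT => /not_orP[B0 AB0]; apply: nBC; exists B, (A `\` B); split.
- by split => //; rewrite lt0e measure_ge0 andbT; exact/eqP.
- by split; [exact: measurableD|rewrite lt0e measure_ge0 andbT; exact/eqP].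
- exact: BA.
- by move=> x [].
- by rewrite setDE setIC -setIA setICl setI0.
Qed.

Lemma atomless_seq (n : nat) (A : set X) : (forall B, ~ atom mu B) ->
  measurable_pos A -> exists F : nat -> set X,
    [/\ forall k, (k < n)%N -> measurable_pos (F k),
        forall k, (k < n)%N -> F k `<=` A &
        forall j k, (j < n)%N -> (k < n)%N -> j <> k -> F j `&` F k = set0].
Proof.
move=> na; elim: n A => [|n IHn] A pA; first by exists (fun=> set0); split.
have [B [C [pB pC BA CA BC]]] := atomless_split na pA.
have [F [Fp FC Fd]] := IHn _ pC.
exists (fun k => if k is k'.+1 then F k' else B); split=> [[|k]|[|k]|[|j] [|k]]//.
- exact: Fp.
- by move=> kn; exact: subset_trans (FC _ kn) CA.
- move=> _ kn _; apply/seteqP; split=> // x [Bx Fx].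
  by rewrite -BC; split=> //; exact: (FC _ kn).
- move=> jn _ _; apply/seteqP; split=> // x [Fx Bx].
  by rewrite -BC; split=> //; exact: (FC _ jn).
- by move=> jn kn jk; apply: Fd => // jk'; apply: jk; rewrite jk'.
Qed.

(** If the intersection is not null, it fills A and B up to null sets, and the symmetric difference
    would be null. *)
Lemma atoms_meet_null (A B : set X) : atom mu A -> atom mu B ->
  0 < mu (A `+` B) -> mu (A `&` B) = 0.
Proof.
move=> [mA A0 aA] [mB B0 aB] AB.
have mAB : measurable (A `&` B) by exact: measurableI.
have [//|AD] := aA _ mAB (@subIsetl _ _ _).
have [//|BD] := aB _ mAB (@subIsetr _ _ _).
exfalso; move: AB; rewrite lt_neqAle => /andP[/eqP + _]; apply.
apply/esym/eqP; rewrite eq_le measure_ge0 andbT.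
have -> : A `+` B = (A `\` (A `&` B)) `|` (B `\` (A `&` B)).
  apply/seteqP; split=> x.
    by move=> [[Ax nBx]|[Bx nAx]]; [left|right]; split => // -[].
  by move=> [[Ax nB]|[Bx nA]]; [left|right]; split => // h; [apply: nB|apply: nA].
rewrite (le_trans (measureU2 _ _ _))//; try exact: measurableD.
by rewrite [X in X + _]AD [X in _ + X]BD adde0.
Qed.

(** [seqDU] removes the earlier atoms from A n; by [atoms_meet_null] and subadditivity this costs
    only a null set. *)
Lemma atoms_seq (A : nat -> set X) : (forall n, atom mu (A n)) ->
  (forall m n, m <> n -> 0 < mu (A m `+` A n)) ->
  exists F : nat -> set X, (forall n, measurable_pos (F n)) /\
    forall j k, j <> k -> F j `&` F k = set0.
Proof.
move=> aA dA; exists (seqDU A); split=> [n|j k jk]; last first.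
  have /trivIsetP/(_ j k I I) := trivIset_seqDU A.
  by apply; exact/eqP.
have [mn n0 _] := aA n.
have mA k : measurable (A k) by case: (aA k).
have mU : measurable (\big[setU/set0]_(k < n) A k).
  by apply: bigsetU_measurable => k _.
split; first exact: measurableD.
have I0 : mu (A n `&` \big[setU/set0]_(k < n) A k) = 0.
  pose G k := if (k < n)%N then A n `&` A k else set0.
  have mG k : measurable (G k) by rewrite /G; case: ifP => // _; exact: measurableI.
  have sub : A n `&` \big[setU/set0]_(k < n) A k `<=` \bigcup_k G k.
    rewrite -bigcup_mkord => x [An [k /= kn Ak]].
    by exists k => //; rewrite /G kn.
  apply/eqP; rewrite eq_le measure_ge0 andbT.
  rewrite (le_trans (measure_sigma_subadditive mu mG _ sub))//.
    exact: measurableI.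
  rewrite eseries0// => k _ _; rewrite /G; case: ifP => [kn|_]; last exact: measure0.
  by apply: atoms_meet_null => //; apply: dA => nk; move: kn; rewrite nk ltnn.
by move: n0; rewrite (measureDI mu (mA n) mU) [X in _ + X]I0 adde0.
Qed.

(** This is how convenience of X enters: [L] has room for a normalized indicator for each index of
    any finite sum. The sets found first may have infinite measure and are shrunk by
    sigma-finiteness. *)
Lemma convenient_disjoint_family (I : finType) : 0 < mu setT ->
  convenient mu -> exists A : I -> set X, disjoint_family mu A.
Proof.
move=> X0 cX.
have [F [Fp Fd]] : exists F : nat -> set X,
    (forall k, (k < #|I|)%N -> measurable_pos (F k)) /\
    forall j k, (j < #|I|)%N -> (k < #|I|)%N -> j <> k -> F j `&` F k = set0.
  case: cX => [na|[A [aA dA]]].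
    have [||F [? ? ?]] := @atomless_seq #|I| setT => //.
    by exists F.
  have [F [? Fd]] := atoms_seq aA dA; exists F; split=> // j k _ _; exact: Fd.
have /choice[G GP] k : exists B, (k < #|I|)%N -> B `<=` F k /\ fin_pos mu B.
  have [kI|_] := boolP (k < #|I|)%N; last by exists set0.
  by have [B ?] := fin_pos_subset (Fp _ kI).1 (Fp _ kI).2; exists B.
exists (fun k => G (enum_rank k)); split=> [k|j k jk].
  by have [] := GP _ (ltn_ord (enum_rank k)).
apply/seteqP; split=> // x [Gj Gk].
rewrite -(Fd (enum_rank j) (enum_rank k)) ?ltn_ord//; first split.
- by have [+ _] := GP _ (ltn_ord (enum_rank j)); apply.
- by have [+ _] := GP _ (ltn_ord (enum_rank k)); apply.
- by move/ord_inj/enum_rank_inj => jk'; rewrite jk' eqxx in jk.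
Qed.

End ManyDisjointSets.

(** * Slices of tensors and the injective norm *)

Definition linear_of (K : comNzRingType) (V W : lmodType K) (f : V -> W)
    (fl : linear f) : {linear V -> W} :=
  HB.pack f (GRing.isLinear.Build K V W *:%R f fl).

Section TensorMaps.
Variables (K : comNzRingType) (V W : lmodType K).

Lemma tensor_ext (U : lmodType K) (F G : tensor V W -> U) :
  linear F -> linear G -> (forall x y, F (tmul x y) = G (tmul x y)) -> F =1 G.
Proof.
move=> lF lG FG u; rewrite -[F u]/(linear_of lF u) -[G u]/(linear_of lG u).
by rewrite (tensor_sum u) !linear_sum; apply: eq_bigr => z _; exact: FG.
Qed.

Lemma tensor_sum_ord (u : tensor V W) : exists n (x : 'I_n -> V) (y : 'I_n -> W),
  u = \sum_k tmul (x k) (y k).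
Proof.
exists (size (repr u)), (fun k => (nth (0, 0) (repr u) k).1).
exists (fun k => (nth (0, 0) (repr u) k).2).
by rewrite {1}(tensor_sum u) (big_nth (0, 0)) big_mkord.
Qed.

Lemma bilinear_sumZ (U : lmodType K) (b : {bilinear V -> W -> U})
    (I J : finType) (s : I -> K) (t : J -> K) (x : I -> V) (y : J -> W) :
  b (\sum_k s k *: x k) (\sum_l t l *: y l) =
  \sum_(m : I * J) (s m.1 * t m.2) *: b (x m.1) (y m.2).
Proof.
rewrite linear_sumlz -(pair_big xpredT xpredT
  (fun k l => (s k * t l) *: b (x k) (y l)))/=.
apply: eq_bigr => k _; rewrite linear_sumr; apply: eq_bigr => l _.
by rewrite linearZl_LR linearZr_LR scalerA.
Qed.

End TensorMaps.

Lemma tensor3_sum_ord (K : comNzRingType) (V E F : lmodType K)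
    (U : tensor V (tensor E F)) :
  exists n (xi : 'I_n -> V) (x : 'I_n -> E) (y : 'I_n -> F),
    U = \sum_m tmul (xi m) (tmul (x m) (y m)).
Proof.
suff [s ->] : exists s : seq (V * (E * F)),
    U = \sum_(z <- s) tmul z.1 (tmul z.2.1 z.2.2).
  exists (size s), (fun m => (tnth (in_tuple s) m).1).
  exists (fun m => (tnth (in_tuple s) m).2.1), (fun m => (tnth (in_tuple s) m).2.2).
  exact: big_tnth.
rewrite (tensor_sum U); elim: (repr U) => [|[xi w] s [t IHs]].
  by exists [::]; rewrite !big_nil.
exists ([seq (xi, z) | z <- repr w] ++ t).
by rewrite big_cons big_cat IHs big_map /= {1}(tensor_sum w) linear_sumr.
Qed.

(** The telescoping x (x) y - x0 (x) y0 = (x - x0) (x) y + x0 (x) (y - y0), with scalars t, t^-2, t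
    of product 1 distributed over the three factors. The large scalar t^-2 falls on the differences,
    which will be of size t^3. *)
Lemma tmul_split (R : realType) (V E F : lmodType R[i]) (xi : V)
    (x x0 : E) (y y0 : F) (t : R) :
  t != 0 -> tmul xi (tmul x y) = tmul xi (tmul x0 y0)
    + tmul ((t%:C)%C *: xi) (tmul (((t ^- 2)%:C)%C *: (x - x0)) ((t%:C)%C *: y))
    + tmul ((t%:C)%C *: xi) (tmul ((t%:C)%C *: x0) (((t ^- 2)%:C)%C *: (y - y0))).
Proof.
move=> t0; have tE : ((t%:C) * ((t ^- 2)%:C * t%:C) = 1 :> R[i])%C.
  by rewrite -!rmorphM/= (_ : t * _ = 1) ?rmorph1//; field.
have tE' : ((t%:C) * (t%:C * (t ^- 2)%:C) = 1 :> R[i])%C.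
  by rewrite [_%:C%C * _ in X in _ * X]mulrC.
have Z3 (a b c : R[i]) (u : E) (v : F) :
    tmul (a *: xi) (tmul (b *: u) (c *: v)) = (a * (b * c)) *: tmul xi (tmul u v).
  have -> : tmul (b *: u) (c *: v) = (b * c) *: tmul u v.
    by rewrite linearZl_LR linearZr_LR/= scalerA.
  by rewrite linearZl_LR linearZr_LR/= scalerA.
rewrite !Z3 tE tE' !scale1r -addrA -linearDr linearBl linearBr/=.
by rewrite -linearDr; congr (tmul xi _); rewrite /= addrC addrA !subrK.
Qed.

Section Slice.
Variables (R : realType) (L : normedModType R[i]).

Section LinearSlice.
Variables (E : lmodType R[i]).

(* The map id (x) g on the tensor product of L and E. *)
Definition slice (g : E -> R[i]) (u : tensor L E) : L :=
  tlift (fun xi x => g x *: xi) u.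

Lemma slice_bilinear (g : {scalar E}) :
  bilinear_for *:%R *:%R (fun (xi : L) (x : E) => g x *: xi).
Proof.
split=> [y a u u'|u a y y'] /=; first by rewrite scalerDr !scalerA mulrC.
by rewrite linearP scalerDl scalerA.
Qed.

Lemma slice_tmul (g : {scalar E}) xi x : slice g (tmul xi x) = g x *: xi.
Proof. exact: tlift_tmul_for (slice_bilinear g). Qed.

Lemma slice_is_linear (g : {scalar E}) : linear (slice g).
Proof. exact: tlift_is_linear_for (slice_bilinear g). Qed.

HB.instance Definition _ (g : {scalar E}) :=
  GRing.isLinear.Build R[i] (tensor L E) L *:%R (slice g) (slice_is_linear g).

Lemma slice_sum (g : {scalar E}) (I : finType) (xi : I -> L) (x : I -> E) :
  slice g (\sum_k tmul (xi k) (x k)) = \sum_k g (x k) *: xi k.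
Proof. by rewrite linear_sum; apply: eq_bigr => k _; exact: slice_tmul. Qed.

Lemma slice_scalar (f : {scalar L}) (g : E -> R[i]) u :
  f (slice g u) = tlift (fun xi x => (f xi * g x : R[i]^o)) u.
Proof.
rewrite /slice /tlift /fsum linear_sum; apply: eq_bigr => z _.
by rewrite linearZ/= mulrC.
Qed.

Lemma slice_eq (g h : E -> R[i]) u : g =1 h -> slice g u = slice h u.
Proof. by move=> /funext ->. Qed.

Lemma sliceZ (c : R[i]) (g : E -> R[i]) u :
  slice (fun x => c * g x) u = c *: slice g u.
Proof.
rewrite /slice /tlift /fsum scaler_sumr; apply: eq_bigr => z _.
by rewrite scalerA.
Qed.

Lemma slice_act (g : {scalar E}) (a : {linear L -> L}) (u : tensor L E) :
  slice g (act a u) = a (slice g u).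
Proof.
have al := tmap_is_linear a (idfun : {linear E -> E}).
apply: (@tensor_ext _ _ _ _ (slice g \o act a) (a \o slice g)).
- by move=> c x y; rewrite /= [act a _]al linearP.
- by move=> c x y; rewrite /= !linearP.
- move=> x y; rewrite /= [act _ _](tmap_tmul a (idfun : {linear E -> E})).
  by rewrite !slice_tmul linearZ.
Qed.

Lemma slice_sum_scalar (I : finType) (t : I -> R[i]) (g : I -> E -> R[i])
    (u : tensor L E) :
  slice (fun x => \sum_k t k * g k x) u = \sum_k t k *: slice (g k) u.
Proof.
rewrite /slice /tlift /fsum; under eq_bigr do rewrite scaler_suml.
rewrite exchange_big; apply: eq_bigr => k _; rewrite scaler_sumr.
by apply: eq_bigr => z _; rewrite scalerA.
Qed.

End LinearSlice.

Lemma slice_amp (E F : lmodType R[i]) (phi : {linear E -> F}) (g : {scalar F})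
    (u : tensor L E) :
  slice g (amp phi u) = slice (g \o phi) u.
Proof.
have gp : scalar (g \o phi) by move=> a x y; rewrite /= !linearP.
have al := tmap_is_linear (idfun : {linear L -> L}) phi.
have sl := slice_is_linear (scalar_of gp).
apply: (@tensor_ext _ _ _ _ (slice g \o amp phi) (slice (g \o phi))).
- by move=> a x y; rewrite /= [amp phi _]al linearP.
- exact: sl.
- move=> x y; rewrite /= [amp _ _](tmap_tmul (idfun : {linear L -> L}) phi).
  by rewrite slice_tmul [RHS](slice_tmul (scalar_of gp)).
Qed.

Lemma amp_bij (E F : lmodType R[i]) (phi : {linear E -> F}) : bijective phi ->
  bijective (amp phi : tensor L E -> tensor L F).
Proof.
move=> [psi phiK psiK].
have lpsi : linear psi by exact: (can2_linear phiK psiK).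
pose psil := linear_of lpsi.
have la := tmap_is_linear (idfun : {linear L -> L}) phi.
have lb := tmap_is_linear (idfun : {linear L -> L}) psil.
have lid (V : lmodType R[i]) : linear (@id V) by [].
exists (amp psi).
- apply: (@tensor_ext _ _ _ _ (amp psi \o amp phi) id) => //.
    by move=> a x y; rewrite /= [amp phi _]la [LHS]lb.
  move=> x y; rewrite /= [amp phi _](tmap_tmul (idfun : {linear L -> L}) phi).
  by rewrite [LHS](tmap_tmul (idfun : {linear L -> L}) psil)/= phiK.
- apply: (@tensor_ext _ _ _ _ (amp phi \o amp psi) id) => //.
    by move=> a x y; rewrite /= [amp psi _]lb [LHS]la.
  move=> x y; rewrite /= [amp psi _](tmap_tmul (idfun : {linear L -> L}) psil).
  by rewrite [LHS](tmap_tmul (idfun : {linear L -> L}) phi)/= psiK.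
Qed.

Section InjectiveNorm.
Hypothesis norming : forall xi : L, exists f : {scalar L},
  (forall w, normc (f w) <= rnorm w) /\ f xi = ((rnorm xi)%:C)%C.
Variable E : normedModType R[i].
Implicit Types (u : tensor L E) (g : {scalar E}).

Let injset u := [set r | exists (f : {scalar L}) (g : {scalar E}),
    [/\ forall xi, normc (f xi) <= rnorm xi,
        forall x, normc (g x) <= rnorm x &
        r = normc (tlift (fun xi x => (f xi * g x : R[i]^o)) u)]].

Let injset_ub u : has_ubound (injset u).
Proof.
(* A bound from one representation of u, uniform in f and g; it ensures that [sup] is a genuine
   least upper bound. *)
exists (\sum_(z <- repr u) rnorm z.1 * rnorm z.2) => _ [f [g [fb gb ->]]].
rewrite /tlift /fsum (le_trans (normc_sum _ _ _))//; apply: ler_sum => z _.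
by rewrite normc_mul ler_pM// normc_ge0.
Qed.

Let injset_n0 u : injset u !=set0.
Proof.
have zs (V : lmodType R[i]) : scalar (fun _ : V => 0 : R[i]).
  by move=> a x y; rewrite mulr0 addr0.
exists (normc (tlift (fun xi x =>
  (scalar_of (zs L) xi * scalar_of (zs E) x : R[i]^o)) u)).
exists (scalar_of (zs L)), (scalar_of (zs E)).
by split=> // x; rewrite [_ x](erefl 0) Normc.normc0 rnorm_ge0.
Qed.

Lemma rnorm_slice u g : (forall x, normc (g x) <= rnorm x) ->
  rnorm (slice g u) <= inj_norm u.
Proof.
move=> gb; have [f [fb fu]] := norming (slice g u).
have -> : rnorm (slice g u) = normc (f (slice g u)).
  by rewrite fu normc_real ger0_norm// rnorm_ge0.
apply: (ub_le_sup (injset_ub u)); exists f, g; split => //.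
by rewrite slice_scalar.
Qed.

Lemma inj_norm_le u (M : R) :
  (forall g, (forall x, normc (g x) <= rnorm x) -> rnorm (slice g u) <= M) ->
  inj_norm u <= M.
Proof.
move=> uM; apply: (ge_sup (injset_n0 u)) => _ [f [g [fb gb ->]]].
by rewrite -slice_scalar (le_trans (fb _))// uM.
Qed.

Lemma inj_norm_ge0 u : 0 <= inj_norm u.
Proof.
have [r ru] := injset_n0 u; apply: le_trans (ub_le_sup (injset_ub u) ru).
by case: ru => f [g [_ _ ->]]; exact: normc_ge0.
Qed.

Lemma rnorm_slice_scaled u g (C : R) : 0 <= C ->
  (forall x, normc (g x) <= C * rnorm x) ->
  rnorm (slice g u) <= C * inj_norm u.
Proof.
(* For C = 0 the functional vanishes; otherwise g / C has norm at most 1. *)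
rewrite le_eqVlt => /orP[/eqP <- g0|C0 gC].
  have -> : slice g u = 0.
    rewrite /slice /tlift /fsum big1// => z _.
    have := g0 z.2; rewrite mul0r => gz.
    rewrite (_ : g z.2 = 0) ?scale0r//; apply: Normc.eq0_normc.
    by apply/eqP; rewrite eq_le gz normc_ge0.
  by rewrite rnorm0 mul0r.
pose c : R[i] := ((C^-1)%:C)%C.
have nc : normc c = C^-1 by rewrite normc_real ger0_norm// invr_ge0 ltW.
have hs : scalar (fun x => c * g x).
  by move=> a x y; rewrite linearP mulrDr mulrCA.
have : rnorm (slice (scalar_of hs) u) <= inj_norm u.
  apply: rnorm_slice => x; rewrite /= normc_mul nc mulrC ler_pdivrMr// mulrC.
  exact: gC.
by rewrite [slice _ _](sliceZ c g u) rnormZ nc mulrC ler_pdivrMr// mulrC.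
Qed.

End InjectiveNorm.

End Slice.

Section OperatorNorm.
Variables (R : realType) (L : normedModType R[i]).

Let opset (a : L -> L) := [set rnorm (a xi) | xi in [set xi : L | rnorm xi <= 1]].

Lemma opnorm_le (a : {linear L -> L}) (C : R) :
  (forall xi, rnorm (a xi) <= C * rnorm xi) -> 0 <= C -> opnorm a <= C.
Proof.
move=> aC C0; apply: ge_sup.
  by exists (rnorm (a 0)), 0 => //=; rewrite rnorm0.
by move=> _ [xi /= xi1 <-]; rewrite (le_trans (aC _))// ler_piMr.
Qed.

Lemma rnorm_opnorm (a : {linear L -> L}) xi : bounded_op a ->
  rnorm (a xi) <= opnorm a * rnorm xi.
Proof.
move=> [C aC].
have ub : has_ubound (opset a).
  exists `|C| => _ [w /= w1 <-]; rewrite (le_trans (aC _))//.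
  rewrite (le_trans (ler_norm _))// normrM ler_piMr//.
  by rewrite ger0_norm// rnorm_ge0.
have [x0|xn0] := eqVneq (rnorm xi) 0.
  by rewrite (rnorm_eq0 x0) linear0 rnorm0 mulr0.
have x0 : 0 < rnorm xi by rewrite lt_neqAle eq_sym xn0 rnorm_ge0.
pose c : R[i] := (((rnorm xi)^-1)%:C)%C.
have nc : normc c = (rnorm xi)^-1 by rewrite normc_real ger0_norm// invr_ge0 ltW.
have : rnorm (a (c *: xi)) <= opnorm a.
  by apply: (ub_le_sup ub); exists (c *: xi) => //=; rewrite rnormZ nc mulVf.
by rewrite linearZ/= rnormZ nc mulrC ler_pdivrMr.
Qed.

Lemma opnorm_ge0 (a : {linear L -> L}) : bounded_op a -> 0 <= opnorm a.
Proof.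
move=> [C aC]; apply: ub_le_sup; last first.
  by exists 0 => /=; rewrite ?rnorm0// linear0 rnorm0.
exists `|C| => _ [w /= w1 <-]; rewrite (le_trans (aC _))//.
rewrite (le_trans (ler_norm _))// normrM ler_piMr//.
by rewrite ger0_norm// rnorm_ge0.
Qed.

End OperatorNorm.

(** * Diamond products and the space of finite sums f(s) g(t) *)

Section DiamondTensor.
Context d (X : measurableType d) (R : realType).
Variable mu : {sigma_finite_measure set X -> \bar R}.
Variables (p : R) (p1 : 1 <= p).
Variable i : {linear Lp (mu \x mu)%E p1 -> Lp mu p1}.
Variables E F : lmodType R[i].
Local Notation L := (Lp mu p1).

Let right_bilinear (xi : L) (x : E) : bilinear_for *:%R *:%R
  (fun eta (y : F) => tmul (diam i xi eta) (tmul x y : tensor E F)).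
Proof.
split=> [y a u u'|u a y y'] /=; first by rewrite /diam linearPr linearP linearPl.
by rewrite !linearPr.
Qed.

Let left_bilinear (eta : L) (y : F) : bilinear_for *:%R *:%R
  (fun xi (x : E) => tmul (diam i xi eta) (tmul x y : tensor E F)).
Proof.
split=> [x a u u'|u a x x'] /=; first by rewrite /diam linearPl linearP linearPl.
by rewrite linearPl linearPr.
Qed.

Lemma tdiam_is_linearr (u : tensor L E) :
  linear (tdiam i u : tensor L F -> tensor L (tensor E F)).
Proof.
move=> a v v'; rewrite /tdiam /tlift /fsum scaler_sumr -big_split.
by apply: eq_bigr => z _; apply: (tlift_is_linear_for (right_bilinear z.1 z.2)).
Qed.

Lemma tdiam_is_linearl (v : tensor L F) :
  linear (fun u : tensor L E => tdiam i u v).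
Proof.
move=> a u u'.
(* [tdiam] nests the lift in v inside the one in u; exchanging the two finite sums exhibits it as a
   sum of lifts in u. *)
have S w : tdiam i w v = \sum_(z <- repr v) tlift (fun xi (x : E) =>
    tmul (diam i xi z.1) (tmul x z.2 : tensor E F)) w.
  by rewrite /tdiam /tlift /fsum exchange_big.
rewrite !S scaler_sumr -big_split.
by apply: eq_bigr => z _; apply: (tlift_is_linear_for (left_bilinear z.1 z.2)).
Qed.

Lemma tdiam_sum (I J : finType) (xi : I -> L) (x : I -> E)
    (eta : J -> L) (y : J -> F) :
  tdiam i (\sum_k tmul (xi k) (x k)) (\sum_l tmul (eta l) (y l)) =
  \sum_(m : I * J) tmul (i (Lp_prod (xi m.1) (eta m.2))) (tmul (x m.1) (y m.2)).
Proof.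
rewrite -(pair_big xpredT xpredT (fun k l =>
  tmul (i (Lp_prod (xi k) (eta l))) (tmul (x k) (y l))))/=.
set v := \sum_l tmul (eta l) (y l).
rewrite -[LHS]/(linear_of (tdiam_is_linearl v) _) linear_sum.
apply: eq_bigr => k _ /=.
rewrite -[LHS]/(linear_of (tdiam_is_linearr _) _) linear_sum.
by apply: eq_bigr => l _ /=; rewrite tdiam_tmul.
Qed.

(** With i isometric, this moves the norm of the slice into L_p(X x X), where the product structure
    is visible and Tonelli's theorem applies. *)
Lemma slice_tdiam (I J : finType) (xi : I -> L) (x : I -> E)
    (eta : J -> L) (y : J -> F) (G : {scalar tensor E F}) :
  slice G (tdiam i (\sum_k tmul (xi k) (x k)) (\sum_l tmul (eta l) (y l))) =
  i (\sum_(m : I * J) G (tmul (x m.1) (y m.2)) *: Lp_prod (xi m.1) (eta m.2)).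
Proof.
rewrite tdiam_sum slice_sum linear_sum; apply: eq_bigr => m _.
by rewrite linearZ.
Qed.

End DiamondTensor.

Section ProductSpace.
Context dS dT (S : measurableType dS) (T : measurableType dT) (R : realType).
Variables (nu : {sigma_finite_measure set S -> \bar R}).
Variables (la : {sigma_finite_measure set T -> \bar R}).
Variables (q : R) (q1 : 1 <= q).
Local Notation LS := (Lp nu q1).
Local Notation LT := (Lp la q1).

Lemma Lp_prod_alg (x : LS) (y : LT) : Lp_prod x y \in @Lp_alg _ _ _ _ _ nu la q q1.
Proof. by rewrite inE; exists [:: (x, y)]; rewrite big_seq1. Qed.

Definition alg_prod (x : LS) (y : LT) : LpAlg nu la q1 :=
  MkLpAlg (Lp_prod_alg x y).

Lemma alg_prod_is_bilinear : bilinear_for *:%R *:%R alg_prod.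
Proof.
split=> [y a x x'|x a y y']; apply: val_inj; rewrite linearP/=.
  exact: linearPl.
exact: linearPr.
Qed.

HB.instance Definition _ := bilinear_isBilinear.Build R[i] LS LT (LpAlg nu la q1)
  *:%R *:%R alg_prod alg_prod_is_bilinear.

Definition alg_map : tensor LS LT -> LpAlg nu la q1 := tlift alg_prod.

HB.instance Definition _ := GRing.isLinear.Build R[i] (tensor LS LT)
  (LpAlg nu la q1) *:%R alg_map (tlift_is_linear alg_prod).

Lemma alg_map_tmul x y : alg_map (tmul x y) = alg_prod x y.
Proof. exact: tlift_tmul. Qed.

Lemma alg_map_val x y : LpAlg_val (alg_map (tmul x y)) = Lp_prod x y.
Proof. by rewrite alg_map_tmul. Qed.

Lemma alg_map_surj (w : LpAlg nu la q1) : exists U, alg_map U = w.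
Proof.
case: w => w wP; have := wP; rewrite inE => -[s ws].
exists (\sum_(z <- s) tmul z.1 z.2); apply: val_inj.
rewrite [alg_map _]linear_sum [LHS]linear_sum/= [RHS]ws; apply: eq_bigr => z _.
by rewrite alg_map_tmul.
Qed.

Lemma rnorm_alg (w : LpAlg nu la q1) : rnorm w = Lp_norm (val w).
Proof. by []. Qed.

(** The measure of the sections of a null set is a nonnegative function with integral 0, hence it
    vanishes almost everywhere. *)
Lemma ae_sections (P : S * T -> Prop) :
  {ae (nu \x la)%E, forall z, P z} ->
  {ae nu, forall x, {ae la, forall y, P (x, y)}}.
Proof.
move=> [N [mN N0 PN]].
have : ae_eq nu setT (la \o xsection N) (cst 0%E).
  apply/ae_eq_integral_abs => //; first exact: measurable_fun_xsection.
  rewrite -[RHS]N0; apply: eq_integral => x _ /=.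
  by rewrite gee0_abs.
apply: filterS => x /(_ I) /= Nx; exists (xsection N x); split => //.
  exact: measurable_xsection.
by move=> y nP; rewrite /xsection/= inE; exact: PN.
Qed.

Variables (p : R) (p1 : 1 <= p) (qp : q^-1 + p^-1 = 1).

(** For almost every s the combination sum_k x_k(s) y_k is the zero class; pairing it with h gives
    the assertion at s. *)
Lemma sum_Lp_prod_eq0 (I : finType) (x : I -> LS) (y : I -> LT) (h : Lp la p1) :
  \sum_k Lp_prod (x k) (y k) = 0 -> \sum_k pair (y k) h *: x k = 0.
Proof.
move=> xy0.
have ae1 : {ae (nu \x la)%E, forall z, \sum_k repr (x k) z.1 * repr (y k) z.2 = 0}.
  have := Lp_repr_sum (index_enum I) (fun=> 1) (fun k => Lp_prod (x k) (y k)).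
  under eq_bigr do rewrite scale1r.
  have a3 : {ae (nu \x la)%E, forall z, forall k : I,
      repr (Lp_prod (x k) (y k)) z = repr (x k) z.1 * repr (y k) z.2}.
    by apply: ae_forall_fin => k; exact: Lp_repr_pi.
  rewrite xy0; apply: filterS3 (Lp_repr0 (nu \x la)%E q1) a3 => z z0 zk.
  rewrite z0 => h0; rewrite [RHS]h0.
  by apply: eq_bigr => k _; rewrite mul1r zk.
apply: Lp_ext.
have := Lp_repr_sum (index_enum I) (fun k => pair (y k) h) x.
apply: filterS3 (ae_sections ae1) (Lp_repr0 nu q1) => s s0 -> ->.
have ys : \sum_k repr (x k) s *: y k = 0.
  apply: Lp_ext; have := Lp_repr_sum (index_enum I) (fun k => repr (x k) s) y.
  by apply: filterS3 s0 (Lp_repr0 la q1) => t /= t0 -> ->.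
have := linear0 (@pairl _ _ _ _ _ _ q1 p1 qp h); rewrite -ys linear_sum => h0.
rewrite -[RHS]h0; apply: eq_bigr => k _.
by rewrite linearZ/= mulrC.
Qed.

(* A functional h that does not vanish on the last y expresses the last x by the
   others, which shortens the sum. *)
Lemma sum_tmul_eq0 n (x : 'I_n -> LS) (y : 'I_n -> LT) :
  \sum_k Lp_prod (x k) (y k) = 0 -> \sum_k tmul (x k) (y k) = 0.
Proof.
elim: n x y => [|n IHn] x y xy0; first by rewrite big_ord0.
have [y0|yn0] := eqVneq (y ord_max) 0.
  rewrite big_ord_recr/= y0 linear0r addr0; apply: IHn.
  by move: xy0; rewrite big_ord_recr/= y0 linear0r addr0.
have [h yh] : exists h : Lp la p1, pair (y ord_max) h != 0.
  apply: contrapT => nh; move/eqP: yn0; apply; apply: (pair_eq0 (q1 := p1) qp).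
  by move=> v; apply/eqP; apply: contrapT => /negP vn; apply: nh; exists v.
pose c k := pair (y k) h.
pose x' (k : 'I_n) := x (widen_ord (leqnSn n) k).
pose y' (k : 'I_n) := y (widen_ord (leqnSn n) k).
pose t (k : 'I_n) := - (pair (y' k) h / c ord_max).
have xn : x ord_max = \sum_k t k *: x' k.
  have := sum_Lp_prod_eq0 h xy0; rewrite big_ord_recr/= addrC.
  move=> /eqP; rewrite addr_eq0 => /eqP cx.
  rewrite -[LHS]scale1r -(mulVf yh) -scalerA cx -sumrN.
  rewrite scaler_sumr; apply: eq_bigr => k _.
  by rewrite scalerN scalerA -scaleNr /t mulrC.
(* Stated for every bilinear map: with [Lp_prod] it hands the hypothesis down to n terms, with
   [tmul] it brings the conclusion back. *)
have bE (U : lmodType R[i]) (b : {bilinear LS -> LT -> U}) :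
    \sum_k b (x k) (y k) = \sum_k b (x' k) (y' k + t k *: y ord_max).
  rewrite big_ord_recr/= xn linear_sumlz -big_split/=; apply: eq_bigr => k _.
  by rewrite linearDr linearZr_LR linearZl_LR.
by rewrite bE IHn// -bE.
Qed.

Lemma alg_map_inj : injective alg_map.
Proof.
apply: raddf_inj => U /= U0.
have [n [x [y UE]]] := tensor_sum_ord U; rewrite UE.
have {}U0 : \sum_k LpAlg_val (alg_map (tmul (x k) (y k))) = 0.
  have := congr1 (@LpAlg_val _ _ _ _ _ _ _ _ _) U0.
  by rewrite UE [alg_map _]linear_sum [X in X = _](linear_sum val).
apply: sum_tmul_eq0; rewrite -[RHS]U0; apply: eq_bigr => k _.
by rewrite alg_map_tmul.
Qed.

Lemma alg_map_bij : bijective alg_map.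
Proof.
have /choice[f fK] := alg_map_surj.
by exists f => // U; apply: alg_map_inj; rewrite fK.
Qed.

End ProductSpace.

(** * The injective norm of a diamond product *)

Section DiamondBound.
Context dX dY dZ (X : measurableType dX) (Y : measurableType dY)
  (Z : measurableType dZ) (R : realType).
Variable mu : {sigma_finite_measure set X -> \bar R}.
Variable nu : {sigma_finite_measure set Y -> \bar R}.
Variable la : {sigma_finite_measure set Z -> \bar R}.
Variables (p q : R) (p1 : 1 <= p) (q1 : 1 <= q) (pq : p^-1 + q^-1 = 1).
Local Notation L := (Lp mu p1).

Let p0 : 0 < p := lt_le_trans ltr01 p1.
Let q0 : 0 < q := lt_le_trans ltr01 q1.
Let qp : q^-1 + p^-1 = 1. Proof. by rewrite addrC. Qed.

Lemma norming_Lp (xi : L) : exists f : {scalar L},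
  (forall w, normc (f w) <= rnorm w) /\ f xi = ((rnorm xi)%:C)%C.
Proof. exact: norming_scalar q1 pq xi. Qed.

(** The combination of slices is one slice, by the pairing with sum t_a e_a; as a functional this
    has norm at most |t|_p. The p-th powers give the form that [Lp_norm_sum_prod] takes as
    hypothesis. *)
Lemma Lp_norm_sum_slice dT (T : measurableType dT)
    (ka : {sigma_finite_measure set T -> \bar R})
    (I : finType) (A : I -> set T) (u : tensor L (Lp ka q1)) (t : I -> R[i]) :
  disjoint_family ka A ->
  Lp_norm (\sum_a t a *: slice (pairl q1 qp (nind ka p1 (A a))) u) `^ p <=
  inj_norm u `^ p * \sum_a normc (t a) `^ p.
Proof.
move=> dA; rewrite -slice_sum_scalar.
have -> : slice (fun x => \sum_a t a * pairl q1 qp (nind ka p1 (A a)) x) u =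
    slice (pairl q1 qp (\sum_a t a *: nind ka p1 (A a))) u.
  by apply: slice_eq => x; rewrite !pairlE pair_sumr.
rewrite -(@Lp_norm_sum_nind _ _ _ ka p p1 I A t dA) mulrC.
rewrite -powRM ?Lp_norm_ge0 ?inj_norm_ge0//.
rewrite ler_powR2r ?Lp_norm_ge0 ?mulr_ge0 ?Lp_norm_ge0 ?inj_norm_ge0//.
rewrite -rnorm_Lp; apply: (rnorm_slice_scaled norming_Lp); first exact: Lp_norm_ge0.
by move=> x; exact: normc_pairl.
Qed.

(** The products are the normalized indicators of rectangles, so finite duality applies in their
    span inside L_q(Y x Z). *)
Lemma sum_alg_prod_nind (I J : finType) (A : I -> set Y) (B : J -> set Z)
    (g : {scalar LpAlg nu la q1}) :
  disjoint_family nu A -> disjoint_family la B ->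
  (forall w, normc (g w) <= rnorm w) ->
  \sum_(k : I * J) normc (g (alg_prod (nind nu q1 (A k.1)) (nind la q1 (B k.2)))) `^ p
    <= 1.
Proof.
move=> dA dB gb; rewrite (_ : 1 = 1 `^ p); last by rewrite powR1.
apply: (finite_duality p1 q1 pq) => // t.
under eq_bigr do rewrite -[_ * _]/(t _ *: _) -linearZ.
rewrite -linear_sum mul1r (le_trans (gb _))// rnorm_alg.
rewrite [val _](linear_sum val)/=.
under eq_bigr do rewrite (Lp_prod_nind q1 (dA.1 _) (dB.1 _)).
rewrite -(Lp_norm_sum_nind q1 t (disjoint_family_setX dA dB)).
by rewrite powRK ?Lp_norm_ge0// gt_eqF.
Qed.

(* After conditioning, g enters only through its values c on the products of
   indicators; these have l_p norm at most 1 by duality. *)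
Lemma Lp_norm_sum_prod_condexp (I J K M : finType) (A : I -> set Y)
    (B : J -> set Z) (xi : K -> L) (x : K -> Lp nu q1) (eta : M -> L)
    (y : M -> Lp la q1) (g : {scalar LpAlg nu la q1}) :
  disjoint_family nu A -> disjoint_family la B ->
  (forall w, normc (g w) <= rnorm w) ->
  Lp_norm (\sum_(m : K * M)
    g (alg_prod (condexp p1 A (x m.1)) (condexp p1 B (y m.2))) *:
      Lp_prod (xi m.1) (eta m.2)) <=
  inj_norm (\sum_k tmul (xi k) (x k)) * inj_norm (\sum_k tmul (eta k) (y k)).
Proof.
move=> dA dB gb; set u := \sum_k tmul (xi k) (x k).
set v := \sum_k tmul (eta k) (y k).
have u0 : 0 <= inj_norm u by exact: inj_norm_ge0.
have v0 : 0 <= inj_norm v by exact: inj_norm_ge0.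
pose al a := slice (pairl q1 qp (nind nu p1 (A a))) u.
pose be b := slice (pairl q1 qp (nind la p1 (B b))) v.
rewrite -(@ler_powR2r _ p) ?Lp_norm_ge0 ?mulr_ge0// powRM//.
pose c (k : I * J) := g (alg_prod (nind nu q1 (A k.1)) (nind la q1 (B k.2))).
have -> : \sum_(m : K * M)
    g (alg_prod (condexp p1 A (x m.1)) (condexp p1 B (y m.2))) *:
      Lp_prod (xi m.1) (eta m.2) = \sum_k c k *: Lp_prod (al k.1) (be k.2).
  transitivity (\sum_(k : I * J) \sum_(m : K * M)
     (c k * (pair (x m.1) (nind nu p1 (A k.1)) * pair (y m.2) (nind la p1 (B k.2))))
       *: Lp_prod (xi m.1) (eta m.2)).
    rewrite exchange_big; apply: eq_bigr => m _ /=.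
    rewrite /condexp bilinear_sumZ linear_sum scaler_suml.
    by apply: eq_bigr => k _; rewrite linearZ/= mulrC.
  apply: eq_bigr => k _.
  rewrite /al /be /u /v !slice_sum bilinear_sumZ scaler_sumr.
  by apply: eq_bigr => m _; rewrite scalerA.
have cM := Lp_norm_sum_prod (powR_ge0 _ _)
  (fun t => Lp_norm_sum_slice u t dA) (fun t => Lp_norm_sum_slice v t dB) c.
rewrite (le_trans cM)// ler_piMr ?mulr_ge0 ?powR_ge0//.
exact: sum_alg_prod_nind.
Qed.

Lemma Lp_norm_prodB (x x' : Lp nu q1) (y y' : Lp la q1) :
  rnorm (alg_prod x y - alg_prod x' y') <=
  rnorm (x - x') * rnorm y + rnorm x' * rnorm (y - y').
Proof.
have -> : alg_prod x y - alg_prod x' y' = alg_prod (x - x') y + alg_prod x' (y - y').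
  by rewrite linearBl linearBr addrA subrK.
by rewrite (le_trans (rnormD _ _))// !rnorm_alg/= !Lp_norm_prod.
Qed.

Lemma Lp_norm_sum_prod_alg (K M : finType) (xi : K -> L) (x : K -> Lp nu q1)
    (eta : M -> L) (y : M -> Lp la q1) (g : {scalar LpAlg nu la q1}) :
  (forall w, normc (g w) <= rnorm w) ->
  Lp_norm (\sum_(m : K * M) g (alg_prod (x m.1) (y m.2)) *:
      Lp_prod (xi m.1) (eta m.2)) <=
  inj_norm (\sum_k tmul (xi k) (x k)) * inj_norm (\sum_k tmul (eta k) (y k)).
Proof.
move=> gb; apply/ler_addgt0Pr => e e0.
(* Replacing x and y by conditional expectations within delta moves the m-th coefficient by at most
   delta (|y| + |x|), hence the whole sum by at most delta C. The choice delta = e / (C + 1) also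
   covers C = 0. *)
pose C := \sum_(m : K * M) (rnorm (y m.2) + rnorm (x m.1)) *
  (Lp_norm (xi m.1) * Lp_norm (eta m.2)).
have C0 : 0 <= C.
  apply: sumr_ge0 => m _.
  by rewrite mulr_ge0 ?addr_ge0 ?rnorm_ge0 ?mulr_ge0 ?Lp_norm_ge0.
have C1 : 0 < C + 1 by rewrite ltr_wpDl.
have e10 : 0 < e / (C + 1) by rewrite divr_gt0.
have [I [A [dA Ax]]] := Lp_condexp_approx p1 pq x e10.
have [J [B [dB By]]] := Lp_condexp_approx p1 pq y e10.
have := Lp_norm_sum_prod_condexp xi x eta y dA dB gb.
set W := \sum_(m : K * M) _ *: _; set W' := \sum_(m : K * M) _ *: _ => W'b.
have -> : W' = W + (W' - W) by rewrite addrC subrK.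
rewrite -rnorm_Lp (le_trans (rnormD _ _))// lerD//.
suff : rnorm (W' - W) <= e / (C + 1) * C.
  by move=> h; rewrite (le_trans h)// mulrAC ler_pdivrMr// ler_wpM2l ?(ltW e0)// lerDl.
rewrite /W' /W -sumrB mulr_sumr (le_trans (rnorm_sum _ _))//.
apply: ler_sum => m _; rewrite -scalerBl -linearB/= rnormZ rnorm_Lp Lp_norm_prod.
rewrite [leRHS]mulrA ler_wpM2r ?mulr_ge0 ?Lp_norm_ge0//.
rewrite (le_trans (gb _))// (le_trans (Lp_norm_prodB _ _ _ _))// mulrDr lerD//.
  by rewrite ler_wpM2r ?rnorm_ge0//; exact: Ax.
rewrite mulrC ler_pM ?rnorm_ge0//; first exact: By.
exact: Lp_norm_condexp.
Qed.

End DiamondBound.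

(** * The injective norm is at most the projective norm *)

Section ProperIsometries.
Context d (X : measurableType d) (R : realType).
Variable mu : {sigma_finite_measure set X -> \bar R}.
Variables (p : R) (p1 : 1 <= p).
Local Notation L := (Lp mu p1).

Lemma nind_Lp_on (A B : set X) : fin_pos mu B -> B `<=` A ->
  Lp_on A (nind mu p1 B).
Proof.
move=> fB BA; apply: filterS (repr_nind p1 fB) => x -> nA.
by rewrite /nindf indicE memNset ?mulr0// => /BA.
Qed.

(** If the intersection had positive measure, the normalized indicator of a part of finite measure
    would lie in both subspaces and have norm 1. *)
Lemma Lp_on_disjoint_null (A B : set X) : measurable A -> measurable B ->
  (@Lp_on _ _ _ mu p p1 A `&` Lp_on B = [set 0]) -> mu (A `&` B) = 0%E.
Proof.
move=> mA mB AB0; apply/eqP; rewrite eq_le measure_ge0 andbT leNgt.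
apply/negP => AB; have mAB := measurableI _ _ mA mB.
have [C [CAB fC]] := fin_pos_subset mAB AB.
have : [set 0] (nind mu p1 C).
  rewrite -AB0; split; apply: nind_Lp_on => // x /CAB [].
  by [].
  by [].
move=> /= C0; have := Lp_norm_nind p1 fC.
by rewrite C0 -rnorm_Lp rnorm0 => /esym/eqP; rewrite oner_eq0.
Qed.

Lemma proper_isometries_norm n (I : 'I_n -> {linear L -> L}) (zeta : 'I_n -> L) :
  (forall k, proper_isometry (I k)) ->
  (forall j k, j != k -> disjoint_op (I j) (I k)) ->
  Lp_norm (\sum_k I k (zeta k)) `^ p = \sum_k Lp_norm (zeta k) `^ p.
Proof.
move=> pI dI; rewrite Lp_norm_disjoint.
  apply: eq_bigr => k _; have [iso _] := pI k.
  by rewrite -!rnorm_Lp (isometric_rnorm _ iso).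
move=> j k jk; have [_ [A mA IA]] := pI j; have [_ [B mB IB]] := pI k.
have : mu (A `&` B) = 0%E.
  by apply: Lp_on_disjoint_null => //; rewrite -IA -IB; exact: dI.
move=> AB0; have aeAB : {ae mu, forall x, ~ (A `&` B) x}.
  exists (A `&` B); split => //; first exact: measurableI.
  by move=> x /= /contrapT.
have jA : Lp_on A (I j (zeta j)) by rewrite -IA; exists (zeta j).
have kB : Lp_on B (I k (zeta k)) by rewrite -IB; exists (zeta k).
apply: filterS3 aeAB jA kB => x nAB xA xB.
have [Ax|/xA ->] := pselect (A x); last by left.
by right; apply: xB => Bx; exact: nAB.
Qed.

End ProperIsometries.

Section LowerBound.
Context dX dY dZ (X : measurableType dX) (Y : measurableType dY)
  (Z : measurableType dZ) (R : realType).
Variable mu : {sigma_finite_measure set X -> \bar R}.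
Variable nu : {sigma_finite_measure set Y -> \bar R}.
Variable la : {sigma_finite_measure set Z -> \bar R}.
Variables (p q : R) (p1 : 1 <= p) (q1 : 1 <= q) (pq : p^-1 + q^-1 = 1).
Local Notation L := (Lp mu p1).
Variable i : {linear Lp (mu \x mu)%E p1 -> L}.
Hypothesis i_isometric : isometric i.

Let p0 : 0 < p := lt_le_trans ltr01 p1.

Lemma rnorm_slice_tdiam (u : tensor L (Lp nu q1)) (v : tensor L (Lp la q1))
    (g : {scalar LpAlg nu la q1}) (gm : {scalar tensor (Lp nu q1) (Lp la q1)}) :
  (forall w, normc (g w) <= rnorm w) -> gm =1 g \o @alg_map _ _ _ _ _ nu la q q1 ->
  rnorm (slice gm (tdiam i u v)) <= inj_norm u * inj_norm v.
Proof.
move=> gb gmE.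
have [n [xi [x ->]]] := tensor_sum_ord u; have [m [eta [y ->]]] := tensor_sum_ord v.
rewrite slice_tdiam (isometric_rnorm _ i_isometric).
under eq_bigr do rewrite gmE/= alg_map_tmul.
exact: Lp_norm_sum_prod_alg.
Qed.

(** Slicing commutes with the operators acting on [L], so the slice is a applied to a sum of the I_k
    of slices of u_k <> v_k. Disjointness makes the norm of that sum the l_p norm of the single
    ones. *)
Lemma inj_norm_amp_le n (a : {linear L -> L}) (I : 'I_n -> {linear L -> L})
    (u : 'I_n -> tensor L (Lp nu q1)) (v : 'I_n -> tensor L (Lp la q1)) :
  bounded_op a -> (forall k, proper_isometry (I k)) ->
  (forall j k, j != k -> disjoint_op (I j) (I k)) ->
  inj_norm (amp (@alg_map _ _ _ _ _ nu la q q1)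
    (act a (\sum_k act (I k) (tdiam i (u k) (v k))))) <=
  opnorm a * (\sum_k inj_norm (u k) `^ p * inj_norm (v k) `^ p) `^ p^-1.
Proof.
move=> ab pI dI; apply: inj_norm_le => g gb.
have gs : scalar (g \o @alg_map _ _ _ _ _ nu la q q1).
  by move=> c x y; rewrite /= !linearP.
rewrite slice_amp; pose gm := scalar_of gs.
rewrite [X in rnorm X](slice_act gm).
have -> : slice gm (\sum_k act (I k) (tdiam i (u k) (v k))) =
    \sum_k I k (slice gm (tdiam i (u k) (v k))).
  by rewrite [LHS]linear_sum; apply: eq_bigr => k _; exact: slice_act.
rewrite (le_trans (rnorm_opnorm _ ab))// ler_wpM2l ?opnorm_ge0//.
rewrite -(@ler_powR2r _ p) ?powR_ge0 ?rnorm_ge0// powRVK ?gt_eqF//; last first.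
  by apply: sumr_ge0 => k _; rewrite mulr_ge0 ?powR_ge0.
rewrite rnorm_Lp proper_isometries_norm//; apply: ler_sum => k _.
rewrite -powRM ?inj_norm_ge0// ler_powR2r ?Lp_norm_ge0 ?mulr_ge0 ?inj_norm_ge0//.
exact: (rnorm_slice_tdiam _ _ gb).
Qed.

End LowerBound.

(** * The projective norm is at most the injective norm *)

Section ProductPairing.
Context dS dT (S : measurableType dS) (T : measurableType dT) (R : realType).
Variables (nu : {sigma_finite_measure set S -> \bar R}).
Variables (la : {sigma_finite_measure set T -> \bar R}).

Lemma cintegrable_prod (f : S -> R[i]) (g : T -> R[i]) :
  cintegrable nu f -> cintegrable la g ->
  cintegrable (nu \x la)%E (fun z => f z.1 * g z.2).
Proof.
move=> fi gi.
have mf := cintegrable_cmeasurable fi; have mg := cintegrable_cmeasurable gi.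
have mfg : cmeasurable (fun z : S * T => f z.1 * g z.2).
  by apply: cmeasurableM; [exact: cmeasurable_fst|exact: cmeasurable_snd].
apply: (@cintegrable_le _ _ _ _ _ (@normc R \o (fun z => f z.1 * g z.2))) => //.
apply/integrable12ltyP; first exact/measurable_EFinP/measurable_normc.
have /integrableP[_ nf] := integrable_normc fi.
have /integrableP[_ ng] := integrable_normc gi.
have I0 d (U : measurableType d) (m : {measure set U -> \bar R}) (h : U -> R[i]) :
    (0 <= \int[m]_y `|(EFin \o (@normc R \o h)) y|)%E.
  by apply: integral_ge0.
have mn d (U : measurableType d) (h : U -> R[i]) : cmeasurable h ->
    measurable_fun setT (fun y => `|(EFin \o (@normc R \o h)) y|)%E.
  by move=> mh; apply: measurableT_comp => //; exact/measurable_EFinP/measurable_normc.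
under eq_integral => x _.
  under eq_integral => y _.
    rewrite (_ : `|_|%E = (`|(EFin \o (@normc R \o f)) x| *
      `|(EFin \o (@normc R \o g)) y|)%E); last by rewrite /= normc_mul normrM.
    over.
  rewrite ge0_integralZl//; last exact: mn.
  over.
rewrite ge0_integralZr//; last exact: mn.
by rewrite lte_mul_pinfty// ge0_fin_numE.
Qed.

(** Fubini's theorem is applied to the real and imaginary parts of the whole product; [cintZ]
    evaluates the inner integral as a complex number, which avoids expanding the parts of f g. *)
Lemma cint_prod (f : S -> R[i]) (g : T -> R[i]) :
  cintegrable nu f -> cintegrable la g ->
  cint (nu \x la)%E (fun z => f z.1 * g z.2) = cint nu f * cint la g.
Proof.
move=> fi gi; have [pr pim] := cintegrable_prod fi gi.
have inner x := cintZ (f x) gi.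
have iG x := cintegrableZ (f x) gi.
rewrite [RHS]mulrC -(cintZ (cint la g) fi) /cint; congr (_ +i* _)%C.
- rewrite /Rintegral -(integral12_prod_meas1 pr); congr fine.
  apply: eq_integral => x _; rewrite mulrC -inner /cint/= /fubini_F/=.
  by rewrite fineK//; apply: integrable_fin_num => //; exact: (iG x).1.
- rewrite /Rintegral -(integral12_prod_meas1 pim); congr fine.
  apply: eq_integral => x _; rewrite mulrC -inner /cint/= /fubini_F/=.
  by rewrite fineK//; apply: integrable_fin_num => //; exact: (iG x).2.
Qed.

Variables (p q : R) (p1 : 1 <= p) (q1 : 1 <= q) (pq : p^-1 + q^-1 = 1).

Lemma pair_Lp_prod (x : Lp nu p1) (y : Lp la p1) (u : Lp nu q1) (v : Lp la q1) :
  pair (Lp_prod x y) (Lp_prod u v) = pair x u * pair y v.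
Proof.
rewrite {2 3}/pair -cint_prod; [|exact: cintegrable_pair|exact: cintegrable_pair].
apply: cint_ae.
- by apply: cmeasurableM; exact: LpFun_cmeasurable.
- exact: cintegrable_cmeasurable
    (cintegrable_prod (cintegrable_pair pq x u) (cintegrable_pair pq y v)).
- have := Lp_repr_pi (Lp_prod_fun (repr x) (repr y)).
  have := Lp_repr_pi (Lp_prod_fun (repr u) (repr v)).
  by apply: filterS2 => z /= -> ->; rewrite mulrACA.
Qed.

End ProductPairing.

Section UpperBound.
Context dX dY dZ (X : measurableType dX) (Y : measurableType dY)
  (Z : measurableType dZ) (R : realType).
Variable mu : {sigma_finite_measure set X -> \bar R}.
Variable nu : {sigma_finite_measure set Y -> \bar R}.
Variable la : {sigma_finite_measure set Z -> \bar R}.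
Variables (p q : R) (p1 : 1 <= p) (q1 : 1 <= q) (pq : p^-1 + q^-1 = 1).
Local Notation L := (Lp mu p1).
Variable i : {linear Lp (mu \x mu)%E p1 -> L}.
Hypothesis i_isometric : isometric i.
Hypothesis i_bijective : bijective i.

Let p0 : 0 < p := lt_le_trans ltr01 p1.
Let qp : q^-1 + p^-1 = 1. Proof. by rewrite addrC. Qed.

Local Notation pLn := (pL_norm i (@inj_norm R L (Lp nu q1)) (@inj_norm R L (Lp la q1))).

Lemma act_id (E : lmodType R[i]) (u : tensor L E) :
  act (idfun : {linear L -> L}) u = u.
Proof.
have lid : linear (@id (tensor L E)) by [].
have la_ := tmap_is_linear (idfun : {linear L -> L}) (idfun : {linear E -> E}).
apply: (@tensor_ext _ _ _ _ (act idfun) id) => // x y.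
by rewrite [LHS](tmap_tmul (idfun : {linear L -> L}) (idfun : {linear E -> E})).
Qed.

Lemma proper_isometry_id : proper_isometry (idfun : {linear L -> L}).
Proof.
split=> //; exists setT => //.
apply/seteqP; split=> [xi _|xi _]; last by exists xi.
by apply: aeW => x nT; exfalso; exact: nT.
Qed.

(* The representations over which the infimum defining pL_norm is taken. *)
Definition pL_representation (U : tensor L (tensor (Lp nu q1) (Lp la q1))) (r : R) :=
  exists (n : nat) (a : {linear L -> L}) (I : 'I_n -> {linear L -> L})
      (u : 'I_n -> tensor L (Lp nu q1)) (v : 'I_n -> tensor L (Lp la q1)),
    [/\ bounded_op a,
        forall k, proper_isometry (I k),
        forall j k, j != k -> disjoint_op (I j) (I k),
        U = act a (\sum_k act (I k) (tdiam i (u k) (v k))) &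
        r = opnorm a * (\sum_k inj_norm (u k) `^ p * inj_norm (v k) `^ p) `^ p^-1].

(** A single product with the identity as its only isometry, which is proper with image L_p(X). The
    upper bound uses representations of this form only. *)
Lemma pL_representation_one (a : {linear L -> L}) (u : tensor L (Lp nu q1))
    (v : tensor L (Lp la q1)) : bounded_op a ->
  pL_representation (act a (tdiam i u v)) (opnorm a * (inj_norm u * inj_norm v)).
Proof.
move=> ab; exists 1%N, a, (fun=> idfun), (fun=> u), (fun=> v); split => //.
- by move=> _; exact: proper_isometry_id.
- by move=> j k; rewrite !ord1 eqxx.
- by rewrite big_ord1 act_id.
- by rewrite big_ord1 -powRM ?inj_norm_ge0// powRK ?gt_eqF// mulr_ge0 ?inj_norm_ge0.
Qed.

Lemma pL_norm_le (a : {linear L -> L}) (u : tensor L (Lp nu q1))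
    (v : tensor L (Lp la q1)) : bounded_op a ->
  pLn (act a (tdiam i u v)) <= opnorm a * (inj_norm u * inj_norm v).
Proof.
move=> ab; apply: ge_inf; last exact: pL_representation_one.
exists 0 => _ [n [b [I [u' [v' [bb _ _ _ ->]]]]]].
by rewrite mulr_ge0 ?powR_ge0// opnorm_ge0.
Qed.

Section Factorization.
Variables (S T : finType) (A : S -> set X) (B : T -> set X).
Hypotheses (dA : disjoint_family mu A) (dB : disjoint_family mu B).
Variables (x : S -> Lp nu q1) (y : T -> Lp la q1) (th : S * T -> L).

Let u := \sum_s tmul (nind mu p1 (A s)) (x s).
Let v := \sum_t tmul (nind mu p1 (B t)) (y t).

(* The operator a is the averaging projection onto the span of the tensor
   products of the indicators, composed with the map given by th. *)
Lemma tdiam_factor (M : R) : 0 <= M ->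
  (forall c : S * T -> R[i],
     Lp_norm (\sum_k c k *: th k) <= M * (\sum_k normc (c k) `^ p) `^ p^-1) ->
  exists a : {linear L -> L}, (forall w, rnorm (a w) <= M * rnorm w) /\
    \sum_k tmul (th k) (tmul (x k.1) (y k.2)) = act a (tdiam i u v).
Proof.
move=> M0 thM.
have [j ij ji] := i_bijective.
have jl : linear j by exact: (can2_linear ij ji).
have jiso w : Lp_norm (j w) = Lp_norm w.
  by rewrite -[in RHS](ji w) -!rnorm_Lp (isometric_rnorm _ i_isometric).
have dAB := disjoint_family_setX dA dB.
pose C (k : S * T) := A k.1 `*` B k.2.
(* The dual family reads off the coefficients of j w on the rectangles. Their l_p norm is at most
   |w| by [pair_nind_bessel], which gives |a| <= M. *)
pose a0 w := \sum_k pair (j w) (nind (mu \x mu)%E q1 (C k)) *: th k.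
have a0l : linear a0.
  move=> c w w'; rewrite /a0 scaler_sumr -big_split; apply: eq_bigr => k _ /=.
  by rewrite jl (pair_is_scalar pq) scalerDl scalerA.
pose a := linear_of a0l; exists a; split=> [w|].
  rewrite rnorm_Lp (le_trans (thM _))// ler_wpM2l// rnorm_Lp -jiso.
  rewrite -(@ler_powR2r _ p) ?powR_ge0 ?Lp_norm_ge0// powRVK ?gt_eqF//; last first.
    by apply: sumr_ge0 => k _; exact: powR_ge0.
  exact: (pair_nind_bessel q1 qp dAB (j w)).
rewrite /u /v tdiam_sum.
have al := tmap_is_linear a (idfun : {linear tensor (Lp nu q1) (Lp la q1) -> _}).
rewrite -[RHS]/(linear_of al _) linear_sum; apply: eq_bigr => k _.
rewrite [RHS](tmap_tmul a (idfun : {linear tensor (Lp nu q1) (Lp la q1) -> _}))/=.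
congr tmul; rewrite /a0 ij (Lp_prod_nind p1 (dA.1 _) (dB.1 _)).
rewrite (bigD1 k)//= (pair_nind p1 q1 pq k k dAB) eqxx scale1r big1 ?addr0// => l lk.
by rewrite (pair_nind p1 q1 pq k l dAB) eq_sym (negbTE lk) scale0r.
Qed.

Lemma pL_norm_factor (M N1 N2 : R) : 0 <= M -> 0 <= N1 -> 0 <= N2 ->
  (forall c : S * T -> R[i],
     Lp_norm (\sum_k c k *: th k) <= M * (\sum_k normc (c k) `^ p) `^ p^-1) ->
  (forall g : {scalar Lp nu q1}, (forall w, normc (g w) <= rnorm w) ->
     Lp_norm (\sum_s g (x s) *: nind mu p1 (A s)) <= N1) ->
  (forall g : {scalar Lp la q1}, (forall w, normc (g w) <= rnorm w) ->
     Lp_norm (\sum_t g (y t) *: nind mu p1 (B t)) <= N2) ->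
  pLn (\sum_k tmul (th k) (tmul (x k.1) (y k.2))) <= M * (N1 * N2).
Proof.
move=> M0 N10 N20 thM xN1 yN2.
have [a [aM ->]] := tdiam_factor M0 thM.
have ab : bounded_op a by exists M.
have uN : inj_norm u <= N1.
  by apply: inj_norm_le => g gb; rewrite slice_sum rnorm_Lp; exact: xN1.
have vN : inj_norm v <= N2.
  by apply: inj_norm_le => g gb; rewrite slice_sum rnorm_Lp; exact: yN2.
apply: le_trans (pL_norm_le _ _ ab) _.
rewrite ler_pM ?ler_pM ?opnorm_ge0 ?mulr_ge0 ?inj_norm_ge0//.
exact: opnorm_le.
Qed.

End Factorization.

End UpperBound.

(** * Factorizations with an absorbed remainder, and the passage to the limit *)

Section BlockSums.
Variables (I I' J : finType).

Lemma sum_block (V : nmodType) (F : (I + J) * (I' + J) -> V) :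
  (forall a l, F (inl a, inr l) = 0) -> (forall j b, F (inr j, inl b) = 0) ->
  (forall j l, j != l -> F (inr j, inr l) = 0) ->
  \sum_k F k = \sum_(k : I * I') F (inl k.1, inl k.2) + \sum_j F (inr j, inr j).
Proof.
move=> F1 F2 F3.
rewrite [LHS](_ : _ = \sum_s \sum_t F (s, t)); last first.
  by rewrite pair_big; apply: eq_bigr => -[].
rewrite big_sumType/=; congr (_ + _).
  rewrite -(pair_big xpredT xpredT (fun a b => F (inl a, inl b)))/=.
  apply: eq_bigr => a _; rewrite big_sumType/= [X in _ + X]big1 ?addr0//.
apply: eq_bigr => j _; rewrite big_sumType/= big1 ?add0r//.
by rewrite (bigD1 j)//= big1 ?addr0// => l lj; rewrite F3// eq_sym.
Qed.

Lemma ler_sum_block (R : numDomainType) (F : (I + J) * (I' + J) -> R) :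
  (forall k, 0 <= F k) ->
  \sum_(k : I * I') F (inl k.1, inl k.2) <= \sum_k F k.
Proof.
move=> F0; rewrite [leRHS](_ : _ = \sum_s \sum_t F (s, t)); last first.
  by rewrite pair_big; apply: eq_bigr => -[].
rewrite big_sumType/= ler_wpDr ?sumr_ge0//; first by move=> j _; exact: sumr_ge0.
rewrite -(pair_big xpredT xpredT (fun a b => F (inl a, inl b)))/=.
by apply: ler_sum => a _; rewrite big_sumType/= lerDl sumr_ge0.
Qed.

End BlockSums.

Lemma sum_bool_prod (V : nmodType) (J : finType) (F : bool * J -> V) :
  \sum_k F k = \sum_j F (true, j) + \sum_j F (false, j).
Proof.
transitivity (\sum_b \sum_j F (b, j)); last by rewrite big_bool.
by rewrite pair_big; apply: eq_bigr => -[].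
Qed.

Lemma limit_product_bound (R : realType) (r w C : R) : 0 <= w -> 0 <= C ->
  (forall t, 0 < t -> t <= 1 ->
     r <= (w + t * C) * ((1 + t * C) * (1 + t * C))) -> r <= w.
Proof.
move=> w0 C0 rt; apply/ler_addgt0Pr => e e0.
(* The sum of the coefficients of t, t^2 and t^3 in the expanded product; for t <= 1 the product
   exceeds w by at most t K. *)
pose K := 2 * C * w + C ^+ 2 * w + C + 2 * C ^+ 2 + C ^+ 3.
have K0 : 0 <= K by rewrite /K !addr_ge0// ?mulr_ge0 ?exprn_ge0.
pose t := Num.min 1 (e / (K + 1)).
have K1 : 0 < K + 1 by rewrite ltr_wpDl.
have t0 : 0 < t by rewrite lt_min ltr01 divr_gt0.
have t1 : t <= 1 by rewrite ge_min lexx.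
have tK : t * K <= e.
  have : t <= e / (K + 1) by rewrite ge_min lexx orbT.
  rewrite ler_pdivlMr// => h; apply: le_trans h.
  by rewrite ler_pM2l// lerDl.
apply: (le_trans (rt t t0 t1)); apply: le_trans (lerD (lexx w) tK).
have t2 : t ^+ 2 <= t by rewrite expr2 ler_piMl// ltW.
have t3 : t ^+ 3 <= t by rewrite exprS (le_trans _ t2)// expr2 ler_wpM2l// ltW.
have -> : (w + t * C) * ((1 + t * C) * (1 + t * C)) =
  w + (t * (2 * C * w + C) + t ^+ 2 * (C ^+ 2 * w + 2 * C ^+ 2) + t ^+ 3 * C ^+ 3).
  by ring.
rewrite lerD2l (_ : t * K = t * (2 * C * w + C) +
  t * (C ^+ 2 * w + 2 * C ^+ 2) + t * C ^+ 3); last by rewrite /K; ring.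
by rewrite !lerD// ler_wpM2r// ?addr_ge0 ?mulr_ge0 ?exprn_ge0.
Qed.

Lemma sum_scalar_nind d (T : measurableType d) (R : realType)
    (mu : {measure set T -> \bar R}) (p q : R) (p1 : 1 <= p) (q1 : 1 <= q)
    (pq : p^-1 + q^-1 = 1) (I : finType) (A : I -> set T)
    (g : {scalar Lp mu q1}) :
  disjoint_family mu A -> (forall w, normc (g w) <= rnorm w) ->
  \sum_a normc (g (nind mu q1 (A a))) `^ p <= 1.
Proof.
move=> dA gb; rewrite (_ : 1 = 1 `^ p); last by rewrite powR1.
apply: (finite_duality p1 q1 pq) => // t.
under eq_bigr do rewrite -[_ * _]/(t _ *: _) -linearZ.
rewrite -linear_sum mul1r (le_trans (gb _))// rnorm_Lp.
rewrite -(Lp_norm_sum_nind q1 t dA).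
by rewrite powRK ?Lp_norm_ge0// gt_eqF// (lt_le_trans ltr01).
Qed.

Lemma normc_le_lp (R : realType) (p : R) (I : finType) (c : I -> R[i]) k : 0 < p ->
  normc (c k) <= (\sum_l normc (c l) `^ p) `^ p^-1.
Proof.
move=> p0; have s0 : 0 <= \sum_l normc (c l) `^ p.
  by apply: sumr_ge0 => l _; exact: powR_ge0.
rewrite -(@ler_powR2r _ p) ?normc_ge0 ?powR_ge0// powRVK ?gt_eqF//.
by rewrite (bigD1 k)//= lerDl sumr_ge0// => l _; exact: powR_ge0.
Qed.

Section Perturbation.
Context dX dY dZ (X : measurableType dX) (Y : measurableType dY)
  (Z : measurableType dZ) (R : realType).
Variable mu : {sigma_finite_measure set X -> \bar R}.
Variable nu : {sigma_finite_measure set Y -> \bar R}.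
Variable la : {sigma_finite_measure set Z -> \bar R}.
Variables (p q : R) (p1 : 1 <= p) (q1 : 1 <= q) (pq : p^-1 + q^-1 = 1).
Local Notation L := (Lp mu p1).
Variable i : {linear Lp (mu \x mu)%E p1 -> L}.
Hypothesis i_isometric : isometric i.
Hypothesis i_bijective : bijective i.
Hypothesis many : forall I : finType, exists A : I -> set X, disjoint_family mu A.

Let p0 : 0 < p := lt_le_trans ltr01 p1.
Let qp : q^-1 + p^-1 = 1. Proof. by rewrite addrC. Qed.

Local Notation pLn := (pL_norm i (@inj_norm R L (Lp nu q1)) (@inj_norm R L (Lp la q1))).

(** Bounds the slices of u, and equally those of v. The indicator block contributes at most 1 by
    [sum_scalar_nind], and each further term at most |x'_j|. *)
Lemma Lp_norm_block dT (T : measurableType dT) (ka : {measure set T -> \bar R})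
    (I J : finType) (A : I -> set T) (D : I + J -> set X) (x' : J -> Lp ka q1)
    (g : {scalar Lp ka q1}) :
  disjoint_family ka A -> disjoint_family mu D ->
  (forall w, normc (g w) <= rnorm w) ->
  Lp_norm (\sum_s g (match s with inl a => nind ka q1 (A a) | inr j => x' j end)
    *: nind mu p1 (D s)) <= 1 + \sum_j rnorm (x' j).
Proof.
move=> dA [D1 D2] gb; rewrite big_sumType/= -rnorm_Lp.
rewrite (le_trans (rnormD _ _))// lerD//.
  have dD : disjoint_family mu (fun a => D (inl a)).
    by split=> // j k jk; apply: D2; apply: contra jk => /eqP [->].
  rewrite rnorm_Lp -(@ler_powR2r _ p) ?Lp_norm_ge0//.
  by rewrite (Lp_norm_sum_nind p1 _ dD) powR1; exact: (sum_scalar_nind p1 pq dA).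
rewrite (le_trans (rnorm_sum _ _))//; apply: ler_sum => j _.
by rewrite rnormZ rnorm_Lp Lp_norm_nind// mulr1.
Qed.

(* Each term z_j (x'_j y'_j) gets disjoint indicators of its own, so that the
   perturbed tensor is again of the form a (u <> v). *)
Lemma pL_norm_perturb (I I' J : finType) (A : I -> set Y) (B : I' -> set Z)
    (th : I * I' -> L) (M : R) (z : J -> L) (x' : J -> Lp nu q1)
    (y' : J -> Lp la q1) :
  disjoint_family nu A -> disjoint_family la B -> 0 <= M ->
  (forall c : I * I' -> R[i],
     Lp_norm (\sum_k c k *: th k) <= M * (\sum_k normc (c k) `^ p) `^ p^-1) ->
  pLn (\sum_k tmul (th k) (tmul (nind nu q1 (A k.1)) (nind la q1 (B k.2))) +
       \sum_j tmul (z j) (tmul (x' j) (y' j))) <=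
  (M + \sum_j rnorm (z j)) * ((1 + \sum_j rnorm (x' j)) * (1 + \sum_j rnorm (y' j))).
Proof.
move=> dA dB M0 thM.
have [D dD] := many (I + J)%type; have [D' dD'] := many (I' + J)%type.
pose Xs (s : I + J) := match s with inl a => nind nu q1 (A a) | inr j => x' j end.
pose Yt (t : I' + J) := match t with inl b => nind la q1 (B b) | inr j => y' j end.
(* The product u <> v also contains mixed terms and the products of x'_j with y'_l for j different
   from l; a block-diagonal array of values lets the operator a kill them. *)
pose Th (k : (I + J) * (I' + J)) : L := match k with
  | (inl a, inl b) => th (a, b)
  | (inr j, inr l) => if j == l then z j else 0
  | _ => 0 end.
have -> : \sum_k tmul (th k) (tmul (nind nu q1 (A k.1)) (nind la q1 (B k.2))) +
       \sum_j tmul (z j) (tmul (x' j) (y' j)) =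
    \sum_k tmul (Th k) (tmul (Xs k.1) (Yt k.2)).
  rewrite [RHS]sum_block/=.
  - congr (_ + _); first by apply: eq_bigr => -[].
    by apply: eq_bigr => j _; rewrite eqxx.
  - by move=> *; rewrite linear0l.
  - by move=> *; rewrite linear0l.
  - by move=> j l jl; rewrite (negbTE jl) linear0l.
have s0 (V : normedModType R[i]) (F : J -> V) : 0 <= \sum_j rnorm (F j).
  by apply: sumr_ge0 => j _; exact: rnorm_ge0.
apply: (pL_norm_factor pq i_isometric i_bijective dD dD') => //.
- by rewrite addr_ge0.
- by rewrite addr_ge0.
- by rewrite addr_ge0.
- move=> c; rewrite [X in Lp_norm X]sum_block/=.
  + rewrite mulrDl -rnorm_Lp (le_trans (rnormD _ _))// lerD//.
      have := thM (fun k => c (inl k.1, inl k.2)).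
      rewrite -rnorm_Lp (_ : \sum_k _ =
        \sum_(i0 : I * I') c (inl i0.1, inl i0.2) *: th (i0.1, i0.2)); last first.
        by apply: eq_bigr => -[].
      move=> /le_trans; apply; rewrite ler_wpM2l// ge0_ler_powR ?invr_ge0 ?(ltW p0)//.
      * by rewrite nnegrE sumr_ge0// => k _; exact: powR_ge0.
      * by rewrite nnegrE sumr_ge0// => k _; exact: powR_ge0.
      * apply: (ler_sum_block (F := fun k => normc (c k) `^ p)) => k.
        exact: powR_ge0.
    rewrite mulr_suml (le_trans (rnorm_sum _ _))//; apply: ler_sum => j _.
    rewrite eqxx rnormZ mulrC ler_wpM2l ?rnorm_ge0//.
    exact: normc_le_lp.
  + by move=> *; rewrite scaler0.
  + by move=> *; rewrite scaler0.
  + by move=> j l jl; rewrite (negbTE jl) scaler0.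
- by move=> g gb; exact: Lp_norm_block.
- by move=> g gb; exact: Lp_norm_block.
Qed.

(** The inner sums are the coefficients theta of the conditioned tensor. Their combination with
    scalars c is the slice of the unconditioned tensor by the pairing with sum c_k e_k in L_p(Y x
    Z), which has norm |c|_p; so |a| is bounded by the injective norm of U itself, without an error
    term. *)
Lemma Lp_norm_sum_coeff (I I' K : finType) (A : I -> set Y) (B : I' -> set Z)
    (xi : K -> L) (x : K -> Lp nu q1) (y : K -> Lp la q1) (c : I * I' -> R[i]) :
  disjoint_family nu A -> disjoint_family la B ->
  Lp_norm (\sum_k c k *: \sum_m (pair (x m) (nind nu p1 (A k.1)) *
      pair (y m) (nind la p1 (B k.2))) *: xi m) <=
  inj_norm (\sum_m tmul (xi m) (alg_prod (x m) (y m))) *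
    (\sum_k normc (c k) `^ p) `^ p^-1.
Proof.
move=> dA dB; have dAB := disjoint_family_setX dA dB.
pose e k := nind (nu \x la)%E p1 (A k.1 `*` B k.2).
pose h0 (w : LpAlg nu la q1) := pair (val w) (\sum_k c k *: e k).
have h0s : scalar h0 by move=> a u v; rewrite /h0 linearP (pair_is_scalar qp).
have hE m : h0 (alg_prod (x m) (y m)) = \sum_k c k *
    (pair (x m) (nind nu p1 (A k.1)) * pair (y m) (nind la p1 (B k.2))).
  rewrite /h0 (pair_sumr qp)/=; apply: eq_bigr => k _; congr (_ * _).
  by rewrite /e -(Lp_prod_nind p1 (dA.1 _) (dB.1 _)) pair_Lp_prod.
rewrite (_ : \sum_k _ = slice (scalar_of h0s)
    (\sum_m tmul (xi m) (alg_prod (x m) (y m)))); last first.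
  rewrite slice_sum; under [RHS]eq_bigr do rewrite [scalar_of _ _]hE scaler_suml.
  rewrite exchange_big/=; apply: eq_bigr => k _; rewrite scaler_sumr.
  by apply: eq_bigr => m _; rewrite scalerA.
rewrite -(Lp_norm_sum_nind p1 c dAB) powRK ?Lp_norm_ge0 ?gt_eqF// mulrC -rnorm_Lp.
apply: (rnorm_slice_scaled (norming_Lp q1 pq)); first exact: Lp_norm_ge0.
by move=> w; rewrite mulrC; exact: normc_pair.
Qed.

End Perturbation.

Section UpperBoundLimit.
Context dX dY dZ (X : measurableType dX) (Y : measurableType dY)
  (Z : measurableType dZ) (R : realType).
Variable mu : {sigma_finite_measure set X -> \bar R}.
Variable nu : {sigma_finite_measure set Y -> \bar R}.
Variable la : {sigma_finite_measure set Z -> \bar R}.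
Variables (p q : R) (p1 : 1 <= p) (q1 : 1 <= q) (pq : p^-1 + q^-1 = 1).
Local Notation L := (Lp mu p1).
Variable i : {linear Lp (mu \x mu)%E p1 -> L}.
Hypothesis i_isometric : isometric i.
Hypothesis i_bijective : bijective i.
Hypothesis many : forall I : finType, exists A : I -> set X, disjoint_family mu A.

Local Notation pLn := (pL_norm i (@inj_norm R L (Lp nu q1)) (@inj_norm R L (Lp la q1))).

(* With z = t xi, one factor of size O(t^-2 t^3) and the other of size O(t), the
   error terms of the conditioning contribute O(t) to all three norms. *)
Lemma pL_norm_upper (U : tensor L (tensor (Lp nu q1) (Lp la q1))) :
  pLn U <= inj_norm (amp (@alg_map _ _ _ _ _ nu la q q1) U).
Proof.
have [n [xi [x [y ->]]]] := tensor3_sum_ord U.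
set W := amp _ _.
have WE : W = \sum_m tmul (xi m) (alg_prod (x m) (y m)).
  have al := tmap_is_linear (idfun : {linear L -> L}) (@alg_map _ _ _ _ _ nu la q q1).
  rewrite /W -[LHS]/(linear_of al _) linear_sum; apply: eq_bigr => m _.
  by rewrite [LHS](tmap_tmul (idfun : {linear L -> L})) /= alg_map_tmul.
(* One constant for three estimates. The factor 2 counts the two corrections per term; in 1 + |x m|
   the 1 comes from the rescaled difference and |x m| from its conditional expectation, and for y m
   from y m itself. *)
pose C := 2 * \sum_m rnorm (xi m) + \sum_m (1 + rnorm (x m)) + \sum_m (1 + rnorm (y m)).
have sx : 0 <= 2 * \sum_m rnorm (xi m).
  by rewrite mulr_ge0// sumr_ge0// => m _; exact: rnorm_ge0.
have s1x : 0 <= \sum_m (1 + rnorm (x m)).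
  by rewrite sumr_ge0// => m _; rewrite addr_ge0 ?rnorm_ge0.
have s1y : 0 <= \sum_m (1 + rnorm (y m)).
  by rewrite sumr_ge0// => m _; rewrite addr_ge0 ?rnorm_ge0.
have C0 : 0 <= C by rewrite !addr_ge0.
apply: (limit_product_bound (inj_norm_ge0 _) C0) => t t0 t1.
have t30 : 0 < t ^+ 3 by rewrite exprn_gt0.
have [I [A [dA Ax]]] := Lp_condexp_approx p1 pq x t30.
have [I' [B [dB By]]] := Lp_condexp_approx p1 pq y t30.
pose th (k : I * I') : L := \sum_m (pair (x m) (nind nu p1 (A k.1)) *
      pair (y m) (nind la p1 (B k.2))) *: xi m.
pose Ex m := condexp p1 A (x m); pose Ey m := condexp p1 B (y m).
pose tc : R[i] := (t%:C)%C; pose tv : R[i] := ((t ^- 2)%:C)%C.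
(* The Boolean selects one of the two corrections in [tmul_split]: [true] the one with x - Ex,
   [false] the one with y - Ey. *)
pose z (j : bool * 'I_n) : L := tc *: xi j.2.
pose x' (j : bool * 'I_n) := if j.1 then tv *: (x j.2 - Ex j.2) else tc *: Ex j.2.
pose y' (j : bool * 'I_n) := if j.1 then tc *: y j.2 else tv *: (y j.2 - Ey j.2).
have ntc : normc tc = t by rewrite normc_real gtr0_norm.
have ntv : normc tv = t ^- 2 by rewrite normc_real ger0_norm// invr_ge0 exprn_ge0 ?ltW.
have -> : \sum_m tmul (xi m) (tmul (x m) (y m)) =
  \sum_k tmul (th k) (tmul (nind nu q1 (A k.1)) (nind la q1 (B k.2))) +
  \sum_j tmul (z j) (tmul (x' j) (y' j)).
  rewrite sum_bool_prod/= addrA.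
  have -> : \sum_k tmul (th k) (tmul (nind nu q1 (A k.1)) (nind la q1 (B k.2))) =
      \sum_m tmul (xi m) (tmul (Ex m) (Ey m)).
    under eq_bigr do rewrite /th linear_sumlz.
    rewrite exchange_big/=; apply: eq_bigr => m _.
    rewrite /Ex /Ey /condexp bilinear_sumZ linear_sumr; apply: eq_bigr => k _.
    by rewrite linearZl_LR linearZr_LR.
  rewrite -!big_split/=; apply: eq_bigr => m _.
  by apply: tmul_split; rewrite gt_eqF.
have thM c : Lp_norm (\sum_k c k *: th k) <=
    inj_norm W * (\sum_k normc (c k) `^ p) `^ p^-1.
  by rewrite WE; exact: Lp_norm_sum_coeff.
have := pL_norm_perturb pq i_isometric i_bijective many z x' y' dA dB
  (inj_norm_ge0 W) thM.
move=> /le_trans; apply.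
have tv3 : t ^- 2 * t ^+ 3 = t by field; rewrite gt_eqF.
have small (r : R) : r <= t ^+ 3 -> t ^- 2 * r <= t.
  by move=> h; rewrite -[leRHS]tv3 ler_wpM2l// invr_ge0 exprn_ge0 ?ltW.
have zC : \sum_j rnorm (z j) <= t * C.
  rewrite sum_bool_prod/= -big_split/=.
  apply: (@le_trans _ _ (t * (2 * \sum_m rnorm (xi m)))).
    rewrite mulrA mulr_sumr; apply: ler_sum => m _.
    by rewrite /z rnormZ ntc; lra.
  by rewrite ler_wpM2l ?(ltW t0)// /C -addrA lerDl addr_ge0.
have xC : \sum_j rnorm (x' j) <= t * C.
  rewrite sum_bool_prod/= -big_split/=.
  apply: (@le_trans _ _ (t * (\sum_m (1 + rnorm (x m))))).
    rewrite mulr_sumr; apply: ler_sum => m _.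
    rewrite /x'/= !rnormZ ntc ntv mulrDr mulr1 lerD//.
      by apply: small; exact: Ax.
    by rewrite ler_wpM2l ?(ltW t0)//; exact: Lp_norm_condexp.
  by rewrite ler_wpM2l ?(ltW t0)// /C; lra.
have yC : \sum_j rnorm (y' j) <= t * C.
  rewrite sum_bool_prod/= -big_split/=.
  apply: (@le_trans _ _ (t * (\sum_m (1 + rnorm (y m))))).
    rewrite mulr_sumr; apply: ler_sum => m _.
    rewrite /y'/= !rnormZ ntc ntv mulrDr mulr1 addrC lerD//.
    by apply: small; exact: By.
  by rewrite ler_wpM2l ?(ltW t0)// /C; lra.
have s0 (V : normedModType R[i]) (F : bool * 'I_n -> V) : 0 <= \sum_j rnorm (F j).
  by apply: sumr_ge0 => j _; exact: rnorm_ge0.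
by rewrite !ler_pM ?lerD ?mulr_ge0 ?addr_ge0 ?inj_norm_ge0 ?s0//.
Qed.

Lemma pL_norm_lower (U : tensor L (tensor (Lp nu q1) (Lp la q1))) :
  inj_norm (amp (@alg_map _ _ _ _ _ nu la q q1) U) <= pLn U.
Proof.
(* A lower bound passes to [inf] only for a nonempty set, so some representation has to be
   exhibited; its cost is irrelevant. *)
have [r Ur] : exists r, pL_representation i U r.
  have [n [xi [x [y ->]]]] := tensor3_sum_ord U.
  have [A dA] := many 'I_n.
  (* The factorization runs over all pairs of indices; the diagonal array keeps exactly the terms of
     U. *)
  pose th (k : 'I_n * 'I_n) : L := if k.1 == k.2 then xi k.1 else 0.
  have thM (c : 'I_n * 'I_n -> R[i]) : Lp_norm (\sum_k c k *: th k) <=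
      (\sum_k rnorm (th k)) * (\sum_k normc (c k) `^ p) `^ p^-1.
    rewrite -rnorm_Lp (le_trans (rnorm_sum _ _))// mulr_suml.
    apply: ler_sum => k _; rewrite rnormZ mulrC ler_wpM2l ?rnorm_ge0//.
    by apply: normc_le_lp; exact: lt_le_trans ltr01 p1.
  have M0 : 0 <= \sum_k rnorm (th k) by apply: sumr_ge0 => k _; exact: rnorm_ge0.
  have [a [aM aE]] := tdiam_factor pq i_isometric i_bijective dA dA x y M0 thM.
  have -> : \sum_m tmul (xi m) (tmul (x m) (y m)) =
      \sum_(k : 'I_n * 'I_n) tmul (th k) (tmul (x k.1) (y k.2)).
    rewrite [RHS](_ : _ = \sum_j \sum_l tmul (th (j, l)) (tmul (x j) (y l))).
      apply: eq_bigr => m _; rewrite (bigD1 m)//= big1 ?addr0 /th/= ?eqxx// => l lm.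
      by rewrite eq_sym (negbTE lm) linear0l.
    by rewrite pair_big; apply: eq_bigr => -[].
  by rewrite aE; eexists; apply: pL_representation_one; eexists; exact: aM.
apply: lb_le_inf; first by exists r.
move=> _ [m [a [J [u [v [ab pJ dJ -> ->]]]]]].
exact: inj_norm_amp_le.
Qed.

End UpperBoundLimit.

Theorem theorem6p4 (R : realType) (p : R) (p1 : 1 < p)
  (dX dY dZ : measure_display)
  (X : measurableType dX) (Y : measurableType dY) (Z : measurableType dZ)
  (mu : {sigma_finite_measure set X -> \bar R})
  (nu : {sigma_finite_measure set Y -> \bar R})
  (la : {sigma_finite_measure set Z -> \bar R})
  (mu_basis : countable_basis mu)
  (nu_basis : countable_basis nu)
  (la_basis : countable_basis la)
  (mu_gt0 : (0 < mu [set: X])%E)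
  (mu_convenient : convenient mu)
  (i : {linear Lp (mu \x mu)%E (ltW p1) -> Lp mu (ltW p1)})
  (i_isometric : isometric i) (i_bijective : bijective i) :
  let L := Lp mu (ltW p1) in
  let LqY := Lp nu (conj_exp_ge1 p1) in
  let LqZ := Lp la (conj_exp_ge1 p1) in
  let LqYZ := LpAlg nu la (conj_exp_ge1 p1) in
  exists phi : {linear tensor LqY LqZ -> LqYZ},
    (forall (x : LqY) (y : LqZ), LpAlg_val (phi (tmul x y)) = Lp_prod x y) /\
    L_isometric_iso
      (pL_norm i (@inj_norm R L LqY) (@inj_norm R L LqZ))
      (@inj_norm R L LqYZ)
      phi.
Proof.
move=> L LqY LqZ LqYZ.
have pq := conj_exp_inv p1.
have qp : (conj_exp p)^-1 + p^-1 = 1 by rewrite addrC.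
have many (I : finType) : exists A : I -> set X, disjoint_family mu A.
  exact: convenient_disjoint_family.
exists (@alg_map _ _ _ _ _ nu la _ (conj_exp_ge1 p1)); split.
  by move=> x y; exact: alg_map_val.
split=> [|U].
  by apply: amp_bij; exact: (@alg_map_bij _ _ _ _ _ nu la _ _ _ (ltW p1) qp).
apply/eqP; rewrite eq_le; apply/andP; split.
- exact: (pL_norm_lower pq).
- exact: (pL_norm_upper pq).
Qed.
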